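(* Let $n$ be a positive integer, let $\mathbf{S}^2_n$ be the sphere centered at the origin of $\mathbf{R}^3$ with surface area $n$, and let $\mathcal{L}\subset\mathbf{S}^2_n$ be a set of $n$ distinct points. Then the gravitational allocation $\psi:\mathbf{S}^2_n\to\mathcal{L}\cup\{\infty\}$ is a fair allocation of $\lambda_n$ to $\mathcal{L}$; that is, $\psi$ is measurable, $\lambda_n(\psi^{-1}(\infty))=0$, and $\lambda_n(\psi^{-1}(z))=1$ for every $z\in\mathcal{L}$.
   Context: $\lambda_n$ denotes surface area measure on $\mathbf{S}^2_n$, so $\lambda_n(\mathbf{S}^2_n)=n$. $|\cdot|$ is the Euclidean norm in $\mathbf{R}^3$. Gravitational allocation: let $U(x)=\sum_{z\in\mathcal{L}}\log|x-z|$ on $\mathbf{S}^2_n$ and let $F(x)$ be the negative gradient of $U$ at $x\in\mathbf{S}^2_n\setminus\mathcal{L}$ with respect to the Riemannian metric induced from $\mathbf{R}^3$. For $x\in\mathbf{S}^2_n\setminus\mathcal{L}$ let $Y_x$ be the integral curve $\frac{dY_x}{dt}(t)=F(Y_x(t))$, $Y_x(0)=x$, on its maximal interval $(-\infty,\tau_x)$, $0<\tau_x\le\infty$. Define $\psi(x)=z$ if $\lim_{t\uparrow\tau_x}Y_x(t)=z$ with $z\in\mathcal{L}$, and $\psi(x)=\infty$ otherwise (with the convention $\psi(z)=z$ for $z\in\mathcal{L}$). *)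

(* Defs.v *)
From HB Require Import structures.
From mathcomp Require Import all_boot all_order all_algebra.
From mathcomp Require Import all_classical all_reals all_analysis.
From mathcomp Require Import measurable_realfun ring lra.
Set Implicit Arguments.
Unset Strict Implicit.
Unset Printing Implicit Defensive.
Import Order.TTheory GRing.Theory Num.Theory.
Import numFieldNormedType.Exports.
Local Open Scope classical_set_scope.
Local Open Scope ring_scope.

(* The library norm `|x| on 'rV[R]_3 is the sup norm (same topology). *)
Definition dotv {R : realType} (u v : 'rV[R]_3) : R :=
  \sum_(i < 3) u ord0 i * v ord0 i.

Definition enorm {R : realType} (x : 'rV[R]_3) : R := Num.sqrt (dotv x x).

Definition osphere {R : realType} (r : R) : set 'rV[R]_3 :=
  [set x | enorm x = r].

(* A sphere of radius r has area 4 pi r^2; see [sphere_area_total]. *)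
Definition radius_of_area {R : realType} (a : R) : R := Num.sqrt (a / (4 * pi)).

Definition borelR3 (R : realType) := g_sigma_algebraType (@open 'rV[R]_3).

Definition spherical {R : realType} (r : R) (p : R * R) : 'rV[R]_3 :=
  \row_(i < 3) nth 0 [:: r * (sin p.1 * cos p.2); r * (sin p.1 * sin p.2);
                         r * cos p.1] i.

Definition angles {R : realType} : set (R * R) :=
  `[0, pi] `*` `[0, 2 * pi].

(* Riemannian area of the part of A lying on the sphere of radius r, the area
   element in spherical coordinates being r^2 sin(phi) dphi dtheta. *)
Definition sphere_area {R : realType} (r : R) (A : set (borelR3 R)) : \bar R :=
  (\int[(@lebesgue_measure R \x @lebesgue_measure R)%E]_(p in angles)
     (r ^+ 2 * sin p.1 * \1_A (spherical r p))%:E)%E.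

Section sphere_area_measure.
Context {R : realType}.
Implicit Types (r : R) (A : set (borelR3 R)).

Let rat_box (c : 'rV[rat]_3 * nat) : set 'rV[R]_3 :=
  ball (map_mx ratr c.1 : 'rV[R]_3) (c.2.+1%:R^-1).

Lemma open_rat_boxes (U : set 'rV[R]_3) : open U ->
  U = \bigcup_c (if `[< rat_box c `<=` U >] then rat_box c else set0).
Proof.
move=> oU; apply/seteqP; split=> [x Ux|x [c _]]; last first.
  by case: asboolP => // cU /cU.
have /nbhs_ballP[e /= e0 xeU] : nbhs x U by exact: open_nbhs_nbhs.
have [k ke] : exists k, k.+1%:R^-1 < e / 2.
  have e20 : 0 < e / 2 by rewrite divr_gt0.
  exists (Num.truncn (e / 2)^-1).
  by rewrite invf_plt ?posrE// truncnS_gt.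
have k0 : 0 < k.+1%:R^-1 :> R by rewrite invr_gt0.
have /choice[q qP] i : exists q : rat, `|x ord0 i - ratr q| < k.+1%:R^-1.
  have := @rat_in_itvoo R (x ord0 i) (x ord0 i + k.+1%:R^-1).
  rewrite ltrDl => /(_ k0)[q]; rewrite in_itv/= => /andP[xq qx].
  by exists q; rewrite ltr0_norm ?subr_lt0// opprB ltrBlDl.
have bx : rat_box (\row_i q i, k) x.
  by split=> // i j; rewrite !mxE /ball/= (ord1 i) distrC; exact: qP.
exists (\row_i q i, k) => //; case: asboolP => // nU; exfalso; apply: nU.
move=> y by_; apply: xeU.
rewrite (splitr e); apply: (@ball_triangle _ _ (map_mx ratr (\row_i q i) : 'rV[R]_3)).
  by apply: ball_sym; apply: le_ball bx; exact: ltW.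
by apply: le_ball by_; exact: ltW.
Qed.

Lemma measurable_spherical r :
  measurable_fun setT (spherical r : R * R -> borelR3 R).
Proof.
apply: (@measurability _ _ _ (borelR3 R) _ _ (@open 'rV[R]_3)) => // _ [U oU <-].
rewrite setTI.
rewrite (open_rat_boxes oU) preimage_bigcup.
apply: countable_bigcupT_measurable; first exact: countableP.
move=> c; case: asboolP => _; last by rewrite preimage_set0.
have -> : spherical r @^-1` rat_box c = \bigcap_(i : 'I_3)
    ((fun p => spherical r p ord0 i) @^-1`
       ball (ratr (c.1 ord0 i) : R) c.2.+1%:R^-1).
  apply/seteqP; split=> [p h i _|p h].
    by case: h => _ /(_ ord0 i); rewrite /= !mxE.
  split=> [|i j]; first by rewrite invr_gt0.
  by have := h j I; rewrite (ord1 i) /= !mxE.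
apply: fin_bigcap_measurable => // i _.
rewrite -[X in measurable X]setTI.
suff : measurable_fun setT (fun p => spherical r p ord0 i).
  by apply => //; exact: measurable_ball.
have ms1 : measurable_fun setT (fun p : R * R => sin p.1).
  by apply: measurableT_comp => //; apply: continuous_measurable_fun; exact: continuous_sin.
have ms2 : measurable_fun setT (fun p : R * R => sin p.2).
  by apply: measurableT_comp => //; apply: continuous_measurable_fun; exact: continuous_sin.
have mc1 : measurable_fun setT (fun p : R * R => cos p.1).
  by apply: measurableT_comp => //; apply: continuous_measurable_fun; exact: continuous_cos.
have mc2 : measurable_fun setT (fun p : R * R => cos p.2).
  by apply: measurableT_comp => //; apply: continuous_measurable_fun; exact: continuous_cos.
under eq_fun do rewrite mxE.
case: i => -[|[|[|//]]] /= _; apply: measurable_funM => //;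
  by apply: measurable_funM.
Qed.

Lemma measurable_angles : measurable (@angles R).
Proof. exact: measurableX. Qed.

Let g r (p : R * R) : \bar R := (r ^+ 2 * sin p.1)%:E.

Let mg r D : measurable_fun D (g r).
Proof.
apply: (measurable_funS measurableT) => //; apply/measurable_EFinP.
apply: measurable_funM => //; apply: measurableT_comp => //.
apply: continuous_measurable_fun; exact: continuous_sin.
Qed.

Let g_ge0 r p : angles p -> (0 <= g r p)%E.
Proof.
case; rewrite /= !in_itv/= => p1 _; rewrite lee_fin mulr_ge0 ?sqr_ge0//.
exact: sin_ge0_pi.
Qed.

Lemma sphere_areaE r A : sphere_area r A =
  (\int[(@lebesgue_measure R \x @lebesgue_measure R)%E]_(p in
     angles `&` spherical r @^-1` A) (r ^+ 2 * sin p.1)%:E)%E.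
Proof.
rewrite integral_mkcondr; apply: eq_integral => p _.
rewrite patchE indicE (_ : (p \in _ @^-1` A) = (spherical r p \in A)); last first.
  by apply/idP/idP; rewrite !inE.
by case: ifPn => _; rewrite ?mulr1 ?mulr0.
Qed.

Let m0 r : sphere_area r set0 = 0%E.
Proof. by rewrite sphere_areaE preimage_set0 setI0 integral_set0. Qed.

Let m_ge0 r A : (0 <= sphere_area r A)%E.
Proof. by rewrite sphere_areaE; apply: integral_ge0 => p [+ _]; exact: g_ge0. Qed.

Let m_sigma r : semi_sigma_additive (sphere_area r : set (borelR3 R) -> _).
Proof.
move=> F mF tF mUF.
have -> : sphere_area r (\bigcup_n F n) = (\sum_(n <oo) sphere_area r (F n))%E.
  rewrite sphere_areaE preimage_bigcup setI_bigcupr ge0_integral_bigcup//.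
  - by under eq_eseriesr do rewrite -sphere_areaE.
  - move=> k; apply: measurableI; first exact: measurable_angles.
    by rewrite -[X in measurable X]setTI; exact: measurable_spherical.
  - exact: mg.
  - by move=> p [k _ [+ _]]; exact: g_ge0.
  - apply/trivIsetP => i j _ _ ij; rewrite setIACA -preimage_setI.
    by move/trivIsetP : tF => /(_ i j I I ij) ->; rewrite preimage_set0 setI0.
by apply: is_cvg_ereal_nneg_natsum => k _.
Qed.

HB.instance Definition _ r := isMeasure.Build _ (borelR3 R) R (sphere_area r)
  (m0 r) (m_ge0 r) (@m_sigma r).

Lemma osphere_spherical r p : 0 <= r -> osphere r (spherical r p).
Proof.
move=> r0; rewrite /osphere/= /enorm /dotv !big_ord_recl big_ord0 !mxE/=.
rewrite (_ : _ + _ = r ^+ 2) ?sqrtr_sqr ?ger0_norm//.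
have h1 := cos2Dsin2 p.1; have h2 := cos2Dsin2 p.2.
transitivity (r ^+ 2 * (sin p.1 ^+ 2 * (cos p.2 ^+ 2 + sin p.2 ^+ 2) + cos p.1 ^+ 2)).
  by ring.
by rewrite h2 mulr1 addrC h1 mulr1.
Qed.

Lemma sphere_area_total r : 0 <= r ->
  sphere_area r (osphere r) = (4 * pi * r ^+ 2)%:E.
Proof.
move=> r0; rewrite sphere_areaE.
have -> : angles `&` spherical r @^-1` osphere r = angles.
  by apply/setIidPl => p _; exact: osphere_spherical.
rewrite integral_mkcond fubini_tonelli1; last 2 first.
- exact: (iffLR (measurable_restrictT _ measurable_angles) (@mg _ _)).
- by move=> p; rewrite patchE; case: ifPn => // /set_mem; exact: g_ge0.
transitivity (\int[@lebesgue_measure R]_(x in `[0%R, pi]) ((2 * pi * r ^+ 2)%:E * (sin x)%:E))%E.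
  rewrite [RHS]integral_mkcond; apply: eq_integral => x _.
  rewrite /fubini_F patchE; case: ifPn => xpi.
    transitivity (\int[@lebesgue_measure R]_(y in `[0%R, (2 * pi)%R]) (r ^+ 2 * sin x)%:E)%E.
      rewrite [RHS]integral_mkcond; apply: eq_integral => y _.
      by rewrite !patchE in_setX xpi.
    rewrite integral_cst//= lebesgue_measure_itv/= lte_fin mulr_gt0 ?pi_gt0//.
    by rewrite -EFinB -!EFinM; congr EFin; ring.
  rewrite -[RHS](integral0 lebesgue_measure setT); apply: eq_integral => y _.
  by rewrite patchE in_setX (negbTE xpi).
rewrite ge0_integralZl//; last 3 first.
- apply/measurable_EFinP; apply: (measurable_funS measurableT) => //.
  apply: continuous_measurable_fun; exact: continuous_sin.
- by move=> x; rewrite /= in_itv/= => h; rewrite lee_fin sin_ge0_pi.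
- by rewrite lee_fin !mulr_ge0 ?pi_ge0 ?sqr_ge0.
rewrite (@continuous_FTC2 _ sin (fun x => - cos x))//.
- by rewrite cospi cos0 -EFinB -EFinM; congr EFin; ring.
- exact: pi_gt0.
- by apply: continuous_subspaceT => x; exact: continuous_sin.
- split=> [x _||].
  + by apply: derivableN; exact: derivable_cos.
  + by apply: cvg_at_right_filter; apply: cvgN; exact: continuous_cos.
  + by apply: cvg_at_left_filter; apply: cvgN; exact: continuous_cos.
- move=> x _; rewrite derive1E deriveN ?derive_val ?opprK//.
Qed.

Lemma sphere_area_radius_of_area (a : R) : 0 <= a ->
  sphere_area (radius_of_area a) (osphere (radius_of_area a)) = a%:E.
Proof.
move=> a0; rewrite sphere_area_total ?sqrtr_ge0// sqr_sqrtr.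
  congr EFin; move: (pi_gt0 R); move: pi => p p0; field; exact: lt0r_neq0.
by rewrite divr_ge0// mulr_ge0// pi_ge0.
Qed.

End sphere_area_measure.

Definition curve_at {R : realType} (M : set 'rV[R]_3) (x v : 'rV[R]_3)
    (c : R -> 'rV[R]_3) : Prop :=
  [/\ forall t, M (c t), c 0 = x & is_derive (0 : R) (1 : R) c v].

Definition tangent_space {R : realType} (M : set 'rV[R]_3) (x : 'rV[R]_3)
    : set 'rV[R]_3 :=
  [set v | exists c, curve_at M x v c].

(* g represents the differential df_x on the tangent space of M at x for the
   metric induced from R^3; only the values of f on M matter. *)
Definition is_riem_grad {R : realType} (M : set 'rV[R]_3) (f : 'rV[R]_3 -> R)
    (x g : 'rV[R]_3) : Prop :=
  tangent_space M x g /\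
  forall v c, curve_at M x v c ->
    is_derive (0 : R) (1 : R) (f \o c) (dotv g v).

Definition riem_grad {R : realType} (M : set 'rV[R]_3) (f : 'rV[R]_3 -> R)
    (x : 'rV[R]_3) : 'rV[R]_3 :=
  xget 0 [set g | is_riem_grad M f x g].

Definition potential {R : realType} (L : set 'rV[R]_3) (x : 'rV[R]_3) : R :=
  \sum_(z \in L) ln (enorm (x - z)).

Definition force {R : realType} (S L : set 'rV[R]_3) (x : 'rV[R]_3)
    : 'rV[R]_3 :=
  - riem_grad S (potential L) x.

Definition integral_curve {R : realType} (S L : set 'rV[R]_3) (x : 'rV[R]_3)
    (tau : \bar R) (Y : R -> 'rV[R]_3) : Prop :=
  [/\ (0 < tau)%E, Y 0 = x & forall t : R, (t%:E < tau)%E ->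
     (S `\` L) (Y t) /\ is_derive t (1 : R) Y (force S L (Y t))].

Definition maximal_integral_curve {R : realType} (S L : set 'rV[R]_3)
    (x : 'rV[R]_3) (tau : \bar R) (Y : R -> 'rV[R]_3) : Prop :=
  integral_curve S L x tau Y /\
  forall tau' Y', integral_curve S L x tau' Y' ->
    (forall t : R, (t%:E < tau)%E -> (t%:E < tau')%E -> Y' t = Y t) ->
    (tau' <= tau)%E.

(* The filter of t increasing to tau. *)
Definition left_end {R : realType} (tau : \bar R) : set_system R :=
  match tau with
  | r%:E => r^'-
  | +oo => +oo%R
  | -oo => -oo%R
  end%E.

Definition flows_to {R : realType} (S L : set 'rV[R]_3) (x z : 'rV[R]_3)
    : Prop :=
  exists tau Y, maximal_integral_curve S L x tau Y /\
    Y t @[t --> left_end tau] --> z.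

(* None stands for the point at infinity. *)
Definition gravitational_allocation {R : realType} (S L : set 'rV[R]_3)
    (x : 'rV[R]_3) : option 'rV[R]_3 :=
  if pselect (L x) then Some x
  else if pselect (exists z, L z /\ flows_to S L x z) is left e
       then Some (projT1 (cid e))
       else None.

(* An allocation S -> L + {oo} is a total function of which only the values on
   S matter; its finite codomain carries the sigma-algebra of all subsets. *)
Definition fair_allocation {R : realType} (mu : {measure set (borelR3 R) -> \bar R})
    (S L : set 'rV[R]_3) (psi : 'rV[R]_3 -> option 'rV[R]_3) : Prop :=
  [/\ forall x z, S x -> psi x = Some z -> L z,
      forall B : set (option 'rV[R]_3),
        measurable (S `&` psi @^-1` B : set (borelR3 R)),
      mu (S `&` psi @^-1` [set None]) = 0%E &
      forall z, L z -> mu (S `&` psi @^-1` [set Some z]) = 1%E].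

(* Main.v *)
(* On the sphere |x - w|^2 = 2 V_w(x) with V_w(x) = r^2 - x.w, so the force is
   F = G / (2 r^2 rho), where rho is the product of the V_w over w in L and
   G = - r^2 grad rho is polynomial.  The flow Phi of G is complete, and the
   integral curves of F are time changes of those of G: a point is allocated to
   z iff Phi carries it into a small neighbourhood of z, in which V_z decays
   exponentially.  Let u_t = chi o Phi_t, where chi is a C^{1,1} cutoff equal to
   1 near z and to 0 outside that neighbourhood; then u_t tends to the indicator
   of the basin of z as t grows.  Up to a factor, F is a sum over w of fields
   singular only at w and of constant divergence.  As u_t is constant near
   every point of L, integrating by parts (with u_t for w <> z and with 1 - u_t
   for w = z) shows that the integral of u_t / rho grows at rate
   n (1 - int u_t), the divergence at L being harmless.  But that integral is
   bounded, after truncating 1 / rho where u_t is constant, so int u_t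
   converges to 1, and the basin has area 1.  The n disjoint basins exhaust the
   area n of the sphere. *)
Require Import Defs.
From mathcomp Require Import all_boot all_order all_algebra.
From mathcomp Require Import all_classical all_reals all_analysis.
From mathcomp Require Import measurable_realfun ring lra.
Import Order.TTheory GRing.Theory Num.Theory.
Import numFieldNormedType.Exports.
Local Open Scope classical_set_scope.
Local Open Scope ring_scope.
Set Implicit Arguments.
Unset Strict Implicit.
Unset Printing Implicit Defensive.

(** The equal share 1 comes from a coincidence of two numbers: each of the n points contributes -
    int u_t to the flux, and z contributes in addition the area of the sphere, which is again n. No
    regularity of the boundary of a basin is assumed; the cutoffs u_t take the place of its
    indicator, but their C^{1,1} constants may grow with t. The growth law must hold with an error
    uniform in t, so at each time the remainder is estimated for chi near Phi_t(x), where the past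
    of the orbit does not enter. The law is used through increments over a step h with error O(h^2):
    t tends to infinity for fixed h, and h is chosen small in terms of the distance from the limit
    to 1. Integration by parts reduces to the invariance of area under rotations: after
    multiplication by the density sin phi, a rotation field acts as a divergence in the coordinates
    (phi, theta), and its singularity at the poles cancels. *)

(** * Sup norm and inner product on R^3 *)

Lemma coord_le_norm {R : realType} (x : 'rV[R]_3) i : `|x ord0 i| <= `|x|.
Proof.
rewrite [leRHS]/Num.Def.normr/= mx_normrE.
exact: (le_bigmax _ (fun ij => `|x ij.1 ij.2|) (ord0, i)).
Qed.

Lemma norm_le_coord {R : realType} (x : 'rV[R]_3) M :
  0 <= M -> (forall i, `|x ord0 i| <= M) -> `|x| <= M.
Proof.
move=> M0 xM; rewrite [leLHS]/Num.Def.normr/= mx_normrE.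
by apply: bigmax_le => // -[i j] _ /=; rewrite (ord1 i).
Qed.

Lemma rV_subE {R : realType} (u v : 'rV[R]_3) i :
  (u - v) ord0 i = u ord0 i - v ord0 i.
Proof. by rewrite !mxE. Qed.

Lemma dotvE {R : realType} (u v : 'rV[R]_3) :
  dotv u v = u ord0 ord0 * v ord0 ord0 + u ord0 1 * v ord0 1
             + u ord0 2%R * v ord0 2%R.
Proof.
rewrite /dotv !big_ord_recl big_ord0 addr0 addrA.
by congr (_ * _ + _ * _ + _ * _); congr (_ ord0 _); apply/val_inj.
Qed.

Lemma dotvC {R : realType} (u v : 'rV[R]_3) : dotv u v = dotv v u.
Proof. by apply: eq_bigr => i _; rewrite mulrC. Qed.

Lemma dotvDl {R : realType} (u v w : 'rV[R]_3) : dotv (u + v) w = dotv u w + dotv v w.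
Proof. by rewrite -big_split; apply: eq_bigr => i _; rewrite mxE mulrDl. Qed.

Lemma dotvZl {R : realType} a (u w : 'rV[R]_3) : dotv (a *: u) w = a * dotv u w.
Proof. by rewrite mulr_sumr; apply: eq_bigr => i _; rewrite mxE mulrA. Qed.

Lemma dotvNl {R : realType} (u w : 'rV[R]_3) : dotv (- u) w = - dotv u w.
Proof. by rewrite -scaleN1r dotvZl mulN1r. Qed.

Lemma dotvBl {R : realType} (u v w : 'rV[R]_3) : dotv (u - v) w = dotv u w - dotv v w.
Proof. by rewrite dotvDl dotvNl. Qed.

Lemma dotvDr {R : realType} (u v w : 'rV[R]_3) : dotv w (u + v) = dotv w u + dotv w v.
Proof. by rewrite dotvC dotvDl !(dotvC _ w). Qed.

Lemma dotvZr {R : realType} a (u w : 'rV[R]_3) : dotv w (a *: u) = a * dotv w u.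
Proof. by rewrite dotvC dotvZl (dotvC _ w). Qed.

Lemma dotvNr {R : realType} (u w : 'rV[R]_3) : dotv w (- u) = - dotv w u.
Proof. by rewrite dotvC dotvNl (dotvC _ w). Qed.

Lemma dotvBr {R : realType} (u v w : 'rV[R]_3) : dotv w (u - v) = dotv w u - dotv w v.
Proof. by rewrite dotvDr dotvNr. Qed.

Lemma dotv0l {R : realType} (v : 'rV[R]_3) : dotv 0 v = 0.
Proof. by rewrite -(scale0r 0) dotvZl mul0r. Qed.

Lemma dotv_ge0 {R : realType} (v : 'rV[R]_3) : 0 <= dotv v v.
Proof. by apply: sumr_ge0 => i _; rewrite -expr2 sqr_ge0. Qed.

Lemma sqr_norm_le_dotv {R : realType} (v : 'rV[R]_3) : `|v| ^+ 2 <= dotv v v.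
Proof.
rewrite -(sqr_sqrtr (dotv_ge0 v)) ler_sqr ?nnegrE ?sqrtr_ge0//.
apply: norm_le_coord => [|i]; first exact: sqrtr_ge0.
rewrite -sqrtr_sqr ler_sqrt ?dotv_ge0// /dotv (bigD1 i)//= -expr2 lerDl.
by apply: sumr_ge0 => j _; rewrite -expr2 sqr_ge0.
Qed.

Lemma dotv_eq0 {R : realType} (v : 'rV[R]_3) : dotv v v = 0 -> v = 0.
Proof.
move=> v0; have := sqr_norm_le_dotv v; rewrite v0 => v0'.
apply/normr0_eq0/eqP; rewrite -sqrf_eq0 eq_le v0'/=; exact: sqr_ge0.
Qed.

Lemma normr_dotv {R : realType} (u v : 'rV[R]_3) : `|dotv u v| <= 3 * `|u| * `|v|.
Proof.
apply: (le_trans (ler_norm_sum _ _ _)).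
apply: (@le_trans _ _ (\sum_(i < 3) `|u| * `|v|)).
  by apply: ler_sum => i _; rewrite normrM ler_pM// coord_le_norm.
by rewrite sumr_const card_ord -mulrA mulr_natl.
Qed.

Lemma dotv_CauchySchwarz {R : realType} (u v : 'rV[R]_3) :
  dotv u v ^+ 2 <= dotv u u * dotv v v.
Proof.
rewrite !dotvE; set a := u _ _; set b := u _ _; set c := u _ _.
set d := v _ _; set e := v _ _; set f := v _ _.
have := sqr_ge0 (a * e - b * d); have := sqr_ge0 (a * f - c * d).
have := sqr_ge0 (b * f - c * e); nra.
Qed.

(** * Derivatives of functions of one real variable *)

Lemma is_derive_rV {R : realType} (X : R -> 'rV[R]_3) (t : R) (v : 'rV[R]_3) :
  is_derive t (1 : R) X v <-> forall i, is_derive t 1 (fun s => X s ord0 i) (v ord0 i).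
Proof.
split=> [[dX XE] i|dX].
  have dXi := (derivable_mxP _ _ _).1 dX ord0 i.
  by apply: DeriveDef => //; rewrite -XE (derive_mx dX) mxE.
have dX' : derivable X t 1.
  by apply/derivable_mxP => j i; rewrite (ord1 j); have [] := dX i.
apply: DeriveDef => //; rewrite (derive_mx dX'); apply/rowP => i; rewrite mxE.
by have [_ ->] := dX i.
Qed.

Lemma is_derive_continuous {R : realType} {V : normedModType R} (f : R -> V) (t : R) l :
  is_derive t (1 : R) f l -> {for t, continuous f}.
Proof. by case=> df _; apply/differentiable_continuous/derivable1_diffP. Qed.

(** Mean value theorem for [g - f]. Differential inequalities are integrated in this form
    throughout, so that [df] and [dg] may be arbitrary functions. *)
Lemma is_derive_compare {R : realType} (f df g dg : R -> R) (a b : R) : a <= b ->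
  (forall t, a <= t <= b -> is_derive t 1 f (df t)) ->
  (forall t, a <= t <= b -> is_derive t 1 g (dg t)) ->
  (forall t, a <= t <= b -> df t <= dg t) -> f b - f a <= g b - g a.
Proof.
move=> ab fd gd le.
have hd t : a <= t <= b -> is_derive t 1 (g \- f) (dg t - df t).
  by move=> tab; have := fd t tab; have := gd t tab => ? ?; exact: is_deriveB.
have [c cab E] : exists2 c, c \in `[a, b]%R &
    (g \- f) b - (g \- f) a = (dg c - df c) * (b - a).
  apply: (@MVT_segment _ (g \- f) (fun c => dg c - df c) _ _ ab).
    move=> x; rewrite in_itv/= => /andP[ax xb].
    by apply: hd; rewrite !ltW.
  apply: derivable_within_continuous => x xab.
  by move: xab; rewrite in_itv/= => /hd[].
have : 0 <= (g \- f) b - (g \- f) a.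
  by rewrite E mulr_ge0// subr_ge0//; apply: le; move: cab; rewrite in_itv.
by move=> /=; lra.
Qed.

Lemma is_derive_compare_norm {R : realType} (f df g dg : R -> R) (a b : R) : a <= b ->
  (forall t, a <= t <= b -> is_derive t 1 f (df t)) ->
  (forall t, a <= t <= b -> is_derive t 1 g (dg t)) ->
  (forall t, a <= t <= b -> `|df t| <= dg t) -> `|f b - f a| <= g b - g a.
Proof.
move=> ab fd gd le; rewrite ler_norml; apply/andP; split; last first.
  by apply: (is_derive_compare ab fd gd) => t /le; exact: le_trans (ler_norm _).
suff : - f b - - f a <= g b - g a by lra.
apply: (@is_derive_compare _ (- f) (fun t => - df t) _ _ _ _ ab _ gd) => t tab.
  by have := fd t tab => ?; exact: is_deriveN.
by apply: le_trans (le t tab); rewrite -normrN ler_norm.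
Qed.

Lemma is_derive_mulr_cst {R : realType} (M t : R) :
  is_derive t 1 (fun s : R => M * s) M.
Proof.
have -> : (fun s : R => M * s) = M *: (@id R) by [].
by apply: is_derive_eq; rewrite /GRing.scale/= mulr1.
Qed.

Lemma is_derive_le_cst {R : realType} (f df : R -> R) (a b : R) M : a <= b ->
  (forall t, a <= t <= b -> is_derive t 1 f (df t)) ->
  (forall t, a <= t <= b -> `|df t| <= M) -> `|f b - f a| <= M * (b - a).
Proof.
move=> ab fd le; rewrite mulrBr.
apply: (is_derive_compare_norm ab fd _ le) => t _.
exact: is_derive_mulr_cst.
Qed.

Lemma is_derive_nonincr {R : realType} (f df : R -> R) (a b : R) : a <= b ->
  (forall t, a <= t <= b -> is_derive t 1 f (df t)) ->
  (forall t, a <= t <= b -> df t <= 0) -> f b <= f a.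
Proof.
move=> ab fd le; rewrite -subr_le0 -[leRHS](subrr (0 : R)).
exact: (is_derive_compare ab fd (fun t _ => is_derive_cst (0 : R) t 1)).
Qed.

Lemma is_derive_mulr {R : realType} (f g : R -> R) (t df dg : R) :
  is_derive t 1 f df -> is_derive t 1 g dg ->
  is_derive t 1 (fun s => f s * g s) (df * g t + f t * dg).
Proof.
move=> fd gd; have -> : (fun s => f s * g s) = f * g by [].
by apply: is_derive_eq; rewrite /GRing.scale/= addrC mulrC.
Qed.

Lemma is_derive_addr {R : realType} (f g : R -> R) (t df dg : R) :
  is_derive t 1 f df -> is_derive t 1 g dg ->
  is_derive t 1 (fun s => f s + g s) (df + dg).
Proof. by move=> fd gd; exact: is_deriveD. Qed.

Lemma is_derive_subr {R : realType} (f g : R -> R) (t df dg : R) :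
  is_derive t 1 f df -> is_derive t 1 g dg ->
  is_derive t 1 (fun s => f s - g s) (df - dg).
Proof. by move=> fd gd; exact: is_deriveB. Qed.

Lemma is_derive_expR_mul {R : realType} (c t : R) :
  is_derive t 1 (fun s => expR (c * s)) (c * expR (c * t)).
Proof.
have h := is_derive_mulr_cst c t.
by have := is_derive1_comp (is_derive_expR (c * t)) h; rewrite mulrC.
Qed.

Lemma is_derive_comp_opp {R : realType} (f : R -> R) (t df : R) :
  is_derive (- t) 1 f df -> is_derive t 1 (fun s => f (- s)) (- df).
Proof.
move=> fd; have h : is_derive t 1 (-%R : R -> R) (-1).
  by apply: is_deriveN.
by have := @is_derive1_comp _ f -%R t _ _ fd h; rewrite mulrN1.
Qed.

Lemma is_derive_sumr {R : realType} n (f : 'I_n -> R -> R) (df : 'I_n -> R) (t : R) :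
  (forall i, is_derive t 1 (f i) (df i)) ->
  is_derive t 1 (fun s => \sum_(i < n) f i s) (\sum_(i < n) df i).
Proof.
move=> fd; have -> : (fun s => \sum_(i < n) f i s) = \sum_(i < n) f i.
  by apply/funext => s; rewrite fct_sumE.
exact: is_derive_sum.
Qed.

Lemma is_derive_dotv {R : realType} (u v : R -> 'rV[R]_3) (t : R) (du dv : 'rV[R]_3) :
  (forall i, is_derive t 1 (fun s => u s ord0 i) (du ord0 i)) ->
  (forall i, is_derive t 1 (fun s => v s ord0 i) (dv ord0 i)) ->
  is_derive t 1 (fun s => dotv (u s) (v s)) (dotv du (v t) + dotv (u t) dv).
Proof.
move=> ud vd; rewrite -big_split/=; apply: is_derive_sumr => i.
exact: (is_derive_mulr (ud i) (vd i)).
Qed.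

(** * Picard iteration for a globally Lipschitz field *)

(** The sup norm is not differentiable, so [gronwall] follows N = [dotv w w]. Since |u.v| <= 3 |u|
    |v|, one gets N' <= 6 K |w|^2 + 6 e |w| <= (6 K + 3) N + 3 e^2, whence the exponent. The factor
    3 (1 + T) absorbs N(0) <= 3 |w(0)|^2 and the integrated error 3 e^2 T. *)
Definition gronwall_cst {R : realType} (K T : R) : R :=
  3 * expR ((6 * K + 3) * T) * (1 + T).

Lemma gronwall_cst_ge0 {R : realType} (K T : R) : 0 <= T -> 0 <= gronwall_cst K T.
Proof. by move=> T0; rewrite /gronwall_cst !mulr_ge0 ?expR_ge0// addr_ge0. Qed.

Lemma gronwall {R : realType} (w dw : R -> 'rV[R]_3) (K e T : R) :
  0 <= K -> 0 <= e -> 0 <= T ->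
  (forall t, 0 <= t <= T -> forall i,
    is_derive t 1 (fun s => w s ord0 i) (dw t ord0 i)) ->
  (forall t, 0 <= t <= T -> `|dw t| <= K * `|w t| + e) ->
  `|w T| <= gronwall_cst K T * (`|w 0| + e).
Proof.
move=> K0 e0 T0 wd dwle; set a := 6 * K + 3.
have a0 : 0 <= a by rewrite /a; lra.
pose N t := dotv (w t) (w t).
have hle : N T * expR (- a * T) - 3 * e ^+ 2 * T <= N 0 * expR (- a * 0) - 3 * e ^+ 2 * 0.
  apply: (@is_derive_nonincr _ (fun t => N t * expR (- a * t) - 3 * e ^+ 2 * t)
    (fun t => (dotv (dw t) (w t) + dotv (w t) (dw t)) * expR (- a * t)
      + N t * (- a * expR (- a * t)) - 3 * e ^+ 2) 0 T T0) => t tT.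
    apply: is_derive_subr; last exact: is_derive_mulr_cst.
    apply: is_derive_mulr; last exact: is_derive_expR_mul.
    by apply: is_derive_dotv; exact: wd.
  have d1 : dotv (dw t) (w t) <= 3 * (K * `|w t| + e) * `|w t|.
    apply: le_trans (ler_norm _) _; apply: le_trans (normr_dotv _ _) _.
    by rewrite ler_wpM2r// ler_wpM2l// dwle.
  have e1 : expR (- a * t) <= 1.
    by rewrite -expR0 ler_expR; case/andP: tT => t0 _; nra.
  have e2 := expR_ge0 (- a * t); have NE := sqr_norm_le_dotv (w t).
  rewrite (dotvC (w t) (dw t)); move: NE d1 (normr_ge0 (w t)) e1 e2.
  rewrite -/(N t); move: (N t) (dotv _ _) `|w t| (expR _) => n d q x nq dq q0 x1 x0.
  have h : d + d - a * n <= 3 * e ^+ 2.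
    have qq : 0 <= (q - e) ^+ 2 by exact: sqr_ge0.
    have h1 : d + d <= 6 * K * q ^+ 2 + 3 * q ^+ 2 + 3 * e ^+ 2 by lra.
    have h2 : a * q ^+ 2 <= a * n by rewrite ler_wpM2l.
    by rewrite /a in h2 *; lra.
  have h3 : (d + d - a * n) * x <= 3 * e ^+ 2 * x by rewrite ler_wpM2r.
  have h4 : 3 * e ^+ 2 * x <= 3 * e ^+ 2 * 1 by rewrite ler_wpM2l// mulr_ge0// sqr_ge0.
  by lra.
move: hle; rewrite mulr0 expR0 !mulr1 mulr0 subr0 => hle.
have hT : N T <= expR (a * T) * (N 0 + 3 * e ^+ 2 * T).
  rewrite -ler_pdivrMl ?expR_gt0// -expRN mulrC -mulNr; lra.
have N0 : N 0 <= 3 * `|w 0| ^+ 2.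
  by apply: le_trans (ler_norm _) _; apply: le_trans (normr_dotv _ _) _; rewrite expr2 mulrA.
(* The bound obtained is for the square of the norm; G >= 1 gives G q^2 <= (G q)^2 and allows the
   square root. *)
set G := gronwall_cst K T; have G1 : 1 <= G.
  have e1 : 1 <= expR (a * T) by rewrite -expR0 ler_expR mulr_ge0.
  rewrite /G /gronwall_cst -/a; move: (expR _) e1 => x x1; nra.
have G0 : 0 <= G by lra.
rewrite -ler_sqr ?nnegrE//; last by rewrite mulr_ge0// addr_ge0.
apply: (le_trans (sqr_norm_le_dotv _)); apply: (le_trans hT).
apply: (@le_trans _ _ (G * (`|w 0| + e) ^+ 2)); last first.
  rewrite exprMn ler_wpM2r ?sqr_ge0// expr2; nra.
rewrite /G /gronwall_cst -/a.
have -> : forall x y : R, 3 * x * (1 + T) * y = x * (3 * (1 + T) * y) by move=> x y; ring.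
rewrite ler_wpM2l ?expR_ge0//.
move: (normr_ge0 (w 0)) N0; move: `|w 0| => q q0 N0.
have h1 : 3 * e ^+ 2 * T <= 3 * (q + e) ^+ 2 * T.
  by rewrite ler_wpM2r// ler_wpM2l// ler_sqr ?nnegrE//; lra.
have h2 : q ^+ 2 <= (q + e) ^+ 2 by rewrite ler_sqr ?nnegrE//; lra.
lra.
Qed.

(** The fundamental theorem of calculus applies to integrals from a fixed lower end -M, at points s
    > -M. The differences [J M s - J M 0] do not depend on M, so M may vary with the point. *)
Lemma continuous_primitive {R : realType} (f : R -> R) : continuous f ->
  exists F : R -> R, F 0 = 0 /\ forall t : R, is_derive t 1 F (f t).
Proof.
move=> cf.
pose J (M s : R) : R := \int[lebesgue_measure]_(x in `[- M, s]) f x.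
have Jd (M s : R) : - M < s -> is_derive s 1 (J M) (f s).
  move=> Ms; have s1 : s < s + 1 by rewrite ltrDl.
  have fi : lebesgue_measure.-integrable `[- M, s + 1] (EFin \o f).
    apply: continuous_compact_integrable; first exact: segment_compact.
    by apply: continuous_subspaceT.
  have [d1 d2] := continuous_FTC1_closed s1 fi Ms (cf s).
  by apply: DeriveDef; [exact: d1|rewrite -derive1E; exact: d2].
have JE M M' s : - M < s -> - M' < s -> 0 < M -> 0 < M' -> J M s - J M 0 = J M' s - J M' 0.
  move=> Ms M's M0 M'0.
  have hle a b : a <= b -> - M < a -> - M' < a -> J M b - J M' b - (J M a - J M' a) = 0.
    move=> ab Ma M'a; apply/eqP; rewrite -normr_le0.
    have := @is_derive_le_cst _ (fun t => J M t - J M' t) (fun t => f t - f t) a b 0 ab.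
    rewrite mul0r; apply => [t|t _]; last by rewrite subrr normr0.
    by move=> /andP[aT _]; apply: is_derive_subr; apply: Jd; apply: lt_le_trans aT.
  have aux (a b c d : R) : a - b - (c - d) = 0 -> a - c = b - d by lra.
  have aux' (a b c d : R) : a - b - (c - d) = 0 -> c - a = d - b by lra.
  have [s0|s0] := leP 0 s; first by apply/aux/hle; rewrite ?oppr_lt0.
  by apply/aux'/hle => //; exact: ltW.
(* The lower end -(|t| + 1) lies to the left of both 0 and t; near t it is exchanged for the fixed
   -(|t| + 2). *)
exists (fun t => J (`|t| + 1) t - J (`|t| + 1) 0); split; first by rewrite subrr.
move=> t.
have hd : is_derive t 1 (fun s => J (`|t| + 2) s - J (`|t| + 2) 0) (f t - 0).
  apply: is_derive_subr.
  by apply: Jd; rewrite -normrN; have := ler_norm (- t); lra.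
rewrite subr0 in hd; apply: near_eq_is_derive hd.
near=> s.
have st : `|s - t| < 1 by near: s; apply/nbhs_ballP; exists 1 => //= z; rewrite /ball/= distrC.
have h1 : `|s| < `|t| + 1.
  by have := ler_normD (s - t) t; rewrite subrK; lra.
apply: JE.
- by have := ler_norm (- s); rewrite normrN; lra.
- by have := ler_norm (- s); rewrite normrN; lra.
- by have := normr_ge0 t; lra.
- by have := normr_ge0 s; lra.
Unshelve. all: by end_near. Qed.

Definition primitive {R : realType} (f : R -> R) : R -> R :=
  xget (cst 0) [set F | F 0 = 0 /\ forall t : R, is_derive t 1 F (f t)].

Lemma primitiveP {R : realType} (f : R -> R) : continuous f ->
  primitive f 0 = 0 /\ forall t : R, is_derive t 1 (primitive f) (f t).
Proof.
move=> /continuous_primitive[F FP].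
exact: (@xgetPex _ _ [set F : R -> R | F 0 = 0 /\ forall t : R, is_derive t 1 F (f t)] (ex_intro _ F FP)).
Qed.

(** Integrating e^(K|s|) gains a factor 1/K; this gain makes the Picard map contract in a weighted
    norm on the whole line. *)
Lemma exp_growth_bound {R : realType} (F f : R -> R) (K b t : R) : 0 < K ->
  0 <= b -> F 0 = 0 -> (forall t : R, is_derive t 1 F (f t)) ->
  (forall s, `|f s| <= b * expR (K * `|s|)) ->
  `|F t| <= b / K * expR (K * `|t|).
Proof.
move=> K0 b0.
have pos (F0 f0 : R -> R) s : 0 <= s -> F0 0 = 0 ->
    (forall t : R, is_derive t 1 F0 (f0 t)) ->
    (forall s, `|f0 s| <= b * expR (K * `|s|)) -> `|F0 s| <= b / K * expR (K * s).
  move=> s0 F00 Fd fb.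
  have := @is_derive_compare_norm _ F0 f0 (fun u => b / K * expR (K * u))
    (fun u => b / K * (K * expR (K * u))) 0 s s0 (fun u _ => Fd u).
  rewrite F00 subr0 mulr0 expR0 mulr1 => h.
  apply: (@le_trans _ _ (b / K * expR (K * s) - b / K)); last first.
    by rewrite lerBlDr lerDl divr_ge0// ltW.
  apply: h => [u _|u /andP[u0 _]].
    have h1 := is_derive_expR_mul K u; have h2 := is_derive_cst (b / K) u (1 : R).
    by have := is_derive_mulr h2 h1; rewrite mul0r add0r.
  by rewrite mulrA divfK ?gt_eqF//; have := fb u; rewrite (ger0_norm u0).
move=> F0 Fd fb; have [t0|t0] := leP 0 t; first by rewrite (ger0_norm t0); exact: pos Fd fb.
rewrite (ltr0_norm t0).
have := @pos (fun s => F (- s)) (fun s => - f (- s)) (- t).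
rewrite opprK oppr0 ltW ?oppr_gt0//; apply => // [u|u].
  by apply: is_derive_comp_opp.
by rewrite normrN; have := fb (- u); rewrite normrN.
Qed.

(** Shifting u_k down and up by 2 C 2^(-k) gives two monotone sequences that enclose the limit,
    hence its existence and the rate together. *)
Lemma geometric_cauchy {R : realType} (u : nat -> R) (C : R) : 0 <= C ->
  (forall k, `|u k.+1 - u k| <= C * 2^-1 ^+ k) ->
  exists l, forall k, `|u k - l| <= 2 * C * 2^-1 ^+ k.
Proof.
move=> C0 uC.
pose v k := u k - 2 * C * 2^-1 ^+ k; pose w k := u k + 2 * C * 2^-1 ^+ k.
have step k : v k <= v k.+1 /\ w k.+1 <= w k.
  rewrite /v /w exprS; have := uC k; rewrite ler_norml => /andP[? ?]; split; lra.
have vn : {homo v : n m / (n <= m)%N >-> n <= m}.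
  apply: (@homo_leq _ v (fun a b => a <= b)) => [a //|b a c|k]; first exact: le_trans.
  by have [] := step k.
have wn : {homo w : n m / (n <= m)%N >-> m <= n}.
  apply: (@homo_leq _ w (fun a b => b <= a)) => [a //|b a c ab bc|k].
    exact: le_trans bc ab.
  by have [] := step k.
have vw k j : v k <= w j.
  apply: (le_trans (vn _ _ (leq_maxl k j))); apply: le_trans (wn _ _ (leq_maxr k j)).
  rewrite /v /w; set m := maxn k j.
  have : 0 <= 2 * C * 2^-1 ^+ m by rewrite !mulr_ge0// exprn_ge0.
  lra.
exists (sup (range v)) => k.
have ub j : ubound (range v) (w j) by move=> _ [i _ <-]; exact: vw.
have h1 : v k <= sup (range v).
  by apply: ub_le_sup; [exists (w 0%N); exact: ub|exists k].
have h2 : sup (range v) <= w k.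
  by apply: ge_sup; [exists (v 0%N), 0%N|exact: ub].
by rewrite ler_norml; move: h1 h2; rewrite /v /w => h1 h2; apply/andP; split; lra.
Qed.

Lemma geometric_le0 {R : realType} (x C : R) :
  (forall k, x <= C * 2^-1 ^+ k) -> x <= 0.
Proof.
move=> xC; have h : (C * 2^-1 ^+ k @[k --> \oo]) --> (C * 0 : R).
  apply: cvgMr; apply: cvg_expr; rewrite ger0_norm ?invr_ge0//.
  by rewrite invf_lt1// ltr1n.
rewrite -(mulr0 C) -(cvg_lim _ h)//.
apply: limr_ge; first by apply/cvg_ex; exists (C * 0).
exact: nearW.
Qed.

Section picard.
Context {R : realType}.
Variables (f : R -> 'rV[R]_3 -> 'rV[R]_3) (x0 : 'rV[R]_3) (K M : R).
Hypotheses (K_gt0 : 0 < K)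
  (f_cont : forall X : R -> 'rV[R]_3, (forall i, continuous (fun s => X s ord0 i)) ->
    forall i, continuous (fun s => f s (X s) ord0 i))
  (f_lip : forall t x y, `|f t x - f t y| <= K * `|x - y|)
  (f_bound : forall t, `|f t x0| <= M).

Let step (X : R -> 'rV[R]_3) (t : R) : 'rV[R]_3 :=
  x0 + \row_i primitive (fun s => f s (X s) ord0 i) t.

Let step0 (X : R -> 'rV[R]_3) : (forall i, continuous (fun s => X s ord0 i)) -> step X 0 = x0.
Proof.
move=> cX; apply/rowP => i; rewrite !mxE.
by have [-> _] := primitiveP (@f_cont X cX i); rewrite addr0.
Qed.

Let step_derive (X : R -> 'rV[R]_3) : (forall i, continuous (fun s => X s ord0 i)) ->
  forall (t : R) i, is_derive t 1 (fun s => step X s ord0 i) (f t (X t) ord0 i).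
Proof.
move=> cX t i; have [_ /(_ t) Fd] := primitiveP (@f_cont X cX i).
have -> : (fun s => step X s ord0 i) =
    (fun s => x0 ord0 i + primitive (fun s => f s (X s) ord0 i) s).
  by apply/funext => s; rewrite !mxE.
by have := is_derive_addr (is_derive_cst (x0 ord0 i) t 1) Fd; rewrite add0r.
Qed.

Let step_cont (X : R -> 'rV[R]_3) : (forall i, continuous (fun s => X s ord0 i)) ->
  forall i, continuous (fun s => step X s ord0 i).
Proof. by move=> cX i t; exact: is_derive_continuous (@step_derive X cX t i). Qed.

(** Weight of the norm sup |X(t)| / E(t), in which [step] has Lipschitz constant 1/2 on the whole
    line; a single iteration then yields a global solution. *)
Let E (t : R) : R := expR (2 * K * `|t|).

Let E_ge0 t : 0 <= E t. Proof. exact: expR_ge0. Qed.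

Let K2_gt0 : 0 < 2 * K. Proof. by rewrite mulr_gt0. Qed.

Let step_dist (X Y : R -> 'rV[R]_3) b (t : R) : 0 <= b ->
  (forall i, continuous (fun s => X s ord0 i)) ->
  (forall i, continuous (fun s => Y s ord0 i)) ->
  (forall s, `|X s - Y s| <= b * E s) -> `|step X t - step Y t| <= b / 2 * E t.
Proof.
move=> b0 cX cY XY.
apply: norm_le_coord => [|i]; first by rewrite mulr_ge0// divr_ge0.
have -> : b / 2 * E t = (K * b) / (2 * K) * E t.
  by congr (_ * _); rewrite invfM; field; rewrite gt_eqF.
rewrite rV_subE.
apply: (@exp_growth_bound _ (fun s => step X s ord0 i - step Y s ord0 i)
  (fun s => f s (X s) ord0 i - f s (Y s) ord0 i)) => //.
- by rewrite mulr_ge0// ltW.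
- by rewrite (step0 cX) (step0 cY) subrr.
- by move=> s; exact: (is_derive_subr (@step_derive X cX s i) (@step_derive Y cY s i)).
- move=> s; have := coord_le_norm (f s (X s) - f s (Y s)) i; rewrite rV_subE => h.
  apply: (le_trans h); apply: (le_trans (f_lip _ _ _)).
  by rewrite -mulrA ler_wpM2l ?(ltW K_gt0)//; exact: XY.
Qed.

Let X_ k : R -> 'rV[R]_3 := iter k step (fun=> x0).

Let X_cont k i : continuous (fun s => X_ k s ord0 i).
Proof.
by elim: k i => [|k IH] i; [move=> t; exact: cst_continuous|exact: (@step_cont (X_ k) IH)].
Qed.

Let C := M / (2 * K).

Let M_ge0 : 0 <= M. Proof. exact: le_trans (f_bound 0). Qed.

Let C_ge0 : 0 <= C. Proof. by rewrite /C divr_ge0// ltW. Qed.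

Let X_step k t : `|X_ k.+1 t - X_ k t| <= C * 2^-1 ^+ k * E t.
Proof.
elim: k t => [|k IH] t.
  rewrite expr0 mulr1; apply: norm_le_coord => [|i].
    by rewrite mulr_ge0// expR_ge0.
  rewrite rV_subE.
  apply: (@exp_growth_bound _ (fun s => step (fun=> x0) s ord0 i - x0 ord0 i)
    (fun s => f s x0 ord0 i)) => //.
  - by rewrite (@step0 (X_ 0) (@X_cont 0)) subrr.
  - move=> s; have d1 := @step_derive (X_ 0) (@X_cont 0) s i.
    by have := is_derive_subr d1 (is_derive_cst (x0 ord0 i) s 1); rewrite subr0.
  - move=> s; apply: (le_trans (coord_le_norm _ _)); apply: (le_trans (f_bound _)).
    by rewrite ler_peMr// -[X in X <= _]expR0 ler_expR mulr_ge0// ltW.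
have -> : C * 2^-1 ^+ k.+1 * E t = C * 2^-1 ^+ k / 2 * E t.
  by rewrite exprS; ring.
apply: (@step_dist (X_ k.+1) (X_ k)) => //; by rewrite mulr_ge0// exprn_ge0.
Qed.

Let Xlim_ex t i : exists l, forall k,
  `|X_ k t ord0 i - l| <= 2 * (C * E t) * 2^-1 ^+ k.
Proof.
apply: geometric_cauchy => [|k]; first by rewrite mulr_ge0// expR_ge0.
rewrite mulrAC; apply: le_trans (X_step k t).
by have := coord_le_norm (X_ k.+1 t - X_ k t) i; rewrite rV_subE.
Qed.

Let X (t : R) : 'rV[R]_3 := \row_i xget 0 [set l | forall k,
  `|X_ k t ord0 i - l| <= 2 * (C * E t) * 2^-1 ^+ k].

Let X_X k t : `|X_ k t - X t| <= 2 * C * 2^-1 ^+ k * E t.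
Proof.
apply: norm_le_coord => [|i].
  by rewrite mulr_ge0// mulr_ge0 ?exprn_ge0// mulr_ge0.
rewrite rV_subE [X t ord0 i]mxE.
have -> : 2 * C * 2^-1 ^+ k * E t = 2 * (C * E t) * 2^-1 ^+ k by ring.
have [l lP] := Xlim_ex t i.
exact: (@xgetPex _ 0 [set l | forall k,
  `|X_ k t ord0 i - l| <= 2 * (C * E t) * 2^-1 ^+ k] (ex_intro _ l lP)).
Qed.

Let Xl_cont i : continuous (fun s => X s ord0 i).
Proof.
move=> t; apply/cvgrPdist_le => /= e e0.
pose D := 2 * C * expR (2 * K * (`|t| + 1)).
have D0 : 0 <= D by rewrite /D mulr_ge0 ?expR_ge0// mulr_ge0.
have [k kP] : exists k, D * 2^-1 ^+ k <= e / 3.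
  apply: contrapT => /forallNP h.
  have : e / 3 <= 0.
    by apply: (@geometric_le0 _ _ D) => k; have /negP := h k; rewrite -ltNge => /ltW.
  by rewrite leNgt divr_gt0.
have bnd s : `|s| <= `|t| + 1 -> `|X_ k s ord0 i - X s ord0 i| <= e / 3.
  move=> sT; have := coord_le_norm (X_ k s - X s) i; rewrite rV_subE => h.
  apply: (le_trans h); apply: (le_trans (X_X k s)); apply: le_trans kP.
  rewrite /D mulrAC ler_wpM2r ?exprn_ge0// ler_wpM2l//; first by rewrite mulr_ge0.
  by rewrite ler_expR ler_wpM2l// ltW.
have ct := bnd t; rewrite lerDl ler01 in ct; have {}ct := ct isT.
have e3 : 0 < e / 3 by rewrite divr_gt0.
near=> s.
have st : `|s| <= `|t| + 1.
  have : `|s - t| < 1 by near: s; apply/nbhs_ballP; exists 1 => //= z; rewrite /ball/= distrC.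
  by have := ler_normD (s - t) t; rewrite subrK; lra.
have cs := bnd s st.
have h : `|X_ k t ord0 i - X_ k s ord0 i| <= e / 3.
  by near: s; exact: ((cvgrPdist_le _ _).1 (@X_cont k i t) _ e3).
have -> : X t ord0 i - X s ord0 i = (X_ k t ord0 i - X_ k s ord0 i)
    + (X_ k s ord0 i - X s ord0 i) - (X_ k t ord0 i - X t ord0 i) by ring.
have -> : e = e / 3 + e / 3 + e / 3 by field.
by rewrite (le_trans (ler_normB _ _))// lerD// (le_trans (ler_normD _ _))// lerD.
Unshelve. all: by end_near. Qed.

(** There are two uses: the clipped polynomial field, and the variational equation along an orbit,
    which is linear with coefficients depending on time. The continuity hypothesis speaks of curves
    so as to cover both. *)
Lemma picard : exists X : R -> 'rV[R]_3, X 0 = x0 /\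
  forall (t : R) i, is_derive t 1 (fun s => X s ord0 i) (f t (X t) ord0 i).
Proof.
suff XE : X = step X.
  exists X; split => [|t i]; first by rewrite XE (@step0 X Xl_cont).
  by rewrite {1}XE; exact: (@step_derive X Xl_cont).
apply/funext => t; apply/eqP; rewrite -subr_eq0 -normr_le0.
apply: (@geometric_le0 _ _ (2 * C * E t)) => k.
have h1 := X_X k.+1 t.
have h2 : `|X_ k.+1 t - step X t| <= 2 * C * 2^-1 ^+ k / 2 * E t.
  apply: (@step_dist (X_ k) X) => //; by rewrite mulr_ge0 ?exprn_ge0// mulr_ge0.
have -> : X t - step X t = (X_ k.+1 t - step X t) - (X_ k.+1 t - X t).
  by rewrite opprB [RHS]addrC subrKA.
apply: (le_trans (ler_normB _ _)).
rewrite exprS in h1.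
lra.
Qed.

End picard.

(** * Functions of class C^{1,1} *)

(* Functions of class C^{1,1} on a bounded set E, without reference to an
   ambient open set: g plays the role of a gradient of f, of which only the
   part tangent to E is determined. *)
Definition C11_bound {R : realType} (E : set 'rV[R]_3) (f : 'rV[R]_3 -> R)
    (g : 'rV[R]_3 -> 'rV[R]_3) (C : R) : Prop :=
  forall x y, E x -> E y ->
  [/\ `|f x| <= C, `|g x| <= C, `|g y - g x| <= C * `|y - x|,
      `|f y - f x| <= C * `|y - x| &
      `|f y - f x - dotv (g x) (y - x)| <= C * `|y - x| ^+ 2].

Definition C11 {R : realType} (E : set 'rV[R]_3) (f : 'rV[R]_3 -> R)
    (g : 'rV[R]_3 -> 'rV[R]_3) : Prop :=
  exists2 C, 1 <= C & C11_bound E f g C.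

Lemma C11_boundW {R : realType} (E : set 'rV[R]_3) (f : 'rV[R]_3 -> R) g C D :
  C <= D -> C11_bound E f g C -> C11_bound E f g D.
Proof.
move=> CD fg x y Ex Ey; have [h1 h2 h3 h4 h5] := fg x y Ex Ey.
split; [exact: le_trans CD|exact: le_trans CD|apply: le_trans h3 _
  |apply: le_trans h4 _|apply: le_trans h5 _]; by rewrite ler_wpM2r ?exprn_ge0.
Qed.

Lemma C11_max {R : realType} (E : set 'rV[R]_3) (f1 f2 : 'rV[R]_3 -> R) g1 g2 :
  C11 E f1 g1 -> C11 E f2 g2 ->
  exists C, [/\ 1 <= C, C11_bound E f1 g1 C & C11_bound E f2 g2 C].
Proof.
move=> [C C1 fg1] [D D1 fg2]; exists (C + D); split; first by lra.
  by apply: C11_boundW fg1; lra.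
by apply: C11_boundW fg2; lra.
Qed.

Lemma C11_cst {R : realType} (E : set 'rV[R]_3) (c : R) : C11 E (fun=> c) (fun=> 0).
Proof.
have c1 : 1 <= 1 + `|c| by rewrite lerDl.
exists (1 + `|c|) => // x y _ _; split.
- by rewrite lerDr.
- by rewrite normr0 (le_trans _ c1).
- by rewrite subrr normr0 mulr_ge0// (le_trans _ c1).
- by rewrite subrr normr0 mulr_ge0// (le_trans _ c1).
- by rewrite dotv0l !subrr normr0 mulr_ge0 ?exprn_ge0// (le_trans _ c1).
Qed.

Lemma C11_dotv {R : realType} (E : set 'rV[R]_3) (w : 'rV[R]_3) M :
  (forall x, E x -> `|x| <= M) -> C11 E (fun x => dotv x w) (fun=> w).
Proof.
move=> EM; pose C := 1 + (3 * `|w|) * (1 + `|M|).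
have C0 : 3 * `|w| <= C by rewrite /C; have := normr_ge0 w; have := normr_ge0 M; nra.
have C1 : 1 <= C by rewrite /C lerDl !mulr_ge0// addr_ge0.
exists C => // x y Ex Ey; split.
- apply: (le_trans (normr_dotv _ _)); have := le_trans (EM _ Ex) (ler_norm M).
  rewrite /C; have := normr_ge0 w; have := normr_ge0 M; have := normr_ge0 x; nra.
- by apply: le_trans C0; have := normr_ge0 w; lra.
- by rewrite subrr normr0 mulr_ge0// (le_trans _ C1).
- rewrite -dotvBl (le_trans (normr_dotv _ _))//.
  by rewrite mulrAC ler_wpM2r.
- by rewrite -dotvBl dotvC subrr normr0 mulr_ge0 ?exprn_ge0// (le_trans _ C1).
Qed.

Lemma C11_eq {R : realType} (E : set 'rV[R]_3) (f f' : 'rV[R]_3 -> R) g g' :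
  {in E, f =1 f'} -> {in E, g =1 g'} -> C11 E f g -> C11 E f' g'.
Proof.
move=> ff gg [C C1 fg]; exists C => // x y Ex Ey.
by rewrite -!ff ?inE// -!gg ?inE//; exact: fg.
Qed.

Lemma C11_add {R : realType} (E : set 'rV[R]_3) (f1 f2 : 'rV[R]_3 -> R) g1 g2 :
  C11 E f1 g1 -> C11 E f2 g2 ->
  C11 E (fun x => f1 x + f2 x) (fun x => g1 x + g2 x).
Proof.
move=> h1 h2; have [C [C1 fg1 fg2]] := C11_max h1 h2.
exists (C + C) => [|x y Ex Ey]; first by lra.
have [a1 a2 a3 a4 a5] := fg1 x y Ex Ey; have [b1 b2 b3 b4 b5] := fg2 x y Ex Ey.
split.
- by rewrite (le_trans (ler_normD _ _))// lerD.
- by rewrite (le_trans (ler_normD _ _))// lerD.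
- by rewrite opprD addrACA (le_trans (ler_normD _ _))// mulrDl lerD.
- by rewrite opprD addrACA (le_trans (ler_normD _ _))// mulrDl lerD.
- rewrite dotvDl (_ : _ - _ - _ = f1 y - f1 x - dotv (g1 x) (y - x)
     + (f2 y - f2 x - dotv (g2 x) (y - x))); last by ring.
  by rewrite (le_trans (ler_normD _ _))// mulrDl lerD.
Qed.

Lemma C11_mul {R : realType} (E : set 'rV[R]_3) (f1 f2 : 'rV[R]_3 -> R) g1 g2 :
  C11 E f1 g1 -> C11 E f2 g2 ->
  C11 E (fun x => f1 x * f2 x) (fun x => f1 x *: g2 x + f2 x *: g1 x).
Proof.
move=> h1 h2; have [C [C1 fg1 fg2]] := C11_max h1 h2.
have C0 : 0 <= C by lra.
have CC : 1 <= C * C by nra.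
exists (4 * (C * C)) => [|x y Ex Ey]; first by lra.
have [a1 a2 a3 a4 a5] := fg1 x y Ex Ey; have [b1 b2 b3 b4 b5] := fg2 x y Ex Ey.
have [a1' _ _ _ _] := fg1 y x Ey Ex; have [b1' _ _ _ _] := fg2 y x Ey Ex.
set d := `|y - x| in a3 a4 a5 b3 b4 b5 *; have d0 : 0 <= d by exact: normr_ge0.
have Cd0 : 0 <= C * C * d by rewrite !mulr_ge0.
split.
- by apply: (@le_trans _ _ (C * C)); [rewrite normrM ler_pM|lra].
- rewrite (le_trans (ler_normD _ _))// !normrZ (@le_trans _ _ (C * C + C * C))//; last by lra.
  by rewrite lerD// ler_pM.
- rewrite (_ : _ - _ = (f1 y *: (g2 y - g2 x) + (f1 y - f1 x) *: g2 x)
     + (f2 y *: (g1 y - g1 x) + (f2 y - f2 x) *: g1 x)); last first.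
    by apply/rowP => i; rewrite !mxE; ring.
  have -> : 4 * (C * C) * d = C * (C * d) + C * d * C + (C * (C * d) + C * d * C) by ring.
  rewrite (le_trans (ler_normD _ _))// lerD// (le_trans (ler_normD _ _))// lerD//;
    by rewrite normrZ ler_pM.
- rewrite (_ : _ - _ = f1 y * (f2 y - f2 x) + (f1 y - f1 x) * f2 x); last by ring.
  rewrite (le_trans (ler_normD _ _))// (@le_trans _ _ (C * (C * d) + C * d * C))//.
    by rewrite lerD// normrM ler_pM.
  lra.
- rewrite dotvDl !dotvZl (_ : _ - _ - _ = (f1 y - f1 x) * (f2 y - f2 x)
     + f1 x * (f2 y - f2 x - dotv (g2 x) (y - x))
     + f2 x * (f1 y - f1 x - dotv (g1 x) (y - x))); last by ring.
  apply: (@le_trans _ _ (C * d * (C * d) + C * (C * d ^+ 2) + C * (C * d ^+ 2))).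
    rewrite (le_trans (ler_normD _ _))// lerD// ?(le_trans (ler_normD _ _))// ?lerD// normrM ler_pM//.
  have : 0 <= C * C * d ^+ 2 by rewrite !mulr_ge0 ?exprn_ge0.
  lra.
Qed.

Lemma C11_scale {R : realType} (E : set 'rV[R]_3) (f : 'rV[R]_3 -> R) g (c : R) :
  C11 E f g -> C11 E (fun x => c * f x) (fun x => c *: g x).
Proof.
move=> fg; apply: C11_eq (C11_mul (C11_cst E c) fg) => // x _.
by rewrite scaler0 addr0.
Qed.

Lemma C11_opp {R : realType} (E : set 'rV[R]_3) (f : 'rV[R]_3 -> R) g :
  C11 E f g -> C11 E (fun x => - f x) (fun x => - g x).
Proof.
by move=> fg; apply: C11_eq (C11_scale (-1) fg) => x _; rewrite ?mulN1r ?scaleN1r.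
Qed.

Lemma C11_sub {R : realType} (E : set 'rV[R]_3) (f1 f2 : 'rV[R]_3 -> R) g1 g2 :
  C11 E f1 g1 -> C11 E f2 g2 ->
  C11 E (fun x => f1 x - f2 x) (fun x => g1 x - g2 x).
Proof. by move=> h1 h2; exact: C11_add h1 (C11_opp h2). Qed.

Definition C11_real {R : realType} (k dk : R -> R) (C : R) : Prop :=
  forall a b, `|dk b - dk a| <= C * `|b - a| /\
    `|k b - k a - dk a * (b - a)| <= C * (b - a) ^+ 2.

Lemma C11_comp {R : realType} (E : set 'rV[R]_3) (f : 'rV[R]_3 -> R) g
    (k dk : R -> R) (D : R) : C11_real k dk D -> C11 E f g ->
  C11 E (fun x => k (f x)) (fun x => dk (f x) *: g x).
Proof.
move=> kD [C C1 fg].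
have D0 : 0 <= D by have [+ _] := kD 0 1; rewrite subr0 normr1 mulr1; apply: le_trans.
have C0 : 0 <= C by lra.
(* [M] and [B] bound dk and k on [-C, C], which contains the values of f; on the whole line both may
   be unbounded. *)
pose M := `|dk 0| + D * C.
have M0 : 0 <= M by rewrite addr_ge0// mulr_ge0.
have dkM x : E x -> `|dk (f x)| <= M.
  move=> Ex; have [fC _ _ _ _] := fg x x Ex Ex.
  rewrite -(subrK (dk 0) (dk (f x))) (le_trans (ler_normD _ _))// /M addrC lerD//.
  have [h _] := kD 0 (f x); apply: (le_trans h); rewrite subr0 ler_wpM2l//.
pose B := `|k 0| + M * C + D * C ^+ 2.
have kB x : E x -> `|k (f x)| <= B.
  move=> Ex; have [fC _ _ _ _] := fg x x Ex Ex.
  have -> : k (f x) = k 0 + dk 0 * f x + (k (f x) - k 0 - dk 0 * (f x - 0)) by ring.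
  rewrite (le_trans (ler_normD _ _))// lerD//.
    rewrite (le_trans (ler_normD _ _))// lerD// normrM ler_pM// /M lerDl mulr_ge0//.
  have [_ h] := kD 0 (f x); apply: (le_trans h); rewrite ler_wpM2l//.
  by rewrite subr0 -real_normK ?num_real// ler_sqr ?nnegrE.
pose Q := 1 + B + M * C + D * C * C + 2 * D * C * C.
have B0 : 0 <= B by rewrite /B !addr_ge0 ?mulr_ge0// exprn_ge0.
have DCC : 0 <= D * C * C by rewrite !mulr_ge0.
have MC : 0 <= M * C by rewrite mulr_ge0.
exists Q => [|x y Ex Ey]; first by rewrite /Q; lra.
have [a1 a2 a3 a4 a5] := fg x y Ex Ey; have [a1' _ _ _ _] := fg y x Ey Ex.
have [k1 k2] := kD (f x) (f y).
set d := `|y - x| in a3 a4 a5 *; have d0 : 0 <= d by exact: normr_ge0.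
have DCd : 0 <= D * C * C * d by rewrite !mulr_ge0.
have MCd : 0 <= M * C * d by rewrite !mulr_ge0.
have Bd : 0 <= B * d by rewrite !mulr_ge0.
split.
- by apply: (le_trans (kB _ Ex)); rewrite /Q; lra.
- by rewrite normrZ (@le_trans _ _ (M * C)) ?ler_pM ?dkM// /Q; lra.
- rewrite (_ : _ - _ = dk (f y) *: (g y - g x) + (dk (f y) - dk (f x)) *: g x); last first.
    by apply/rowP => i; rewrite !mxE; ring.
  rewrite (le_trans (ler_normD _ _))// !normrZ.
  apply: (@le_trans _ _ (M * (C * d) + D * (C * d) * C)); last by rewrite /Q; lra.
  by rewrite lerD// ler_pM ?dkM// (le_trans k1)// ler_wpM2l.
- have -> : k (f y) - k (f x) = dk (f x) * (f y - f x)
     + (k (f y) - k (f x) - dk (f x) * (f y - f x)) by ring.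
  rewrite (le_trans (ler_normD _ _))//.
  apply: (@le_trans _ _ (M * (C * d) + D * ((C + C) * (C * d)))); last by rewrite /Q; lra.
  rewrite lerD// ?normrM ?ler_pM ?dkM//; apply: (le_trans k2); rewrite ler_wpM2l//.
  rewrite -real_normK ?num_real// expr2 ler_pM//.
  by rewrite (le_trans (ler_normB _ _))// lerD.
- rewrite dotvZl (_ : _ - _ - _ = (k (f y) - k (f x) - dk (f x) * (f y - f x))
    + dk (f x) * (f y - f x - dotv (g x) (y - x))); last by ring.
  rewrite (le_trans (ler_normD _ _))//.
  apply: (@le_trans _ _ (D * (C * d) ^+ 2 + M * (C * d ^+ 2))).
    rewrite lerD// ?normrM ?ler_pM ?dkM//; apply: (le_trans k2); rewrite ler_wpM2l//.
    by rewrite -real_normK ?num_real// ler_sqr ?nnegrE ?mulr_ge0.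
  have dd : 0 <= d ^+ 2 by rewrite exprn_ge0.
  rewrite (_ : _ + _ = (D * C * C + M * C) * d ^+ 2); last by ring.
  by rewrite ler_wpM2r// /Q; lra.
Qed.

(** Only C^{1,1}, with some choice of gradient; higher derivatives are not meant. *)
Definition smooth {R : realType} (E : set 'rV[R]_3) (f : 'rV[R]_3 -> R) : Prop :=
  exists g, C11 E f g.

Section smooth_closure.
Context {R : realType} (E : set 'rV[R]_3).
Implicit Types f : 'rV[R]_3 -> R.

Lemma smooth_cst (c : R) : smooth E (fun=> c).
Proof. by exists (fun=> 0); exact: C11_cst. Qed.

Lemma smooth_add f1 f2 : smooth E f1 -> smooth E f2 -> smooth E (fun x => f1 x + f2 x).
Proof. by move=> [g1 h1] [g2 h2]; eexists; exact: C11_add h1 h2. Qed.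

Lemma smooth_sub f1 f2 : smooth E f1 -> smooth E f2 -> smooth E (fun x => f1 x - f2 x).
Proof. by move=> [g1 h1] [g2 h2]; eexists; exact: C11_sub h1 h2. Qed.

Lemma smooth_mul f1 f2 : smooth E f1 -> smooth E f2 -> smooth E (fun x => f1 x * f2 x).
Proof. by move=> [g1 h1] [g2 h2]; eexists; exact: C11_mul h1 h2. Qed.

Lemma smooth_dotv (F1 F2 : 'rV[R]_3 -> 'rV[R]_3) :
  (forall i, smooth E (fun x => F1 x ord0 i)) ->
  (forall i, smooth E (fun x => F2 x ord0 i)) ->
  smooth E (fun x => dotv (F1 x) (F2 x)).
Proof.
move=> h1 h2; have -> : (fun x => dotv (F1 x) (F2 x)) =
    (fun x => F1 x ord0 ord0 * F2 x ord0 ord0 + F1 x ord0 1 * F2 x ord0 1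
             + F1 x ord0 2%R * F2 x ord0 2%R) by apply/funext => x; rewrite dotvE.
by do ! apply: smooth_add; exact: smooth_mul.
Qed.

Lemma smooth_coord M i : (forall x, E x -> `|x| <= M) -> smooth E (fun x => x ord0 i).
Proof.
move=> EM; exists (fun=> delta_mx ord0 i).
apply: C11_eq (C11_dotv (delta_mx ord0 i) EM) => // x _.
rewrite /dotv (bigD1 i)//= mxE !eqxx mulr1 big1 ?addr0// => j ji.
by rewrite mxE (negbTE ji) andbF mulr0.
Qed.

Lemma smooth_common (F : 'rV[R]_3 -> 'rV[R]_3) :
  (forall i, smooth E (fun x => F x ord0 i)) ->
  exists g C, 1 <= C /\ forall i, C11_bound E (fun x => F x ord0 i) (g i) C.
Proof.
move=> /choice[g gP].
have /choice[C CP] i : exists C, 1 <= C /\ C11_bound E (fun x => F x ord0 i) (g i) C.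
  by have [C ? ?] := gP i; exists C.
have le i : C i <= \sum_(i < 3) C i.
  rewrite (bigD1 i)//= lerDl sumr_ge0// => j _.
  by have [? _] := CP j; apply: le_trans ler01 _.
exists g, (\sum_(i < 3) C i); split.
  by have [h _] := CP ord0; exact: le_trans (le ord0).
by move=> i; have [_] := CP i; exact: C11_boundW.
Qed.

Lemma smooth_lipschitz (F : 'rV[R]_3 -> 'rV[R]_3) :
  (forall i, smooth E (fun x => F x ord0 i)) ->
  exists2 C, 1 <= C & forall x y, E x -> E y ->
    `|F x| <= C /\ `|F x - F y| <= C * `|x - y|.
Proof.
move=> /smooth_common[g [C [C1 gC]]]; exists C => // x y Ex Ey.
have C0 : 0 <= C by exact: le_trans C1.
split; (apply: norm_le_coord => [|i]; first by rewrite ?mulr_ge0).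
  by have [] := gC i x y Ex Ey.
by rewrite rV_subE; have [] := gC i y x Ey Ex.
Qed.

End smooth_closure.

Lemma cvg_rV_coord {R : realType} (X : R -> 'rV[R]_3) (t e : R) : 0 < e ->
  (forall i, continuous (fun s => X s ord0 i)) -> \forall s \near t, `|X t - X s| <= e.
Proof.
move=> e0 cX.
near=> s; apply: norm_le_coord => [|i]; first exact: ltW.
rewrite rV_subE; move: i; near: s; apply: filter_forall => i.
exact: ((cvgrPdist_le _ _).1 (cX i t) _ e0).
Unshelve. all: by end_near. Qed.

Lemma lipschitz_comp_continuous {R : realType} (X : R -> 'rV[R]_3) (f : R -> R) K :
  (forall i, continuous (fun s => X s ord0 i)) ->
  (forall s t, `|f s - f t| <= K * `|X s - X t|) -> continuous f.
Proof.
move=> cX fK t; apply/cvgrPdist_le => /= e e0.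
have K0 : 0 < `|K| + 1 by rewrite ltr_pwDr.
have := cvg_rV_coord t (divr_gt0 e0 K0) cX; apply: filterS => s h.
apply: (le_trans (fK _ _)); apply: (@le_trans _ _ ((`|K| + 1) * `|X t - X s|)).
  by rewrite ler_wpM2r// (le_trans (ler_norm _))// lerDl.
by rewrite mulrC -ler_pdivlMr.
Qed.

Lemma gronwall_eq0 {R : realType} (w dw : R -> 'rV[R]_3) (K : R) : 0 <= K ->
  (forall (t : R) i, is_derive t 1 (fun s => w s ord0 i) (dw t ord0 i)) ->
  (forall t, `|dw t| <= K * `|w t|) -> w 0 = 0 -> forall t, w t = 0.
Proof.
move=> K0 wd dwle w0 t; apply/eqP; rewrite -normr_le0.
have [t0|t0] := leP 0 t.
  have := @gronwall _ w dw K 0 t K0 (lexx _) t0 (fun s _ => wd s).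
  rewrite w0 normr0 addr0 mulr0; apply => s _.
  by rewrite addr0.
have := @gronwall _ (fun s => w (- s)) (fun s => - dw (- s)) K 0 (- t) K0 (lexx _).
rewrite oppr0 w0 normr0 addr0 mulr0 opprK; apply => [|s _ i|s _].
- by rewrite oppr_ge0 ltW.
- by rewrite mxE; exact: is_derive_comp_opp.
- by rewrite normrN addr0.
Qed.

(** * The polynomial field and its flow *)

(* On the sphere of radius r centered at 0, |x - w|^2 = 2 (r^2 - x.w). *)
Definition halfdist2 {R : realType} (r : R) (w x : 'rV[R]_3) : R := r ^+ 2 - dotv x w.

(** The product rho of the overview. On the sphere the potential is half the logarithm of 2^n rho,
    where n = [size l]. *)
Fixpoint wells {R : realType} (r : R) (l : seq 'rV[R]_3) (x : 'rV[R]_3) : R :=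
  if l is w :: l' then halfdist2 r w x * wells r l' x else 1.

(** Minus the gradient of [wells] in R^3: the sum over w of w times the product of the other
    factors. *)
Fixpoint attraction {R : realType} (r : R) (l : seq 'rV[R]_3) (x : 'rV[R]_3) : 'rV[R]_3 :=
  if l is w :: l' then wells r l' x *: w + halfdist2 r w x *: attraction r l' x else 0.

(* On the sphere this is - r^2 times the Riemannian gradient of [wells], and
   2 r^2 [wells] times the gravitational force. *)
Definition flow_field {R : realType} (r : R) (l : seq 'rV[R]_3) (x : 'rV[R]_3) : 'rV[R]_3 :=
  dotv x x *: attraction r l x - dotv x (attraction r l x) *: x.

Definition sphere {R : realType} (r : R) : set 'rV[R]_3 := [set x | dotv x x = r ^+ 2].

Lemma osphereE {R : realType} (r : R) : 0 <= r -> osphere r = sphere r.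
Proof.
move=> r0; apply/seteqP; split=> x; rewrite /osphere /sphere /enorm/=.
  by move=> <-; rewrite sqr_sqrtr// dotv_ge0.
by move=> ->; rewrite sqrtr_sqr ger0_norm.
Qed.

Lemma sphere_norm {R : realType} (r : R) x : 0 <= r -> sphere r x -> `|x| <= r.
Proof.
move=> r0; rewrite /sphere/= => xr.
by rewrite -ler_sqr ?nnegrE// -xr sqr_norm_le_dotv.
Qed.

(** The coefficient [dotv x x] in [flow_field], in place of [r ^+ 2], makes the field tangent to
    every sphere centered at 0. [flow_sphere] uses this before the orbit is known to stay on the
    sphere of radius r. *)
Lemma dotv_flow_field {R : realType} (r : R) l x : dotv x (flow_field r l x) = 0.
Proof. by rewrite /flow_field dotvBr !dotvZr mulrC subrr. Qed.

Section flow_field_smooth.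
Context {R : realType} (r : R) (E : set 'rV[R]_3) (M : R).
Hypothesis EM : forall x, E x -> `|x| <= M.

Lemma C11_halfdist2 w : C11 E (halfdist2 r w) (fun=> - w).
Proof.
apply: C11_eq (C11_sub (C11_cst E (r ^+ 2)) (C11_dotv w EM)) => // x _.
by rewrite sub0r.
Qed.

Lemma C11_wells l : C11 E (wells r l) (fun x => - attraction r l x).
Proof.
elim: l => [|w l IH] /=.
  by apply: C11_eq (C11_cst E 1) => // x _; rewrite oppr0.
apply: C11_eq (C11_mul (C11_halfdist2 w) IH) => // x _.
by rewrite !scalerN opprD addrC.
Qed.

Lemma smooth_attraction l i : smooth E (fun x => attraction r l x ord0 i).
Proof.
elim: l i => [|w l IH] i.
  have -> : (fun x => attraction r [::] x ord0 i) = fun=> 0 by apply/funext => x; rewrite mxE.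
  exact: smooth_cst.
have -> : (fun x => attraction r (w :: l) x ord0 i) = (fun x =>
   wells r l x * w ord0 i + halfdist2 r w x * attraction r l x ord0 i).
  by apply/funext => x; rewrite !mxE.
apply: smooth_add; first by apply: smooth_mul (smooth_cst _ _); eexists; exact: C11_wells.
by apply: smooth_mul (IH i); eexists; exact: C11_halfdist2.
Qed.

Lemma smooth_flow_field l i : smooth E (fun x => flow_field r l x ord0 i).
Proof.
have sx j : smooth E (fun x => x ord0 j) by exact: smooth_coord EM.
have -> : (fun x => flow_field r l x ord0 i) = (fun x =>
   dotv x x * attraction r l x ord0 i - dotv x (attraction r l x) * x ord0 i).
  by apply/funext => x; rewrite !mxE.
apply: smooth_sub; apply: smooth_mul => //; try exact: smooth_attraction.
  exact: smooth_dotv.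
by apply: smooth_dotv => // j; exact: smooth_attraction.
Qed.

End flow_field_smooth.

(** For c >= 0, a retraction onto the cube of half side c, 1-Lipschitz in the sup norm. Composed
    with it for c = 2 r, the polynomial field becomes bounded and globally Lipschitz, and it is
    unchanged near the sphere. *)
Definition clip {R : realType} (c : R) (x : 'rV[R]_3) : 'rV[R]_3 :=
  \row_i Num.max (- c) (Num.min c (x ord0 i)).

Lemma clip_norm {R : realType} (c : R) x : 0 <= c -> `|clip c x| <= c.
Proof.
move=> c0; apply: norm_le_coord => // i; rewrite mxE ler_norml; apply/andP; split.
  by rewrite le_max lexx.
by rewrite ge_max ge_min lexx andbT; lra.
Qed.

Lemma clip_id {R : realType} (c : R) x : `|x| <= c -> clip c x = x.
Proof.
move=> xc; apply/rowP => i; rewrite mxE.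
have := le_trans (coord_le_norm x i) xc; rewrite ler_norml => /andP[h1 h2].
by rewrite min_r// max_r.
Qed.

Lemma clip_lip {R : realType} (c : R) x y : 0 <= c -> `|clip c x - clip c y| <= `|x - y|.
Proof.
move=> c0; apply: norm_le_coord => // i; rewrite rV_subE !mxE.
apply: le_trans (coord_le_norm (x - y) i); rewrite rV_subE.
move: (x ord0 i) (y ord0 i) => a b; wlog ab : a b / a <= b.
  by move=> H; have [/H//|/ltW/H] := leP a b; rewrite distrC (distrC a).
rewrite distrC (distrC a) !ger0_norm ?subr_ge0//.
all: rewrite /Num.max /Num.min; do ! case: ifPn; rewrite -?leNgt; lra.
Qed.

(** Solves the clipped equation from every starting point; [flow_derive] removes the clipping for
    points of the sphere. *)
Definition flow {R : realType} (r : R) (l : seq 'rV[R]_3) (x : 'rV[R]_3) : R -> 'rV[R]_3 :=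
  xget (fun=> x) [set X : R -> 'rV[R]_3 | X 0 = x /\ forall (t : R) i,
    is_derive t 1 (fun s => X s ord0 i) (flow_field r l (clip (2 * r) (X t)) ord0 i)].

Lemma gronwall_cst_le {R : realType} (K s t : R) : 0 <= K -> 0 <= s <= t ->
  gronwall_cst K s <= gronwall_cst K t.
Proof.
move=> K0 /andP[s0 st]; rewrite /gronwall_cst ler_pM// ?mulr_ge0 ?expR_ge0 ?addr_ge0//.
  by rewrite ler_wpM2l// ler_expR ler_wpM2l// addr_ge0// mulr_ge0.
by rewrite lerD2l.
Qed.

Lemma continuous_dotv {T : topologicalType} {R : realType} (u v : T -> 'rV[R]_3) :
  (forall i, continuous (fun s => u s ord0 i)) ->
  (forall i, continuous (fun s => v s ord0 i)) ->
  continuous (fun s => dotv (u s) (v s)).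
Proof.
move=> cu cv; have -> : (fun s => dotv (u s) (v s)) =
    (fun s => u s ord0 ord0 * v s ord0 ord0 + u s ord0 1 * v s ord0 1
             + u s ord0 2%R * v s ord0 2%R) by apply/funext => x; rewrite dotvE.
move=> s; apply: cvgD; last by apply: cvgM; [exact: cu|exact: cv].
by apply: cvgD; (apply: cvgM; [exact: cu|exact: cv]).
Qed.

Lemma dotv_sumr {R : realType} n (w : 'rV[R]_3) (c : 'I_n -> R) (v : 'I_n -> 'rV[R]_3) :
  dotv w (\sum_j c j *: v j) = \sum_j c j * dotv w (v j).
Proof.
under [RHS]eq_bigr do rewrite -dotvZr.
apply: (big_morph (dotv w)) => [u u'|]; first exact: dotvDr.
by rewrite dotvC dotv0l.
Qed.

Section flow.
Context {R : realType} (r : R) (l : seq 'rV[R]_3).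
Hypothesis r_gt0 : 0 < r.

Let r_ge0 : 0 <= r. Proof. exact: ltW. Qed.
Let r2_ge0 : 0 <= 2 * r. Proof. by rewrite mulr_ge0. Qed.

Let clipped_lipschitz : exists2 C, 1 <= C & forall x y,
  `|flow_field r l (clip (2 * r) x)| <= C /\
  `|flow_field r l (clip (2 * r) x) - flow_field r l (clip (2 * r) y)| <= C * `|x - y|.
Proof.
have EM x : [set x : 'rV[R]_3 | `|x| <= 2 * r] x -> `|x| <= 2 * r by [].
have [C C1 CP] := smooth_lipschitz (smooth_flow_field r EM l).
exists C => // x y.
have [h1 h2] := CP _ _ (clip_norm x r2_ge0) (clip_norm y r2_ge0).
split=> //; apply: (le_trans h2); rewrite ler_wpM2l ?(le_trans _ C1)//.
exact: clip_lip.
Qed.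

Let flow_ex x : exists X : R -> 'rV[R]_3, X 0 = x /\ forall (t : R) i,
  is_derive t 1 (fun s => X s ord0 i) (flow_field r l (clip (2 * r) (X t)) ord0 i).
Proof.
have [C C1 CP] := clipped_lipschitz.
apply: (@picard _ (fun _ y => flow_field r l (clip (2 * r) y)) x C C).
- exact: lt_le_trans C1.
- move=> X cX i; apply: (@lipschitz_comp_continuous _ X _ C) => // s t.
  by rewrite -rV_subE; apply: (le_trans (coord_le_norm _ _)); have [] := CP (X s) (X t).
- by move=> _ y z; have [] := CP y z.
- by move=> _; have [] := CP x x.
Qed.

Let flowP x : flow r l x 0 = x /\ forall (t : R) i,
  is_derive t 1 (fun s => flow r l x s ord0 i)
    (flow_field r l (clip (2 * r) (flow r l x t)) ord0 i).
Proof.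
have [X XP] := flow_ex x.
exact: (@xgetPex _ (fun=> x) [set X : R -> 'rV[R]_3 | X 0 = x /\ forall (t : R) i,
    is_derive t 1 (fun s => X s ord0 i)
      (flow_field r l (clip (2 * r) (X t)) ord0 i)] (ex_intro _ X XP)).
Qed.

Lemma flow0 x : flow r l x 0 = x. Proof. by have [] := flowP x. Qed.

(** Put nu = [dotv X X] - r^2 and let |X| be the sup norm. Where |X| <= 2 r the clipping is inactive
    and nu' = 0; elsewhere |nu'| <= 6 C |X| while |nu| >= 3/4 |X|^2 >= 3/2 r |X|. So |nu'| <= (4 C /
    r) |nu| at all times, and Gronwall's lemma keeps nu at 0. *)
Lemma flow_sphere x t : sphere r x -> sphere r (flow r l x t).
Proof.
move=> xr; have [C C1 CP] := clipped_lipschitz.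
have C0 : 0 <= C by exact: le_trans C1.
have [X0 Xd] := flowP x; set X := flow r l x in X0 Xd *.
pose nu (t : R) := dotv (X t) (X t) - r ^+ 2.
pose G (t : R) := flow_field r l (clip (2 * r) (X t)).
have nud (s : R) : is_derive s 1 nu (dotv (G s) (X s) + dotv (X s) (G s)).
  have := is_derive_subr (is_derive_dotv (Xd s) (Xd s)) (is_derive_cst (r ^+ 2) s 1).
  by rewrite subr0.
(* Constant rows bring the scalar nu into the vector form of Gronwall's lemma without changing its
   norm. *)
pose w (t : R) : 'rV[R]_3 := const_mx (nu t).
pose dw (t : R) : 'rV[R]_3 := const_mx (dotv (G t) (X t) + dotv (X t) (G t)).
have normc (a : R) : `|const_mx a : 'rV[R]_3| = `|a|.
  apply/eqP; rewrite eq_le; apply/andP; split.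
    by apply: norm_le_coord => // i; rewrite mxE.
  by have := coord_le_norm (const_mx a : 'rV[R]_3) ord0; rewrite mxE.
have W : forall t, w t = 0.
  apply: (@gronwall_eq0 _ w dw (4 * C / r)).
  - by rewrite divr_ge0// mulr_ge0.
  - move=> s i; rewrite mxE; have -> : (fun s => w s ord0 i) = nu.
      by apply/funext => u; rewrite mxE.
    exact: nud.
  - move=> s; rewrite !normc (dotvC (G s)).
    have [Xr|Xr] := leP `|X s| (2 * r).
      by rewrite /G clip_id// dotv_flow_field addr0 normr0 mulr_ge0// divr_ge0// mulr_ge0.
    have h1 : `|dotv (X s) (G s)| <= 3 * `|X s| * C.
      apply: (le_trans (normr_dotv _ _)); rewrite ler_wpM2l ?mulr_ge0//.
      by have [] := CP (X s) (X s).
    have h2 := sqr_norm_le_dotv (X s).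
    have h3 : 3 / 4 * `|X s| ^+ 2 <= `|nu s|.
      apply: le_trans (ler_norm _); rewrite /nu.
      have : (2 * r) ^+ 2 <= `|X s| ^+ 2 by rewrite ler_sqr ?nnegrE// ltW.
      by rewrite exprMn; lra.
    have h4 : 2 * r * `|X s| <= `|X s| ^+ 2 by rewrite expr2 ler_wpM2r// ltW.
    apply: (le_trans (ler_normD _ _)).
    apply: (@le_trans _ _ (4 * C / r * (3 / 4 * (2 * r * `|X s|)))).
      rewrite (_ : _ * (_ / _ * _) = 6 * C * `|X s|); first lra.
      by field; rewrite gt_eqF.
    rewrite ler_wpM2l ?divr_ge0 ?mulr_ge0//.
    by apply: le_trans h3; rewrite ler_wpM2l ?divr_ge0.
  - by apply/rowP => i; rewrite !mxE /nu X0 xr subrr.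
have := W t => /rowP /(_ ord0); rewrite !mxE /nu => /eqP; rewrite subr_eq0 => /eqP h.
exact: h.
Qed.

Lemma flow_derive x (t : R) i : sphere r x ->
  is_derive t 1 (fun s => flow r l x s ord0 i) (flow_field r l (flow r l x t) ord0 i).
Proof.
move=> xr; have [_ /(_ t i)] := flowP x.
rewrite clip_id//; apply: (le_trans (sphere_norm r_ge0 (flow_sphere t xr))).
by have := r_ge0; lra.
Qed.

Let sphereM x : sphere r x -> `|x| <= r. Proof. exact: sphere_norm. Qed.

Lemma flow_unique x (X : R -> 'rV[R]_3) : sphere r x ->
  (forall t, sphere r (X t)) -> X 0 = x ->
  (forall (t : R) i, is_derive t 1 (fun s => X s ord0 i) (flow_field r l (X t) ord0 i)) ->
  forall t, X t = flow r l x t.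
Proof.
move=> xr Xr X0 Xd t; have [C C1 CP] := smooth_lipschitz (smooth_flow_field r sphereM l).
apply/eqP; rewrite -subr_eq0; apply/eqP.
apply: (@gronwall_eq0 _ (fun t => X t - flow r l x t)
  (fun t => flow_field r l (X t) - flow_field r l (flow r l x t)) C).
- exact: le_trans C1.
- move=> s i; rewrite rV_subE.
  have -> : (fun s => (X s - flow r l x s) ord0 i) =
      (fun s => X s ord0 i - flow r l x s ord0 i).
    by apply/funext => u; rewrite rV_subE.
  by apply: is_derive_subr; exact: flow_derive.
- by move=> s; have [] := CP _ _ (Xr s) (flow_sphere s xr).
- by rewrite X0 flow0 subrr.
Qed.

Lemma flow_add x s t : sphere r x -> flow r l (flow r l x s) t = flow r l x (s + t).
Proof.
move=> xr; symmetry; move: t.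
apply: (@flow_unique (flow r l x s) (fun t => flow r l x (s + t))).
- exact: flow_sphere.
- by move=> t; exact: flow_sphere.
- by rewrite addr0.
- move=> t i; have h := flow_derive (s + t) i xr.
  have h' : is_derive t 1 (fun u : R => s + u) 1.
    by have := is_derive_addr (is_derive_cst s t 1) (is_derive_id t 1); rewrite add0r.
  have := @is_derive1_comp _ (fun u => flow r l x u ord0 i) (fun u : R => s + u) t _ _ h h'.
  by rewrite mulr1.
Qed.

Lemma flow_fixpoint z t : sphere r z -> flow_field r l z = 0 -> flow r l z t = z.
Proof.
move=> zr z0; symmetry; move: t; apply: (@flow_unique z (fun=> z)) => // t i.
by rewrite z0 mxE; exact: is_derive_cst.
Qed.

Lemma flow_eq_fixpoint x z t : sphere r x -> flow_field r l z = 0 ->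
  flow r l x t = z -> x = z.
Proof.
move=> xr z0 xz; rewrite -(flow0 x) -(addrN t) -(flow_add _ _ xr) xz.
by apply: flow_fixpoint => //; rewrite -xz; exact: flow_sphere.
Qed.

(** [D] is the candidate for the partial derivative of the flow in coordinate j of the starting
    point, obtained from the linearised equation. The condition on x stands under the existential so
    that [choice] turns [D] into a function of all x and j. *)
Let variational (g : 'I_3 -> 'rV[R]_3 -> 'rV[R]_3) (C : R) : 1 <= C ->
  (forall i, C11_bound (sphere r) (fun x => flow_field r l x ord0 i) (g i) C) ->
  forall x j, exists D : R -> 'rV[R]_3, sphere r x -> D 0 = delta_mx ord0 j /\
    forall (t : R) i, is_derive t 1 (fun s => D s ord0 i) (dotv (g i (flow r l x t)) (D t)).
Proof.
move=> C1 gC x j; have [xr|xr] := pselect (sphere r x); last by exists (fun=> 0).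
have C0 : 0 <= C by exact: le_trans C1.
have gb i t : `|g i (flow r l x t)| <= C.
  by have [] := gC i _ _ (flow_sphere t xr) (flow_sphere t xr).
pose f (t : R) (v : 'rV[R]_3) : 'rV[R]_3 := \row_i dotv (g i (flow r l x t)) v.
have fb t (v : 'rV[R]_3) : `|f t v| <= 3 * C * `|v|.
  apply: norm_le_coord => [|i]; first by rewrite !mulr_ge0.
  rewrite mxE; apply: (le_trans (normr_dotv _ _)).
  by rewrite ler_wpM2r// ler_wpM2l.
have [D [D0 Dd]] : exists X : R -> 'rV[R]_3, X 0 = delta_mx ord0 j /\
    forall (t : R) i, is_derive t 1 (fun s => X s ord0 i) (f t (X t) ord0 i).
  apply: (@picard _ f (delta_mx ord0 j) (3 * C) (3 * C)).
  - by rewrite mulr_gt0// (lt_le_trans _ C1).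
  - move=> X cX i.
    have -> : (fun s => f s (X s) ord0 i) = (fun s => dotv (g i (flow r l x s)) (X s)).
      by apply/funext => s; rewrite mxE.
    apply: continuous_dotv => // k.
    apply: (@lipschitz_comp_continuous _ (flow r l x) _ C) => [m t|s t].
      exact: is_derive_continuous (flow_derive t m xr).
    rewrite -rV_subE; apply: (le_trans (coord_le_norm _ _)).
    by have [] := gC i _ _ (flow_sphere t xr) (flow_sphere s xr).
  - move=> t y z; have -> : f t y - f t z = f t (y - z).
      by apply/rowP => i; rewrite !mxE dotvBr.
    exact: fb.
  - move=> t; apply: (le_trans (fb _ _)); rewrite ler_piMr//; first by rewrite mulr_ge0.
    by apply: norm_le_coord => // i; rewrite mxE; case: (_ && _); rewrite ?normr1 ?normr0.
by exists D => _; split=> // t i; have := Dd t i; rewrite mxE.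
Qed.

(** Gronwall's lemma is applied to the difference of two orbits, to the columns [D], to their
    differences, and to the remainder of the linear approximation. Row i of the matrix with columns
    [D x j t] is then the gradient. *)
Lemma smooth_flow t i : 0 <= t -> smooth (sphere r) (fun x => flow r l x t ord0 i).
Proof.
move=> t0; have [g [C [C1 gC]]] := smooth_common (smooth_flow_field r sphereM l).
have C0 : 0 <= C by exact: le_trans C1.
have [D DP] := choice (fun x => let: existT D DP := choice (variational C1 gC x) in
  ex_intro (fun D : 'I_3 -> R -> 'rV[R]_3 => forall j, sphere r x ->
    D j 0 = delta_mx ord0 j /\ forall (t : R) i, is_derive t 1 (fun s => D j s ord0 i)
      (dotv (g i (flow r l x t)) (D j t))) D DP).
have K0 : 0 <= 3 * C by rewrite mulr_ge0.
pose B := gronwall_cst (3 * C) t.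
have B0 : 0 <= B by exact: gronwall_cst_ge0.
have gB s : 0 <= s <= t -> gronwall_cst (3 * C) s <= B by exact: gronwall_cst_le.
clearbody B.
have Fl x y s : 0 <= s <= t -> sphere r x -> sphere r y ->
    `|flow r l y s - flow r l x s| <= B * `|y - x|.
  move=> st xr yr; have /andP[s0 _] := st.
  have := @gronwall _ (fun s => flow r l y s - flow r l x s)
    (fun s => flow_field r l (flow r l y s) - flow_field r l (flow r l x s)) (3 * C) 0 s
    K0 (lexx _) s0.
  rewrite !flow0 addr0 => h; apply: le_trans (h _ _) _ => [u _ k|u _|].
  - rewrite rV_subE.
    have -> : (fun s => (flow r l y s - flow r l x s) ord0 k) =
      (fun s => flow r l y s ord0 k - flow r l x s ord0 k).
      by apply/funext => v; rewrite rV_subE.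
    by apply: is_derive_subr; exact: flow_derive.
  - rewrite addr0; apply: norm_le_coord => [|k]; first by rewrite mulr_ge0.
    rewrite rV_subE; have [_ _ _ h4 _] := gC k _ _ (flow_sphere u xr) (flow_sphere u yr).
    by apply: (le_trans h4); rewrite ler_wpM2r//; lra.
  - by rewrite ler_wpM2r// gB.
have gb k x s : sphere r x -> `|g k (flow r l x s)| <= C.
  by move=> xr; have [] := gC k _ _ (flow_sphere s xr) (flow_sphere s xr).
have Db x j s : 0 <= s <= t -> sphere r x -> `|D x j s| <= B.
  move=> st xr; have /andP[s0 _] := st; have [D0 Dd] := DP x j xr.
  have := @gronwall _ (D x j) (fun s => \row_k dotv (g k (flow r l x s)) (D x j s))
    (3 * C) 0 s K0 (lexx _) s0.
  rewrite addr0 => h; apply: le_trans (h _ _) _ => [u _ k|u _|].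
  - by rewrite mxE; exact: Dd.
  - rewrite addr0; apply: norm_le_coord => [|k]; first by rewrite mulr_ge0.
    rewrite mxE; apply: (le_trans (normr_dotv _ _)).
    by rewrite ler_wpM2r// ler_wpM2l// gb.
  - rewrite D0 -[leRHS]mulr1 ler_pM//; last 2 first.
    + exact: gB.
    + by apply: norm_le_coord => // k; rewrite mxE; case: (_ && _); rewrite ?normr1 ?normr0.
    by exact: gronwall_cst_ge0.
have tt : 0 <= t <= t by rewrite t0 lexx.
have Dl x y j : sphere r x -> sphere r y ->
    `|D y j t - D x j t| <= B * (3 * (C * (B * `|y - x|)) * B).
  move=> xr yr; have [Dx0 Dxd] := DP x j xr; have [Dy0 Dyd] := DP y j yr.
  have e0 : 0 <= 3 * (C * (B * `|y - x|)) * B by rewrite !mulr_ge0.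
  have := @gronwall _ (fun s => D y j s - D x j s)
    (fun s => \row_k (dotv (g k (flow r l y s)) (D y j s) - dotv (g k (flow r l x s)) (D x j s)))
    (3 * C) _ t K0 e0 t0.
  rewrite Dx0 Dy0 subrr normr0 add0r => h; apply: le_trans (h _ _) _ => [u _ k|u ut|].
  - rewrite mxE.
    have -> : (fun s => (D y j s - D x j s) ord0 k) = (fun s => D y j s ord0 k - D x j s ord0 k).
      by apply/funext => v; rewrite rV_subE.
    exact: is_derive_subr.
  - apply: norm_le_coord => [|k]; first by rewrite addr_ge0// mulr_ge0.
    rewrite mxE (_ : _ - _ = dotv (g k (flow r l y u)) (D y j u - D x j u)
      + dotv (g k (flow r l y u) - g k (flow r l x u)) (D x j u)); last first.
      by rewrite dotvBl dotvBr; ring.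
    apply: (le_trans (ler_normD _ _)); rewrite lerD// (le_trans (normr_dotv _ _))//.
      by rewrite ler_wpM2r// ler_wpM2l// gb.
    rewrite ler_pM// ?mulr_ge0// ?Db// ler_wpM2l//.
    have [_ _ h3 _ _] := gC k _ _ (flow_sphere u xr) (flow_sphere u yr).
    by apply: (le_trans h3); rewrite ler_wpM2l// Fl.
  - by rewrite ler_wpM2r// gB.
(* The remainder w solves w_k' = g_k . w + error, where the error is the second order remainder of
   the field, at most C times the squared distance of the two orbits. *)
have rem x y : sphere r x -> sphere r y ->
    `|flow r l y t - flow r l x t - \sum_(j < 3) (y - x) ord0 j *: D x j t|
      <= B * (C * (B * `|y - x|) ^+ 2).
  move=> xr yr.
  have e0 : 0 <= C * (B * `|y - x|) ^+ 2 by rewrite mulr_ge0// exprn_ge0// mulr_ge0.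
  pose w (s : R) := flow r l y s - flow r l x s - \sum_(j < 3) (y - x) ord0 j *: D x j s.
  have := @gronwall _ w (fun s => \row_k
     (flow_field r l (flow r l y s) ord0 k - flow_field r l (flow r l x s) ord0 k -
      dotv (g k (flow r l x s)) (\sum_(j < 3) (y - x) ord0 j *: D x j s)))
    (3 * C) _ t K0 e0 t0.
  have -> : w 0 = 0.
    rewrite /w !flow0 [X in _ - X](_ : _ = y - x) ?subrr//.
    rewrite [RHS]row_sum_delta; apply: eq_bigr => j _.
    by have [-> _] := DP x j xr.
  rewrite normr0 add0r => h; apply: le_trans (h _ _) _ => [u _ k|u ut|].
  - rewrite mxE.
    have -> : (fun s => w s ord0 k) = (fun s => flow r l y s ord0 k - flow r l x s ord0 k
        - \sum_(j < 3) (y - x) ord0 j * D x j s ord0 k).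
      apply/funext => v; rewrite /w !rV_subE summxE; congr (_ - _).
      by apply: eq_bigr => j _; rewrite !mxE.
    apply: is_derive_subr.
      by apply: is_derive_subr; exact: flow_derive.
    rewrite (_ : dotv _ _ = \sum_(j < 3) (y - x) ord0 j * dotv (g k (flow r l x u)) (D x j u)).
      apply: is_derive_sumr => j; have [_ Dd] := DP x j xr.
      have := is_derive_mulr (is_derive_cst ((y - x) ord0 j) u 1) (Dd u k).
      by rewrite mul0r add0r.
    exact: dotv_sumr.
  - apply: norm_le_coord => [|k]; first by rewrite addr_ge0// mulr_ge0.
    rewrite mxE (_ : _ - _ = dotv (g k (flow r l x u)) (w u)
      + (flow_field r l (flow r l y u) ord0 k - flow_field r l (flow r l x u) ord0 k
          - dotv (g k (flow r l x u)) (flow r l y u - flow r l x u))); last first.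
      by rewrite /w !dotvBr; ring.
    apply: (le_trans (ler_normD _ _)); rewrite lerD//.
      by apply: (le_trans (normr_dotv _ _)); rewrite ler_wpM2r// ler_wpM2l// gb.
    have [_ _ _ _ h5] := gC k _ _ (flow_sphere u xr) (flow_sphere u yr).
    by apply: (le_trans h5); rewrite ler_wpM2l// ler_sqr ?nnegrE ?mulr_ge0// Fl.
  - by rewrite ler_wpM2r// gB.
exists (fun x => \row_j D x j t ord0 i).
exists (1 + r + B + 3 * C * B * B * B + C * B * B * B).
  have CB : 0 <= C * B * B * B by rewrite !mulr_ge0.
  have r0 := r_gt0; lra.
have CB : 0 <= C * B * B * B by rewrite !mulr_ge0.
have r0 := r_gt0.
move=> x y xr yr; split.
- apply: (le_trans (coord_le_norm _ _)); apply: (le_trans (sphereM (flow_sphere t xr))).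
  lra.
- apply: norm_le_coord => [|j]; first lra.
  rewrite mxE; apply: (le_trans (coord_le_norm _ _)); apply: (le_trans (Db x j t tt xr)).
  lra.
- apply: norm_le_coord => [|j]; first by rewrite mulr_ge0//; lra.
  rewrite rV_subE !mxE -rV_subE; apply: (le_trans (coord_le_norm _ _)).
  apply: (le_trans (Dl x y j xr yr)).
  have -> : B * (3 * (C * (B * `|y - x|)) * B) = 3 * C * B * B * B * `|y - x| by ring.
  by rewrite ler_wpM2r//; lra.
- rewrite -rV_subE; apply: (le_trans (coord_le_norm _ _)).
  by apply: (le_trans (Fl x y t tt xr yr)); rewrite ler_wpM2r//; lra.
- have := le_trans (coord_le_norm _ i) (rem x y xr yr).
  rewrite !rV_subE summxE (_ : \sum_(j < 3) _ = dotv (\row_j D x j t ord0 i) (y - x)); last first.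
    by apply: eq_bigr => j _; rewrite !mxE mulrC.
  move=> h; apply: (le_trans h).
  have -> : B * (C * (B * `|y - x|) ^+ 2) = C * B * B * B * `|y - x| ^+ 2 by ring.
  by rewrite ler_wpM2r ?exprn_ge0//; lra.
Qed.

End flow.

(** * Integration over the sphere *)

(** The class of integrands: composed with [spherical], such functions are measurable and bounded,
    hence integrable over [angles]. *)
Definition bounded_lipschitz {R : realType} (E : set 'rV[R]_3) (f : 'rV[R]_3 -> R) : Prop :=
  exists2 C, 0 <= C & forall x y, E x -> E y ->
    `|f x| <= C /\ `|f y - f x| <= C * `|y - x|.

Lemma C11_bounded_lipschitz {R : realType} (E : set 'rV[R]_3) (f : 'rV[R]_3 -> R) g :
  C11 E f g -> bounded_lipschitz E f /\
  forall i, bounded_lipschitz E (fun x => g x ord0 i).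
Proof.
move=> [C C1 fg]; have C0 : 0 <= C by exact: le_trans C1.
split=> [|i]; exists C => // x y Ex Ey; have [h1 h2 h3 h4 h5] := fg x y Ex Ey => //.
split; first exact: le_trans (coord_le_norm _ _) h2.
by rewrite -rV_subE; exact: le_trans (coord_le_norm _ _) h3.
Qed.

Lemma measurable_sphere {R : realType} (r : R) : measurable (sphere r : set (borelR3 R)).
Proof.
rewrite -[X in measurable X]setCK; apply: measurableC; apply: sub_sigma_algebra.
apply: closed_openC.
have -> : sphere r = (fun x : 'rV[R]_3 => dotv x x) @^-1` [set r ^+ 2] by [].
apply: preimage_closed; last exact: closed_eq.
by move=> x _; apply: continuous_dotv => i; exact: coord_continuous.
Qed.

(** As f is controlled on the sphere only, the sublevel set is exhibited as the trace of an open
    set, the union of the balls of radius (a - f x) / (C + 1) about its points; the Lipschitz bound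
    keeps f below a on their traces. *)
Lemma measurable_sublevel {R : realType} (r : R) (f : 'rV[R]_3 -> R) a :
  bounded_lipschitz (sphere r) f ->
  measurable (sphere r `&` [set x | f x < a] : set (borelR3 R)).
Proof.
move=> [C C0 fC].
pose O : set 'rV[R]_3 := \bigcup_(x in [set x | sphere r x /\ f x < a])
  ball x ((a - f x) / (C + 1)).
have C10 : 0 < C + 1 by rewrite ltr_wpDl.
have oO : open O by apply: bigcup_open => x _; exact: ball_open.
have -> : sphere r `&` [set x | f x < a] = sphere r `&` O.
  apply/seteqP; split=> y [yr /= ya]; split=> //.
    by exists y => //; apply: ballxx; rewrite divr_gt0// subr_gt0.
  move: ya => [x [xr xa]]; rewrite -ball_normE/= ltr_pdivlMr// => h.
  have [_ h1] := fC x y xr yr.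
  have h2 : C * `|y - x| <= `|x - y| * (C + 1).
    by rewrite (distrC x) mulrC ler_wpM2l// lerDl.
  by have := ler_norm (f y - f x); lra.
apply: measurableI; first exact: measurable_sphere.
exact: sub_sigma_algebra.
Qed.

Lemma measurable_lipschitz_spherical {R : realType} (r : R) (f : 'rV[R]_3 -> R) :
  0 <= r -> bounded_lipschitz (sphere r) f ->
  measurable_fun setT (fun p => f (spherical r p)).
Proof.
move=> r0 fl; apply: (measurability _ (RGenInftyO.measurableE R)) => //.
move=> _ [_ [a ->] <-].
have -> : (fun p => f (spherical r p)) @^-1` `]-oo, a[%classic =
    spherical r @^-1` (sphere r `&` [set x | f x < a]).
  apply/seteqP; split=> p /=; rewrite in_itv/=; last by case.
  move=> fa; split=> //.
  by rewrite -osphereE//; exact: osphere_spherical.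
by apply: measurable_spherical => //; exact: measurable_sublevel.
Qed.

Definition bmeas {R : realType} (h : R * R -> R) : Prop :=
  measurable_fun setT h /\ exists C, forall p, `|h p| <= C.

Section bmeas.
Context {R : realType}.
Implicit Types h : R * R -> R.
Let mu2 := (@lebesgue_measure R \x @lebesgue_measure R)%E.

Lemma bmeas_add h1 h2 : bmeas h1 -> bmeas h2 -> bmeas (fun p => h1 p + h2 p).
Proof.
move=> [m1 [C1 b1]] [m2 [C2 b2]]; split; first exact: measurable_funD.
by exists (C1 + C2) => p; rewrite (le_trans (ler_normD _ _))// lerD.
Qed.

Lemma bmeas_mul h1 h2 : bmeas h1 -> bmeas h2 -> bmeas (fun p => h1 p * h2 p).
Proof.
move=> [m1 [C1 b1]] [m2 [C2 b2]]; split; first exact: measurable_funM.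
by exists (C1 * C2) => p; rewrite normrM ler_pM.
Qed.

Lemma bmeas_cst (c : R) : bmeas (fun=> c).
Proof. by split; [exact: measurable_cst|exists `|c|]. Qed.

Lemma bmeas_fst (k : R -> R) C : continuous k -> (forall x, `|k x| <= C) ->
  bmeas (fun p => k p.1).
Proof.
move=> ck kC; split; last by exists C.
by apply: measurableT_comp => //; apply: continuous_measurable_fun.
Qed.

Lemma bmeas_snd (k : R -> R) C : continuous k -> (forall x, `|k x| <= C) ->
  bmeas (fun p => k p.2).
Proof.
move=> ck kC; split; last by exists C.
by apply: measurableT_comp => //; apply: continuous_measurable_fun.
Qed.

Lemma normr_sin_le1 (x : R) : `|sin x| <= 1.
Proof. by rewrite ler_norml sin_geN1 sin_le1. Qed.

Lemma normr_cos_le1 (x : R) : `|cos x| <= 1.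
Proof. by rewrite ler_norml cos_geN1 cos_le1. Qed.

Lemma bmeas_sin_fst : bmeas (fun p : R * R => sin p.1).
Proof. exact: bmeas_fst (@continuous_sin R) normr_sin_le1. Qed.
Lemma bmeas_cos_fst : bmeas (fun p : R * R => cos p.1).
Proof. exact: bmeas_fst (@continuous_cos R) normr_cos_le1. Qed.
Lemma bmeas_sin_snd : bmeas (fun p : R * R => sin p.2).
Proof. exact: bmeas_snd (@continuous_sin R) normr_sin_le1. Qed.
Lemma bmeas_cos_snd : bmeas (fun p : R * R => cos p.2).
Proof. exact: bmeas_snd (@continuous_cos R) normr_cos_le1. Qed.

Lemma bmeas_spherical (r : R) (f : 'rV[R]_3 -> R) : 0 <= r ->
  bounded_lipschitz (sphere r) f -> bmeas (fun p => f (spherical r p)).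
Proof.
move=> r0 fl; split; first exact: measurable_lipschitz_spherical.
have [C _ fC] := fl; exists C => p.
have sr : sphere r (spherical r p) by rewrite -osphereE//; exact: osphere_spherical.
by have [] := fC _ _ sr sr.
Qed.

Lemma angles_finite : (mu2 angles < +oo)%E.
Proof.
rewrite /mu2 /angles product_measure1E//=. rewrite !lebesgue_measure_itv/=.
by do 2 case: ifP => _; rewrite ?mule0 ?mul0e// -!EFinB -EFinM ltry.
Qed.

Lemma bmeas_integrable h : bmeas h -> mu2.-integrable angles (EFin \o h).
Proof.
move=> [mh [C hC]]; apply: measurable_bounded_integrable.
- exact: measurable_angles.
- exact: angles_finite.
- exact: measurable_funS mh.
- exists C; split; first exact: num_real.
  by move=> M CM p _; apply: (le_trans (hC p)); exact: ltW.
Qed.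

Let patch_integrable h : bmeas h -> mu2.-integrable setT ((EFin \o h) \_ angles).
Proof.
move=> /bmeas_integrable hi.
have [h1 _] := integrable_restrict mu2 measurable_angles measurableT (EFin \o h).
by apply: h1; rewrite setTI.
Qed.

Lemma angles_integral0_fst h : bmeas h ->
  (forall y : R, (\int[@lebesgue_measure R]_(x in `[0%R, pi%R]) (h (x, y))%:E = 0)%E) ->
  \int[mu2]_(p in angles) h p = 0.
Proof.
move=> hb h0; rewrite /Rintegral integral_mkcond/= -integral21_prod_meas1; last first.
  exact: patch_integrable.
rewrite (_ : integral _ _ _ = 0%E)//.
rewrite -[RHS](integral0 lebesgue_measure setT); apply: eq_integral => y _.
rewrite /fubini_G.
have [yI|yI] := boolP (y \in `[0%R, (2 * pi)%R]%classic); last first.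
  rewrite -[RHS](integral0 lebesgue_measure setT); apply: eq_integral => x _.
  by rewrite patchE in_setX (negbTE yI) andbF.
rewrite -(h0 y) [RHS]integral_mkcond; apply: eq_integral => x _.
by rewrite !patchE in_setX yI andbT.
Qed.

Lemma angles_integral0_snd h : bmeas h ->
  (forall x : R, (\int[@lebesgue_measure R]_(y in `[0%R, (2 * pi)%R]) (h (x, y))%:E = 0)%E) ->
  \int[mu2]_(p in angles) h p = 0.
Proof.
move=> hb h0; rewrite /Rintegral integral_mkcond/= -integral12_prod_meas1; last first.
  exact: patch_integrable.
rewrite (_ : integral _ _ _ = 0%E)//.
rewrite -[RHS](integral0 lebesgue_measure setT); apply: eq_integral => x _.
rewrite /fubini_F.
have [xI|xI] := boolP (x \in `[0%R, pi%R]%classic); last first.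
  rewrite -[RHS](integral0 lebesgue_measure setT); apply: eq_integral => y _.
  by rewrite patchE in_setX (negbTE xI).
rewrite -(h0 x) [RHS]integral_mkcond; apply: eq_integral => y _.
by rewrite !patchE in_setX xI.
Qed.

Lemma integral_derive_eq0 (F f : R -> R) (a b : R) : a < b -> continuous f ->
  (forall t : R, is_derive t 1 F (f t)) -> F a = F b ->
  (\int[@lebesgue_measure R]_(t in `[a, b]%classic) (f t)%:E = 0)%E.
Proof.
move=> ab cf Fd Fab; rewrite (@continuous_FTC2 _ f F a b ab).
- by rewrite Fab -EFinB subrr.
- exact: continuous_subspaceT.
- split.
  + by move=> t _; have [] := Fd t.
  + by apply: cvg_at_right_filter; exact: is_derive_continuous (Fd a).
  + by apply: cvg_at_left_filter; exact: is_derive_continuous (Fd b).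
- by move=> t _; rewrite derive1E; have [] := Fd t.
Qed.

End bmeas.

Lemma ord3P (P : 'I_3 -> Prop) : P ord0 -> P 1%R -> P 2%R -> forall i, P i.
Proof.
by move=> P0 P1 P2 [[|[|[|//]]] h]; [move: P0|move: P1|move: P2];
  congr P; apply/val_inj.
Qed.

Definition vec3 {R : realType} (a b c : R) : 'rV[R]_3 := \row_(i < 3) nth 0 [:: a; b; c] i.

Lemma vec3E {R : realType} (a b c : R) :
  (vec3 a b c ord0 ord0 = a) * (vec3 a b c ord0 1 = b) * (vec3 a b c ord0 2%R = c).
Proof. by rewrite !mxE. Qed.

(** The difference quotients of e at t are dominated by those of q. Here q is a squared distance to
    the base point, up to a constant factor. *)
Lemma is_derive_squeeze {R : realType} (e q : R -> R) (t : R) :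
  (forall s, `|e s - e t| <= `|q s - q t|) -> is_derive t 1 q 0 -> is_derive t 1 e 0.
Proof.
move=> eq [dq q0].
have hq : h^-1 *: (q (h *: 1 + t) - q t) @[h --> 0^'] --> ('D_1 q t : R) := dq.
rewrite q0 in hq.
have he : h^-1 *: (e (h *: 1 + t) - e t) @[h --> 0^'] --> (0 : R).
  apply/cvgrPdist_le => /= d d0; near=> h.
  have : `|0 - h^-1 *: (q (h *: 1 + t) - q t)| <= d.
    by near: h; exact: ((cvgrPdist_le _ _).1 hq _ d0).
  by rewrite !sub0r !normrN; apply: le_trans; rewrite !normrZ ler_wpM2l//; exact: eq.
apply: DeriveDef; first by apply/cvg_ex; exists 0.
by apply: cvg_lim he.
Unshelve. all: by end_near. Qed.

(** Only points of E enter: f(c(s)) is an affine function of c(s) plus a remainder bounded by C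
    times the squared Euclidean distance of c(s) and c(t), and this remainder has derivative 0 at
    t. *)
Lemma C11_chain {R : realType} (E : set 'rV[R]_3) (f : 'rV[R]_3 -> R) g
    (c : R -> 'rV[R]_3) (t : R) (v : 'rV[R]_3) :
  C11 E f g -> (forall s, E (c s)) ->
  (forall i, is_derive t 1 (fun s => c s ord0 i) (v ord0 i)) ->
  is_derive t 1 (fun s => f (c s)) (dotv (g (c t)) v).
Proof.
move=> [C C1 fg] Ec cd.
have cst i (w : 'rV[R]_3) : is_derive t 1 (fun=> w ord0 i) ((0 : 'rV[R]_3) ord0 i).
  by rewrite mxE; exact: is_derive_cst.
have md : is_derive t 1 (fun s => dotv (g (c t)) (c s)) (dotv (g (c t)) v).
  by have := is_derive_dotv (fun i => cst i (g (c t))) cd; rewrite dotv0l add0r.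
have dd i : is_derive t 1 (fun s => (c s - c t) ord0 i) (v ord0 i).
  have -> : (fun s => (c s - c t) ord0 i) = (fun s => c s ord0 i - c t ord0 i).
    by apply/funext => s; rewrite rV_subE.
  by have := is_derive_subr (cd i) (is_derive_cst (c t ord0 i) t 1); rewrite subr0.
have qd : is_derive t 1 (fun s => C * dotv (c s - c t) (c s - c t)) 0.
  have := is_derive_mulr (is_derive_cst C t 1) (is_derive_dotv dd dd).
  by rewrite mul0r subrr dotvC dotv0l addr0 mulr0 addr0.
have ed : is_derive t 1 (fun s => f (c s) - dotv (g (c t)) (c s)) 0.
  apply: is_derive_squeeze qd => s.
  have [_ _ _ _ h5] := fg (c t) (c s) (Ec t) (Ec s).
  rewrite subrr dotv0l mulr0 subr0.
  rewrite (_ : _ - _ = f (c s) - f (c t) - dotv (g (c t)) (c s - c t)); last first.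
    by rewrite dotvBr; ring.
  apply: (le_trans h5); apply: le_trans (ler_norm _).
  by rewrite ler_wpM2l ?(le_trans _ C1)// sqr_norm_le_dotv.
have -> : (fun s => f (c s)) =
    (fun s => (f (c s) - dotv (g (c t)) (c s)) + dotv (g (c t)) (c s)).
  by apply/funext => s; rewrite subrK.
by have := is_derive_addr ed md; rewrite add0r.
Qed.

Definition sint {R : realType} (r : R) (f : 'rV[R]_3 -> R) : R :=
  \int[(@lebesgue_measure R \x @lebesgue_measure R)%E]_(p in angles)
    (r ^+ 2 * sin p.1 * f (spherical r p)).

Lemma continuous_mulr {R : realType} (f g : R -> R) :
  continuous f -> continuous g -> continuous (fun s => f s * g s).
Proof. by move=> cf cg s; apply: cvgM; [exact: cf|exact: cg]. Qed.

Lemma continuous_addr {R : realType} (f g : R -> R) :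
  continuous f -> continuous g -> continuous (fun s => f s + g s).
Proof. by move=> cf cg s; apply: cvgD; [exact: cf|exact: cg]. Qed.

Section sint.
Context {R : realType} (r : R).
Hypothesis r_ge0 : 0 <= r.
Implicit Types f : 'rV[R]_3 -> R.

Lemma sphere_spherical p : sphere r (spherical r p).
Proof. by rewrite -osphereE//; exact: osphere_spherical. Qed.

Lemma bmeas_sint f : bounded_lipschitz (sphere r) f ->
  bmeas (fun p => r ^+ 2 * sin p.1 * f (spherical r p)).
Proof.
move=> fl; apply: bmeas_mul; last exact: bmeas_spherical.
by apply: bmeas_mul; [exact: bmeas_cst|exact: bmeas_sin_fst].
Qed.

Lemma sint_eq f1 f2 : {in sphere r, f1 =1 f2} -> sint r f1 = sint r f2.
Proof.
move=> f12; apply: eq_Rintegral => p _; rewrite f12// inE; exact: sphere_spherical.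
Qed.

Lemma sint_add f1 f2 : bounded_lipschitz (sphere r) f1 -> bounded_lipschitz (sphere r) f2 ->
  sint r (fun x => f1 x + f2 x) = sint r f1 + sint r f2.
Proof.
move=> h1 h2; rewrite /sint; under eq_Rintegral do rewrite mulrDr.
apply: RintegralD; first exact: measurable_angles.
  exact/bmeas_integrable/bmeas_sint.
exact/bmeas_integrable/bmeas_sint.
Qed.

Lemma sint_scale c f : bounded_lipschitz (sphere r) f ->
  sint r (fun x => c * f x) = c * sint r f.
Proof.
move=> h; rewrite /sint; under eq_Rintegral do rewrite mulrCA.
apply: RintegralZl; first exact: measurable_angles.
exact/bmeas_integrable/bmeas_sint.
Qed.

Lemma sint_cst c : sint r (fun=> c) = c * (4 * pi * r ^+ 2).
Proof.
have l1 : bounded_lipschitz (sphere r) (fun=> 1 : R).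
  by exists 1 => // x y _ _; rewrite normr1 subrr normr0 mul1r.
have -> : (fun=> c) = (fun x : 'rV[R]_3 => c * 1) by apply/funext => x; rewrite mulr1.
rewrite sint_scale//; congr (c * _).
have := sphere_area_total r_ge0; rewrite /sphere_area => h.
rewrite /sint /Rintegral -[RHS]/(fine (4 * pi * r ^+ 2)%:E) -h; congr fine.
apply: eq_integral => p _; rewrite indicE mem_set//.
exact: osphere_spherical.
Qed.

Lemma le_sint f1 f2 : bounded_lipschitz (sphere r) f1 -> bounded_lipschitz (sphere r) f2 ->
  (forall x, sphere r x -> f1 x <= f2 x) -> sint r f1 <= sint r f2.
Proof.
move=> h1 h2 f12; apply: le_Rintegral; first exact: measurable_angles.
- exact/bmeas_integrable/bmeas_sint.
- exact/bmeas_integrable/bmeas_sint.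
- move=> p [/= p1 _]; rewrite ler_wpM2l//; last exact/f12/sphere_spherical.
  by rewrite mulr_ge0 ?sqr_ge0// sin_ge0_pi//; move: p1; rewrite in_itv.
Qed.

Let sph_phi (p : R * R) : 'rV[R]_3 :=
  vec3 (r * (cos p.1 * cos p.2)) (r * (cos p.1 * sin p.2)) (- (r * sin p.1)).

Let sph_theta (p : R * R) : 'rV[R]_3 :=
  vec3 (- (r * (sin p.1 * sin p.2))) (r * (sin p.1 * cos p.2)) 0.

Lemma sphericalE (p : R * R) : spherical r p =
  vec3 (r * (sin p.1 * cos p.2)) (r * (sin p.1 * sin p.2)) (r * cos p.1).
Proof. by []. Qed.

Let is_derive_phi (t y : R) i :
  is_derive t 1 (fun s => spherical r (s, y) ord0 i) (sph_phi (t, y) ord0 i).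
Proof.
have cr : is_derive t 1 (fun=> r) 0 := is_derive_cst r t 1.
have cc (a : R) : is_derive t 1 (fun=> a) 0 := is_derive_cst a t 1.
move: i; apply: ord3P; under eq_fun do rewrite sphericalE vec3E; rewrite vec3E/=.
- have := is_derive_mulr cr (is_derive_mulr (is_derive_sin t) (cc (cos y))).
  by rewrite mul0r mulr0 addr0 add0r.
- have := is_derive_mulr cr (is_derive_mulr (is_derive_sin t) (cc (sin y))).
  by rewrite mul0r mulr0 addr0 add0r.
- have := is_derive_mulr cr (is_derive_cos t).
  by rewrite mul0r add0r mulrN.
Qed.

Let is_derive_theta (x t : R) i :
  is_derive t 1 (fun s => spherical r (x, s) ord0 i) (sph_theta (x, t) ord0 i).
Proof.
have cr : is_derive t 1 (fun=> r) 0 := is_derive_cst r t 1.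
have cc (a : R) : is_derive t 1 (fun=> a) 0 := is_derive_cst a t 1.
move: i; apply: ord3P; under eq_fun do rewrite sphericalE vec3E; rewrite vec3E/=.
- have := is_derive_mulr cr (is_derive_mulr (cc (sin x)) (is_derive_cos t)).
  by rewrite !mul0r !add0r !mulrN.
- have := is_derive_mulr cr (is_derive_mulr (cc (sin x)) (is_derive_sin t)).
  by rewrite !mul0r !add0r.
- exact: cc.
Qed.

Let continuous_sph_fst y i : continuous (fun s => spherical r (s, y) ord0 i).
Proof. by move=> t; exact: is_derive_continuous (is_derive_phi t y i). Qed.

Let continuous_sph_snd x i : continuous (fun s => spherical r (x, s) ord0 i).
Proof. by move=> t; exact: is_derive_continuous (is_derive_theta x t i). Qed.

Let continuous_comp_fst f y : bounded_lipschitz (sphere r) f ->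
  continuous (fun s => f (spherical r (s, y))).
Proof.
move=> [C _ fC]; apply: (@lipschitz_comp_continuous _ (fun s => spherical r (s, y)) _ C).
  by move=> i; exact: continuous_sph_fst.
by move=> s t; have [_] := fC _ _ (sphere_spherical (t, y)) (sphere_spherical (s, y)).
Qed.

Let continuous_comp_snd f x : bounded_lipschitz (sphere r) f ->
  continuous (fun s => f (spherical r (x, s))).
Proof.
move=> [C _ fC]; apply: (@lipschitz_comp_continuous _ (fun s => spherical r (x, s)) _ C).
  by move=> i; exact: continuous_sph_snd.
by move=> s t; have [_] := fC _ _ (sphere_spherical (x, t)) (sphere_spherical (x, s)).
Qed.

Let spherical_periodic x : spherical r (x, 0) = spherical r (x, 2 * pi).
Proof.
by rewrite !sphericalE/= cos0 sin0 mulr_natl cos2pi sin2pi.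
Qed.

Let bmeas_sph_phi i : bmeas (fun p => sph_phi p ord0 i).
Proof.
move: i; apply: ord3P; under eq_fun do rewrite vec3E.
- exact: (bmeas_mul (bmeas_cst r) (bmeas_mul (@bmeas_cos_fst R) (@bmeas_cos_snd R))).
- exact: (bmeas_mul (bmeas_cst r) (bmeas_mul (@bmeas_cos_fst R) (@bmeas_sin_snd R))).
- under eq_fun do rewrite -mulNr.
  exact: (bmeas_mul (bmeas_cst (- r)) (@bmeas_sin_fst R)).
Qed.

Let bmeas_sph_theta i : bmeas (fun p => sph_theta p ord0 i).
Proof.
move: i; apply: ord3P; under eq_fun do rewrite vec3E.
- under eq_fun do rewrite -mulNr.
  exact: (bmeas_mul (bmeas_cst (- r)) (bmeas_mul (@bmeas_sin_fst R) (@bmeas_sin_snd R))).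
- exact: (bmeas_mul (bmeas_cst r) (bmeas_mul (@bmeas_sin_fst R) (@bmeas_cos_snd R))).
- exact: bmeas_cst.
Qed.

Let bmeas_dotv (u v : R * R -> 'rV[R]_3) : (forall i, bmeas (fun p => u p ord0 i)) ->
  (forall i, bmeas (fun p => v p ord0 i)) -> bmeas (fun p => dotv (u p) (v p)).
Proof.
move=> hu hv; under eq_fun do rewrite dotvE.
by do ! apply: bmeas_add; apply: bmeas_mul.
Qed.

Let cst_cont (a : R) : continuous (fun _ : R => a).
Proof. by move=> s; exact: cvg_cst. Qed.

Let continuous_sph_phi y i : continuous (fun s => sph_phi (s, y) ord0 i).
Proof.
move: i; apply: ord3P.
- rewrite [X in continuous X](_ : _ = (fun s : R => r * (cos s * cos y))); last first.
    by apply/funext => s; rewrite vec3E.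
  exact: continuous_mulr (@cst_cont r) (continuous_mulr (@continuous_cos R) (@cst_cont _)).
- rewrite [X in continuous X](_ : _ = (fun s : R => r * (cos s * sin y))); last first.
    by apply/funext => s; rewrite vec3E.
  exact: continuous_mulr (@cst_cont r) (continuous_mulr (@continuous_cos R) (@cst_cont _)).
- rewrite [X in continuous X](_ : _ = (fun s : R => - r * sin s)); last first.
    by apply/funext => s; rewrite vec3E mulNr.
  exact: continuous_mulr (@cst_cont _) (@continuous_sin R).
Qed.

Let continuous_sph_theta x i : continuous (fun s => sph_theta (x, s) ord0 i).
Proof.
move: i; apply: ord3P.
- rewrite [X in continuous X](_ : _ = (fun s : R => - r * (sin x * sin s))); last first.
    by apply/funext => s; rewrite vec3E mulNr.
  exact: continuous_mulr (@cst_cont _) (continuous_mulr (@cst_cont _) (@continuous_sin R)).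
- rewrite [X in continuous X](_ : _ = (fun s : R => r * (sin x * cos s))); last first.
    by apply/funext => s; rewrite vec3E.
  exact: continuous_mulr (@cst_cont r) (continuous_mulr (@cst_cont _) (@continuous_cos R)).
- rewrite [X in continuous X](_ : _ = (fun s : R => 0)); last first.
    by apply/funext => s; rewrite vec3E.
  exact: cst_cont.
Qed.

Section rotations.
Variables (f : 'rV[R]_3 -> R) (g : 'rV[R]_3 -> 'rV[R]_3).
Hypothesis fg : C11 (sphere r) f g.

Let lf : bounded_lipschitz (sphere r) f.
Proof. by have [] := C11_bounded_lipschitz fg. Qed.

Let lg i : bounded_lipschitz (sphere r) (fun x => g x ord0 i).
Proof. by have [_] := C11_bounded_lipschitz fg. Qed.

Let fphi p := dotv (g (spherical r p)) (sph_phi p).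
Let ftheta p := dotv (g (spherical r p)) (sph_theta p).

Let bmeas_fphi : bmeas fphi.
Proof.
by apply: bmeas_dotv => i; [apply: (bmeas_spherical r_ge0 (lg i))|exact: bmeas_sph_phi].
Qed.

Let bmeas_ftheta : bmeas ftheta.
Proof.
by apply: bmeas_dotv => i; [apply: (bmeas_spherical r_ge0 (lg i))|exact: bmeas_sph_theta].
Qed.

Let is_derive_fphi (t y : R) :
  is_derive t 1 (fun s => f (spherical r (s, y))) (fphi (t, y)).
Proof.
apply: (C11_chain fg) => [s|i]; first exact: sphere_spherical.
exact: is_derive_phi.
Qed.

Let is_derive_ftheta (x t : R) :
  is_derive t 1 (fun s => f (spherical r (x, s))) (ftheta (x, t)).
Proof.
apply: (C11_chain fg) => [s|i]; first exact: sphere_spherical.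
exact: is_derive_theta.
Qed.

Let continuous_fphi y : continuous (fun s => fphi (s, y)).
Proof.
apply: continuous_dotv => i; last exact: continuous_sph_phi.
exact: (@continuous_comp_fst _ y (lg i)).
Qed.

Let continuous_ftheta x : continuous (fun s => ftheta (x, s)).
Proof.
apply: continuous_dotv => i; last exact: continuous_sph_theta.
exact: (@continuous_comp_snd _ x (lg i)).
Qed.

Let pi2_gt0 : 0 < 2 * pi :> R. Proof. by rewrite mulr_gt0// pi_gt0. Qed.

(** A rotation field about a horizontal axis is P(theta) d/dphi + cot(phi) P'(theta) d/dtheta with
    P'' = - P. Times sin(phi), its action on f is the sum of d/dphi (sin(phi) P f) and d/dtheta
    (cos(phi) P' f), because the two terms in f itself cancel by P'' = - P. The first integrates to
    0 since sin vanishes at 0 and pi, the second by periodicity. *)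
Let rot_aux (P P' : R -> R) :
  (forall t : R, is_derive t 1 P (P' t)) -> (forall t : R, is_derive t 1 P' (- P t)) ->
  P' 0 = P' (2 * pi) -> (forall t, `|P t| <= 1) -> (forall t, `|P' t| <= 1) ->
  \int[(@lebesgue_measure R \x @lebesgue_measure R)%E]_(p in angles)
    (sin p.1 * P p.2 * fphi p + cos p.1 * P' p.2 * ftheta p) = 0.
Proof.
move=> Pd P'd P'per P1 P'1.
have cP : continuous P by move=> t; exact: is_derive_continuous (Pd t).
have cP' : continuous P' by move=> t; exact: is_derive_continuous (P'd t).
have bP := bmeas_snd cP P1; have bP' := bmeas_snd cP' P'1.
have bs := @bmeas_sin_fst R; have bc := @bmeas_cos_fst R.
have bf := bmeas_spherical r_ge0 lf.
pose H1 p := cos p.1 * P p.2 * f (spherical r p) + sin p.1 * P p.2 * fphi p.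
pose H2 p := cos p.1 * - P p.2 * f (spherical r p) + cos p.1 * P' p.2 * ftheta p.
have b1 : bmeas H1.
  by apply: bmeas_add; apply: bmeas_mul => //; exact: bmeas_mul.
have b2 : bmeas H2.
  apply: bmeas_add; apply: bmeas_mul => //; apply: bmeas_mul => //.
  by under eq_fun do rewrite -mulN1r; exact: bmeas_mul (bmeas_cst _) bP.
have -> : (fun p => sin p.1 * P p.2 * fphi p + cos p.1 * P' p.2 * ftheta p) =
    (fun p => H1 p + H2 p) by apply/funext => p; rewrite /H1 /H2; ring.
rewrite RintegralD; [|exact: measurable_angles|exact: bmeas_integrable|exact: bmeas_integrable].
rewrite angles_integral0_fst//; last first.
  move=> y; apply: (@integral_derive_eq0 _ (fun s => sin s * P y * f (spherical r (s, y)))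
    (fun s => H1 (s, y))); first exact: pi_gt0.
  - apply: continuous_addr; apply: continuous_mulr.
    + exact: continuous_mulr (@continuous_cos R) (@cst_cont (P y)).
    + exact: continuous_comp_fst.
    + exact: continuous_mulr (@continuous_sin R) (@cst_cont (P y)).
    + exact: continuous_fphi.
  - move=> t; have := is_derive_mulr (is_derive_mulr (is_derive_sin t)
      (is_derive_cst (P y) t 1)) (is_derive_fphi t y).
    by rewrite mulr0 addr0.
  - by rewrite sinpi sin0 !mul0r.
rewrite angles_integral0_snd ?addr0//.
move=> x; apply: (@integral_derive_eq0 _ (fun s => cos x * P' s * f (spherical r (x, s)))
  (fun s => H2 (x, s))); first exact: pi2_gt0.
- apply: continuous_addr; apply: continuous_mulr.
  + apply: continuous_mulr (@cst_cont (cos x)) _.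
    by move=> t; apply: cvgN; exact: cP.
  + exact: continuous_comp_snd.
  + exact: continuous_mulr (@cst_cont (cos x)) cP'.
  + exact: continuous_ftheta.
- move=> t; have := is_derive_mulr (is_derive_mulr (is_derive_cst (cos x) t 1)
    (P'd t)) (is_derive_ftheta x t).
  by rewrite mul0r add0r.
- by rewrite P'per spherical_periodic.
Qed.

Let sint_rot_aux (P P' : R -> R) (h : 'rV[R]_3 -> R) :
  (forall t : R, is_derive t 1 P (P' t)) -> (forall t : R, is_derive t 1 P' (- P t)) ->
  P' 0 = P' (2 * pi) -> (forall t, `|P t| <= 1) -> (forall t, `|P' t| <= 1) ->
  (forall p, sin p.1 * h (spherical r p) =
    sin p.1 * P p.2 * fphi p + cos p.1 * P' p.2 * ftheta p) ->
  sint r h = 0.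
Proof.
move=> Pd P'd P'per P1 P'1 hE; rewrite /sint.
under eq_Rintegral do rewrite -mulrA hE.
have cP : continuous P by move=> t; exact: is_derive_continuous (Pd t).
have cP' : continuous P' by move=> t; exact: is_derive_continuous (P'd t).
have bP := bmeas_snd cP P1; have bP' := bmeas_snd cP' P'1.
have bs := @bmeas_sin_fst R; have bc := @bmeas_cos_fst R.
rewrite RintegralZl; [|exact: measurable_angles|].
  by rewrite rot_aux// mulr0.
apply: bmeas_integrable; apply: bmeas_add; apply: bmeas_mul => //; exact: bmeas_mul.
Qed.

(** The field (0, - x_2, x_1) of rotations about the first axis, with P = - sin. The next lemma
    treats the second axis, with P = cos. *)
Lemma sint_rot1 :
  sint r (fun x => - x ord0 2%R * g x ord0 1 + x ord0 1 * g x ord0 2%R) = 0.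
Proof.
have d1 (t : R) : is_derive t 1 (fun s => - sin s) (- cos t).
  exact: is_deriveN (is_derive_sin t).
have d2 (t : R) : is_derive t 1 (fun s => - cos s) (- - sin t).
  exact: is_deriveN (is_derive_cos t).
apply: (sint_rot_aux d1 d2).
- by rewrite cos0 mulr_natl cos2pi.
- by move=> t; rewrite normrN normr_sin_le1.
- by move=> t; rewrite normrN normr_cos_le1.
- move=> p; rewrite /fphi /ftheta /sph_phi /sph_theta !dotvE !vec3E/=.
  have := cos2Dsin2 p.2; set g0 := g _ _ _; set g1 := g _ _ _; set g2 := g _ _ _.
  move: (cos p.2) (sin p.2) (cos p.1) (sin p.1) => c2 s2 c1 s1 cs.
  have -> : s1 * (- (r * c1) * g0 + r * (s1 * s2) * g1) =
    (c2 ^+ 2 + s2 ^+ 2) * (s1 * - (r * c1) * g0) + s1 * (r * (s1 * s2) * g1).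
    by rewrite cs; ring.
  by ring.
Qed.

Lemma sint_rot2 :
  sint r (fun x => x ord0 2%R * g x ord0 ord0 - x ord0 ord0 * g x ord0 2%R) = 0.
Proof.
have d2 (t : R) : is_derive t 1 (fun s => - sin s) (- cos t).
  exact: is_deriveN (is_derive_sin t).
apply: (sint_rot_aux (@is_derive_cos R) d2).
- by rewrite sin0 mulr_natl sin2pi.
- exact: normr_cos_le1.
- by move=> t; rewrite normrN normr_sin_le1.
- move=> p; rewrite /fphi /ftheta /sph_phi /sph_theta !dotvE !vec3E/=.
  have := cos2Dsin2 p.2; set g0 := g _ _ _; set g1 := g _ _ _; set g2 := g _ _ _.
  move: (cos p.2) (sin p.2) (cos p.1) (sin p.1) => c2 s2 c1 s1 cs.
  have -> : s1 * (r * c1 * g0 - r * (s1 * c2) * g1) =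
    (c2 ^+ 2 + s2 ^+ 2) * (s1 * (r * c1) * g0) - s1 * (r * (s1 * c2) * g1).
    by rewrite cs; ring.
  by ring.
Qed.

(** Rotation about the polar axis is d/dtheta itself, so periodicity in theta gives the result. *)
Lemma sint_rot3 :
  sint r (fun x => - x ord0 1 * g x ord0 ord0 + x ord0 ord0 * g x ord0 1) = 0.
Proof.
rewrite /sint.
have -> : (fun p => r ^+ 2 * sin p.1 * (- spherical r p ord0 1 * g (spherical r p) ord0 ord0
    + spherical r p ord0 ord0 * g (spherical r p) ord0 1)) =
    (fun p => r ^+ 2 * sin p.1 * ftheta p).
  apply/funext => p; rewrite /ftheta /sph_theta dotvE !vec3E/=; ring.
rewrite angles_integral0_snd//.
  apply: bmeas_mul bmeas_ftheta.
  exact: bmeas_mul (bmeas_cst _) (@bmeas_sin_fst R).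
move=> x; apply: (@integral_derive_eq0 _ (fun s => r ^+ 2 * sin x * f (spherical r (x, s)))
  (fun s => r ^+ 2 * sin x * ftheta (x, s))); first exact: pi2_gt0.
- exact: continuous_mulr (@cst_cont (r ^+ 2 * sin x)) (@continuous_ftheta x).
- move=> t; have := is_derive_mulr (is_derive_cst (r ^+ 2 * sin x) t 1) (is_derive_ftheta x t).
  by rewrite mul0r add0r.
- by rewrite spherical_periodic.
Qed.

End rotations.

End sint.

(** * Truncated inverses and integration by parts *)

Definition sqrpos {R : realType} (s : R) : R := Num.max 0 s ^+ 2.

Lemma max0_lip {R : realType} (a b : R) : `|Num.max 0 b - Num.max 0 a| <= `|b - a|.
Proof.
wlog ab : a b / a <= b.
  by move=> H; have [/H//|/ltW/H] := leP a b; rewrite distrC (distrC a).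
rewrite !ger0_norm ?subr_ge0//; rewrite /Num.max; do ! case: ifPn; rewrite -?leNgt; lra.
Qed.

Lemma sqrpos_rem {R : realType} (a b : R) :
  `|sqrpos b - sqrpos a - 2 * Num.max 0 a * (b - a)| <= (b - a) ^+ 2.
Proof.
rewrite /sqrpos ler_norml; have [a0|a0] := leP 0 a; have [b0|b0] := leP 0 b;
  rewrite ?expr0n/= ?mulr0 ?mul0r ?subr0 ?sub0r; have := sqr_ge0 a; have := sqr_ge0 b; have := sqr_ge0 (b - a) => sba sb sa.
- by apply/andP; split; lra.
- have ab : a * b <= 0 by rewrite mulr_ge0_le0// ltW.
  by apply/andP; split; lra.
- have ab : a * b <= 0 by rewrite mulr_le0_ge0// ltW.
  by apply/andP; split; lra.
- by apply/andP; split; lra.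
Qed.

(* A C^{1,1} function bounded below by eps / 2 and equal to s for s >= eps. *)
Definition trunc {R : realType} (eps s : R) : R := s + (2 * eps)^-1 * sqrpos (eps - s).

Lemma trunc_id {R : realType} (eps s : R) : eps <= s -> trunc eps s = s.
Proof. by move=> h; rewrite /trunc /sqrpos max_l ?subr_le0// expr0n/= mulr0 addr0. Qed.

Lemma trunc_ge {R : realType} (eps s : R) : 0 < eps -> eps / 2 <= trunc eps s.
Proof.
move=> e0; have [h|h] := leP eps s; first by rewrite trunc_id//; lra.
have h0 : 0 <= eps - s by rewrite subr_ge0 ltW.
rewrite /trunc /sqrpos (max_r h0).
have -> : s + (2 * eps)^-1 * (eps - s) ^+ 2 = eps / 2 + (2 * eps)^-1 * s ^+ 2.
  by field; rewrite gt_eqF.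
by rewrite lerDl mulr_ge0 ?sqr_ge0// invr_ge0 mulr_ge0// ltW.
Qed.

Lemma C11_real_trunc {R : realType} (eps : R) : 0 < eps ->
  C11_real (trunc eps) (fun s => 1 - Num.max 0 (eps - s) / eps) eps^-1.
Proof.
move=> e0 a b; split.
  rewrite (_ : _ - _ = (Num.max 0 (eps - a) - Num.max 0 (eps - b)) / eps); last by ring.
  rewrite normrM (mulrC eps^-1) [`|eps^-1|]ger0_norm ?invr_ge0 ?(ltW e0)//.
  rewrite ler_wpM2r ?invr_ge0 ?(ltW e0)//; apply: (le_trans (max0_lip _ _)).
  by rewrite opprB addrC subrKA.
rewrite /trunc (_ : _ - _ = (2 * eps)^-1 * (sqrpos (eps - b) - sqrpos (eps - a)
   - 2 * Num.max 0 (eps - a) * ((eps - b) - (eps - a)))); last first.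
  by field; rewrite gt_eqF.
rewrite normrM ger0_norm ?invr_ge0 ?mulr_ge0// ?(ltW e0)//.
have := sqrpos_rem (eps - a) (eps - b); set X := `|_|.
rewrite (_ : (_ - _ - _) ^+ 2 = (b - a) ^+ 2); last by ring.
move=> h; apply: (@le_trans _ _ ((2 * eps)^-1 * (b - a) ^+ 2)).
  by rewrite ler_wpM2l// invr_ge0 mulr_ge0// ltW.
by rewrite ler_wpM2r ?sqr_ge0// lef_pV2 ?posrE ?mulr_gt0//; lra.
Qed.

Lemma C11_inv {R : realType} (E : set 'rV[R]_3) (f : 'rV[R]_3 -> R) g (c : R) :
  0 < c -> (forall x, E x -> c <= f x) -> C11 E f g ->
  C11 E (fun x => (f x)^-1) (fun x => - (f x) ^- 2 *: g x).
Proof.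
move=> c0 fc [C C1 fg]; pose I := c^-1; have I0 : 0 <= I by rewrite invr_ge0 ltW.
have C0 : 0 <= C by exact: le_trans C1.
have fI x : E x -> `|(f x)^-1| <= I.
  move=> Ex; have fx := lt_le_trans c0 (fc _ Ex).
  by rewrite ger0_norm ?invr_ge0 ?(ltW fx)// lef_pV2 ?posrE// fc.
pose Q := 1 + I + I ^+ 2 * C + 2 * I ^+ 3 * C ^+ 2.
have IC : 0 <= I ^+ 2 * C by rewrite mulr_ge0 ?exprn_ge0.
have ICC : 0 <= I ^+ 3 * C ^+ 2 by rewrite mulr_ge0 ?exprn_ge0.
exists Q => [|x y Ex Ey]; first by rewrite /Q; lra.
have [h1 h2 h3 h4 h5] := fg x y Ex Ey.
have fx := gt_eqF (lt_le_trans c0 (fc _ Ex)); have fy := gt_eqF (lt_le_trans c0 (fc _ Ey)).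
set d := `|y - x| in h3 h4 h5 *; have d0 : 0 <= d by exact: normr_ge0.
have dI : 0 <= I * d by rewrite mulr_ge0.
have dIC : 0 <= I ^+ 2 * C * d by rewrite mulr_ge0.
have dICC : 0 <= I ^+ 3 * C ^+ 2 * d by rewrite mulr_ge0.
have iB : `|(f y)^-1 - (f x)^-1| <= I * (I * (C * d)).
  rewrite (_ : _ - _ = - ((f y)^-1 * ((f x)^-1 * (f y - f x)))); last first.
    by field; rewrite fx fy.
  by rewrite normrN normrM ler_pM// ?fI// normrM ler_pM// fI.
split.
- by apply: (le_trans (fI _ Ex)); rewrite /Q; lra.
- rewrite normrZ normrN -exprVn normrX.
  apply: (@le_trans _ _ (I ^+ 2 * C)); last by rewrite /Q; lra.
  by rewrite ler_pM ?exprn_ge0// ler_sqr ?nnegrE// fI.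
- rewrite (_ : _ - _ = - (f y) ^- 2 *: (g y - g x) -
      (((f y)^-1 - (f x)^-1) * ((f y)^-1 + (f x)^-1)) *: g x); last first.
    by apply/rowP => i; rewrite !mxE -!exprVn; ring.
  rewrite (le_trans (ler_normB _ _))// !normrZ normrN -exprVn normrX.
  apply: (@le_trans _ _ (I ^+ 2 * (C * d) + I * (I * (C * d)) * (I + I) * C)).
    rewrite lerD// ler_pM ?exprn_ge0 ?mulr_ge0 ?normr_ge0//.
      by rewrite ler_sqr ?nnegrE// fI.
    by rewrite ler_pM// (le_trans (ler_normD _ _))// lerD// fI.
  rewrite /Q (_ : _ + _ = I ^+ 2 * C * d + 2 * (I ^+ 3 * C ^+ 2 * d)); last by ring.
  lra.
- apply: (le_trans iB); rewrite (_ : _ * _ = I ^+ 2 * C * d); last by ring.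
  rewrite /Q; lra.
(* With a = f x and b = f y: 1/b - 1/a + (b - a)/a^2 = (b - a)^2 / (a^2 b). *)
- rewrite dotvZl (_ : _ - _ - _ = (f y)^-1 * (f x) ^- 2 * (f y - f x) ^+ 2
     - (f x) ^- 2 * (f y - f x - dotv (g x) (y - x))); last first.
    by field; rewrite fx fy.
  rewrite (le_trans (ler_normB _ _))// !normrM -!exprVn !normrX.
  have fx2 : `|(f x)^-1| ^+ 2 <= I ^+ 2 by rewrite ler_sqr ?nnegrE// fI.
  apply: (@le_trans _ _ (I * I ^+ 2 * (C * d) ^+ 2 + I ^+ 2 * (C * d ^+ 2))).
    rewrite lerD// ler_pM ?exprn_ge0 ?mulr_ge0 ?exprn_ge0 ?normr_ge0//.
      by rewrite ler_pM ?exprn_ge0// fI.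
    by rewrite ler_sqr ?nnegrE ?mulr_ge0.
  rewrite (_ : _ + _ = (I ^+ 2 * C + I ^+ 3 * C ^+ 2) * d ^+ 2); last by ring.
  by rewrite ler_wpM2r ?exprn_ge0// /Q; lra.
Qed.

Lemma bounded_lipschitz_of_smooth {R : realType} (E : set 'rV[R]_3) (f : 'rV[R]_3 -> R) :
  smooth E f -> bounded_lipschitz E f.
Proof. by move=> [g /C11_bounded_lipschitz[]]. Qed.

Lemma bounded_lipschitz_add {R : realType} (E : set 'rV[R]_3) (f1 f2 : 'rV[R]_3 -> R) :
  bounded_lipschitz E f1 -> bounded_lipschitz E f2 ->
  bounded_lipschitz E (fun x => f1 x + f2 x).
Proof.
move=> [C1 C10 h1] [C2 C20 h2]; exists (C1 + C2) => [|x y Ex Ey]; first by rewrite addr_ge0.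
have [a1 a2] := h1 x y Ex Ey; have [b1 b2] := h2 x y Ex Ey.
split; first by rewrite (le_trans (ler_normD _ _))// lerD.
by rewrite opprD addrACA (le_trans (ler_normD _ _))// mulrDl lerD.
Qed.

Lemma bounded_lipschitz_mul {R : realType} (E : set 'rV[R]_3) (f1 f2 : 'rV[R]_3 -> R) :
  bounded_lipschitz E f1 -> bounded_lipschitz E f2 ->
  bounded_lipschitz E (fun x => f1 x * f2 x).
Proof.
move=> [C1 C10 h1] [C2 C20 h2]; exists (2 * (C1 * C2)) => [|x y Ex Ey].
  by rewrite !mulr_ge0.
have [a1 a2] := h1 x y Ex Ey; have [b1 b2] := h2 x y Ex Ey; have [a1' _] := h1 y x Ey Ex.
have C12 : 0 <= C1 * C2 by rewrite mulr_ge0.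
split; first by apply: (@le_trans _ _ (C1 * C2)); [rewrite normrM ler_pM|lra].
rewrite (_ : _ - _ = f1 y * (f2 y - f2 x) + (f1 y - f1 x) * f2 x); last by ring.
rewrite (le_trans (ler_normD _ _))// !normrM.
rewrite (_ : _ * `|y - x| = C1 * (C2 * `|y - x|) + C1 * `|y - x| * C2); last by ring.
by rewrite lerD// ler_pM.
Qed.

Lemma bounded_lipschitz_dotv {R : realType} (E : set 'rV[R]_3) (F1 F2 : 'rV[R]_3 -> 'rV[R]_3) :
  (forall i, bounded_lipschitz E (fun x => F1 x ord0 i)) ->
  (forall i, bounded_lipschitz E (fun x => F2 x ord0 i)) ->
  bounded_lipschitz E (fun x => dotv (F1 x) (F2 x)).
Proof.
move=> h1 h2; have -> : (fun x => dotv (F1 x) (F2 x)) =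
    (fun x => F1 x ord0 ord0 * F2 x ord0 ord0 + F1 x ord0 1 * F2 x ord0 1
             + F1 x ord0 2%R * F2 x ord0 2%R) by apply/funext => x; rewrite dotvE.
by do ! apply: bounded_lipschitz_add; exact: bounded_lipschitz_mul.
Qed.

(* For f = k(r^2 - x.w) with k(s) = 1/s, the field f (r^2 w - (x.w) x) has
   constant divergence 1 on the sphere; it is the sum over i of
   f (x * w)_i times the i-th rotation field e_i * x (cross products). *)
Lemma sint_ibp {R : realType} (r : R) (w : 'rV[R]_3) (eps : R) (m : 'rV[R]_3 -> R) g :
  0 < r -> sphere r w -> 0 < eps -> C11 (sphere r) m g ->
  (forall x, sphere r x -> halfdist2 r w x < eps -> m x = 0) ->
  sint r (fun x => (trunc eps (halfdist2 r w x))^-1 *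
    dotv (r ^+ 2 *: w - dotv x w *: x) (g x)) = - sint r m.
Proof.
move=> r0 wr e0 mg m0; have r_ge0 := ltW r0.
have SM x : sphere r x -> `|x| <= r by exact: sphere_norm.
pose V := halfdist2 r w; pose k x := (trunc eps (V x))^-1.
pose kappa x := - (trunc eps (V x)) ^- 2 * (1 - Num.max 0 (eps - V x) / eps).
have kC : C11 (sphere r) k (fun x => kappa x *: - w).
  have := C11_comp (C11_real_trunc e0) (C11_halfdist2 r SM w).
  have e20 : 0 < eps / 2 by rewrite divr_gt0.
  move=> /(C11_inv e20 (fun x _ => trunc_ge (V x) e0)).
  by apply: C11_eq => // x _; rewrite scalerA.
have fC v : C11 (sphere r) (fun x => m x * (k x * dotv x v)) (fun x =>
    m x *: (k x *: v + dotv x v *: (kappa x *: - w)) + (k x * dotv x v) *: g x).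
  exact: C11_mul mg (C11_mul kC (C11_dotv v SM)).
set w0 := w ord0 ord0; set w1 := w ord0 1; set w2 := w ord0 2%R.
(* For these three vectors v, [dotv x v] runs over the coordinates of the cross product of x and
   w. *)
have R1 := sint_rot1 r_ge0 (fC (vec3 0 w2 (- w1))).
have R2 := sint_rot2 r_ge0 (fC (vec3 (- w2) 0 w0)).
have R3 := sint_rot3 r_ge0 (fC (vec3 w1 (- w0) 0)).
have lx i : bounded_lipschitz (sphere r) (fun x : 'rV[R]_3 => x ord0 i).
  by apply: bounded_lipschitz_of_smooth; exact: smooth_coord SM.
have lxN i : bounded_lipschitz (sphere r) (fun x : 'rV[R]_3 => - x ord0 i).
  apply: bounded_lipschitz_of_smooth; have [h hC] := smooth_coord i SM.
  by exists (fun x => - h x); exact: C11_opp.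
have lfg v i : bounded_lipschitz (sphere r) (fun x =>
    (m x *: (k x *: v + dotv x v *: (kappa x *: - w)) + (k x * dotv x v) *: g x) ord0 i).
  by have [_] := C11_bounded_lipschitz (fC v).
have lm : bounded_lipschitz (sphere r) m by have [] := C11_bounded_lipschitz mg.
have lg i : bounded_lipschitz (sphere r) (fun x => g x ord0 i).
  by have [_] := C11_bounded_lipschitz mg.
have lc (c : R) : bounded_lipschitz (sphere r) (fun=> c).
  by apply: bounded_lipschitz_of_smooth; exact: smooth_cst.
have lk : bounded_lipschitz (sphere r) k by have [] := C11_bounded_lipschitz kC.
have ladd := @bounded_lipschitz_add R (sphere r).
have lmul := @bounded_lipschitz_mul R (sphere r).
have lT : bounded_lipschitz (sphere r) (fun x => k x * dotv (r ^+ 2 *: w - dotv x w *: x) (g x)).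
  apply: (@lmul) => //; apply: bounded_lipschitz_dotv => // i.
  have -> : (fun x => (r ^+ 2 *: w - dotv x w *: x) ord0 i) =
    (fun x => r ^+ 2 * w ord0 i + dotv x w * - x ord0 i).
    by apply/funext => x; rewrite !mxE mulrN.
  apply: (@ladd) => //; apply: (@lmul) => //.
  by apply: bounded_lipschitz_dotv => // j; exact: lc.
apply/eqP; rewrite -subr_eq0 opprK -sint_add//; apply/eqP.
move: R1 R2 R3.
set h1 := (X in sint r X = 0); move=> R1.
set h2 := (X in sint r X = 0); move=> R2.
set h3 := (X in sint r X = 0); move=> R3.
have l1 : bounded_lipschitz (sphere r) h1 by apply: (@ladd); apply: (@lmul).
have l2 : bounded_lipschitz (sphere r) h2.
  rewrite /h2; under eq_fun do rewrite -mulNr.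
  by apply: (@ladd); apply: (@lmul).
have l3 : bounded_lipschitz (sphere r) h3 by apply: (@ladd); apply: (@lmul).
have := sint_add r_ge0 (ladd _ _ l1 l2) l3.
rewrite (sint_add r_ge0 l1 l2) R1 R2 R3 !addr0 => <-.
apply: (sint_eq r_ge0) => x /set_mem xr.
(* The gradient of k is - kappa w. The sum splits into the field acting on m and m times the
   divergence of the field. *)
have -> : h1 x + h2 x + h3 x = k x * (dotv x x * dotv w (g x) - dotv x w * dotv x (g x))
    + m x * (- 2 * k x * dotv x w - kappa x * (dotv x x * dotv w w - dotv x w ^+ 2)).
  rewrite /h1 /h2 /h3 !mxE -/w0 -/w1 -/w2 !dotvE !vec3E -/w0 -/w1 -/w2/=.
  ring.
rewrite dotvBl !dotvZl xr -/(k x); congr (_ + _).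
(* Where V < eps, m vanishes. Elsewhere k = 1/V and kappa = -1/V^2, and with x.w = r^2 - V the
   divergence is - 2 (r^2 - V)/V + (r^4 - (r^2 - V)^2)/V^2 = 1. *)
have [Ve|Ve] := leP eps (V x); last by rewrite m0// mul0r.
rewrite -[LHS]mulr1; congr (m x * _); symmetry.
rewrite wr /kappa /k trunc_id// max_l ?subr_le0// mul0r subr0 mulr1.
have -> : dotv x w = r ^+ 2 - V x by rewrite /V /halfdist2; ring.
by field; rewrite gt_eqF// (lt_le_trans e0).
Qed.

(** * Basins of attraction *)

Lemma wells_rem {R : realType} (r : R) l z x : z \in l ->
  wells r l x = halfdist2 r z x * wells r (rem z l) x /\
  attraction r l x = wells r (rem z l) x *: z + halfdist2 r z x *: attraction r (rem z l) x.
Proof.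
elim: l => [//|w l IH]; rewrite in_cons /=.
have [->|zw] := eqVneq z w; first by [].
rewrite /= => zl; have [E1 E2] := IH zl; split.
  by rewrite E1 mulrCA.
by rewrite /= E1 E2; apply/rowP => i; rewrite !mxE; ring.
Qed.

Section trapping.
Context {R : realType} (r : R).
Hypothesis r_gt0 : 0 < r.

Let r_ge0 : 0 <= r. Proof. exact: ltW. Qed.
Let SM (x : 'rV[R]_3) : sphere r x -> `|x| <= r. Proof. exact: sphere_norm. Qed.

Lemma halfdist2E z x : sphere r z -> sphere r x ->
  2 * halfdist2 r z x = dotv (x - z) (x - z).
Proof.
move=> zr xr; rewrite dotvBl !dotvBr zr xr (dotvC z x) /halfdist2; ring.
Qed.

Lemma halfdist2_ge0 z x : sphere r z -> sphere r x -> 0 <= halfdist2 r z x.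
Proof.
by move=> zr xr; have := dotv_ge0 (x - z); rewrite -halfdist2E// pmulr_rge0.
Qed.

Lemma halfdist2_eq0 z x : sphere r z -> sphere r x -> halfdist2 r z x = 0 -> x = z.
Proof.
move=> zr xr h; apply/eqP; rewrite -subr_eq0; apply/eqP/dotv_eq0.
by rewrite -halfdist2E// h mulr0.
Qed.

Lemma halfdist2_self z : sphere r z -> halfdist2 r z z = 0.
Proof. by rewrite /halfdist2 => ->; rewrite subrr. Qed.

Lemma halfdist2_norm z x : sphere r z -> sphere r x ->
  `|x - z| ^+ 2 <= 2 * halfdist2 r z x.
Proof. by move=> zr xr; rewrite halfdist2E//; exact: sqr_norm_le_dotv. Qed.

Lemma wells_ge0 l x : {in l, forall w, sphere r w} -> sphere r x -> 0 <= wells r l x.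
Proof.
move=> lr xr; elim: l lr => [//|w l IH] lr /=; rewrite mulr_ge0//.
  by apply: halfdist2_ge0 => //; apply: lr; exact: mem_head.
by apply: IH => v vl; apply: lr; rewrite in_cons vl orbT.
Qed.

Lemma wells_gt0 l x : {in l, forall w, sphere r w} -> sphere r x -> x \notin l ->
  0 < wells r l x.
Proof.
move=> lr xr xl; rewrite lt_neqAle wells_ge0// andbT eq_sym.
elim: l lr xl => [|w l IH] lr /=; first by rewrite oner_eq0.
rewrite in_cons negb_or => /andP[xw xl]; rewrite mulf_neq0//.
  apply: contra xw => /eqP/halfdist2_eq0 -> //; apply: lr; exact: mem_head.
by apply: IH => // v vl; apply: lr; rewrite in_cons vl orbT.
Qed.

Lemma flow_field_mem l z : {in l, forall w, sphere r w} -> z \in l -> flow_field r l z = 0.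
Proof.
move=> lr zl; have zr := lr z zl; have [_ E] := wells_rem r z zl.
rewrite /flow_field E halfdist2_self// scale0r addr0 dotvZr !zr.
by rewrite scalerA mulrC subrr.
Qed.

Lemma is_derive_halfdist2_flow l z x (t : R) : sphere r x ->
  is_derive t 1 (fun s => halfdist2 r z (flow r l x s))
    (- dotv z (flow_field r l (flow r l x t))).
Proof.
move=> xr; have := C11_chain (C11_halfdist2 r SM z) (fun s => flow_sphere l r_gt0 s xr)
  (fun i => flow_derive l r_gt0 t i xr).
by rewrite dotvNl.
Qed.

(** The relative rate of decrease of V_z along the flow. At z the attraction terms cancel and 2 r^2
    times the product of the other factors remains, which is positive when the points of l are
    distinct. *)
Let decay_rate l z x : R :=
  wells r (rem z l) x * (r ^+ 2 + dotv x z) + r ^+ 2 * dotv z (attraction r (rem z l) x)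
  - dotv x (attraction r (rem z l) x) * dotv x z.

Let dotv_flow_field_well l z x : sphere r z -> sphere r x -> z \in l ->
  dotv z (flow_field r l x) = halfdist2 r z x * decay_rate l z x.
Proof.
move=> zr xr zl; have [_ E] := wells_rem r x zl.
rewrite /flow_field E dotvBr !dotvZr !dotvDr !dotvZr zr xr (dotvC z x).
by rewrite /decay_rate /halfdist2; ring.
Qed.

(** By continuity [decay_rate] exceeds half its value at z in a neighbourhood of z. The constant c
    depends on z, while d is made common to the list by taking minima. *)
Lemma trapping_radius l : uniq l -> {in l, forall w, sphere r w} ->
  exists2 d, 0 < d & {in l, forall z, exists2 c, 0 < c & forall x, sphere r x ->
    halfdist2 r z x < d -> c * halfdist2 r z x <= dotv z (flow_field r l x)}.
Proof.
move=> ul lr.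
have one z : z \in l -> exists2 d, 0 < d & exists2 c, 0 < c & forall x, sphere r x ->
    halfdist2 r z x < d -> c * halfdist2 r z x <= dotv z (flow_field r l x).
  move=> zl; have zr := lr z zl.
  have lr' : {in rem z l, forall w, sphere r w} by move=> w /mem_rem; exact: lr.
  have b0 : 0 < decay_rate l z z.
    rewrite /decay_rate zr (_ : _ - _ = 2 * r ^+ 2 * wells r (rem z l) z); last by ring.
    rewrite !mulr_gt0 ?exprn_gt0// wells_gt0//.
    by rewrite mem_rem_uniq// inE eqxx.
  have bs : smooth (sphere r) (decay_rate l z).
    have sx j := smooth_coord j SM.
    have sz : smooth (sphere r) (fun x => dotv x z) by eexists; exact: C11_dotv SM.
    apply: smooth_sub; last apply: smooth_mul => //; last first.
      by apply: smooth_dotv => // j; exact: smooth_attraction SM _ _.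
    apply: smooth_add; apply: smooth_mul.
    - by eexists; exact: (C11_wells r SM).
    - by apply: smooth_add => //; exact: smooth_cst.
    - exact: smooth_cst.
    - apply: smooth_dotv => j; first exact: smooth_cst.
      exact: smooth_attraction SM _ _.
  have [C C0 bC] := bounded_lipschitz_of_smooth bs.
  (* If V_z < e^2 / 2 then |x - z| <= e, and the Lipschitz bound C e <= b / 2 leaves at least b / 2
     of the rate. *)
  pose b := decay_rate l z z; pose e := b / (2 * (C + 1)).
  have C10 : 0 < C + 1 by rewrite ltr_wpDl.
  have e0 : 0 < e by rewrite divr_gt0// mulr_gt0.
  exists (e ^+ 2 / 2); first by rewrite divr_gt0// exprn_gt0.
  exists (b / 2) => [|x xr xd]; first by rewrite divr_gt0.
  rewrite dotv_flow_field_well// mulrC ler_wpM2l ?halfdist2_ge0//.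
  have [_ h] := bC z x zr xr.
  have xe : `|x - z| <= e.
    rewrite -ler_sqr ?nnegrE ?(ltW e0)//; apply: (le_trans (halfdist2_norm zr xr)).
    by move: xd; rewrite ltr_pdivlMr// mulrC => /ltW.
  have Ce : C * e <= b / 2.
    have -> : b / 2 = (C + 1) * e by rewrite /e; field; rewrite gt_eqF.
    by rewrite ler_wpM2r ?(ltW e0)// lerDl.
  have h2 : C * `|x - z| <= C * e by rewrite ler_wpM2l.
  have := ler_norm (- (decay_rate l z x - b)); rewrite normrN -/b in h * => h3.
  lra.
have gen (s : seq 'rV[R]_3) : {subset s <= l} -> exists2 d, 0 < d &
    {in s, forall z, exists2 c, 0 < c & forall x, sphere r x ->
    halfdist2 r z x < d -> c * halfdist2 r z x <= dotv z (flow_field r l x)}.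
  elim: s => [|z s IH] sl; first by exists 1.
  have [d1 d10 [c1 c10 h1]] := one z (sl _ (mem_head _ _)).
  have [|d2 d20 h2] := IH; first by move=> w ws; apply: sl; rewrite in_cons ws orbT.
  exists (Num.min d1 d2); first by rewrite lt_min d10 d20.
  move=> w; rewrite in_cons => /predU1P[->|ws].
    by exists c1 => // x xr; rewrite lt_min => /andP[xd _]; exact: h1.
  have [c c0 hc] := h2 w ws; exists c => // x xr.
  by rewrite lt_min => /andP[_ xd]; exact: hc.
exact: gen.
Qed.

Lemma C11_real_is_derive (k dk : R -> R) D (a : R) : C11_real k dk D ->
  is_derive a 1 k (dk a).
Proof.
move=> kD.
have ed : is_derive a 1 (fun s => k s - dk a * s) 0.
  apply: (@is_derive_squeeze _ _ (fun s => D * ((s - a) * (s - a)))) => [s|].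
    have [_ h] := kD a s; rewrite subrr !mulr0 subr0 -expr2.
    by rewrite (_ : _ - _ = k s - k a - dk a * (s - a)) ?(le_trans h) ?ler_norm//; ring.
  have d1 : is_derive a 1 (fun s => s - a) 1.
    by have := is_derive_subr (is_derive_id a 1) (is_derive_cst a a 1); rewrite subr0.
  have := is_derive_mulr (is_derive_cst D a 1) (is_derive_mulr d1 d1).
  by rewrite mul0r subrr mul1r mulr1 addr0 mulr0 addr0.
have -> : k = (fun s => (k s - dk a * s) + dk a * s) by apply/funext => s; rewrite subrK.
by have := is_derive_addr ed (is_derive_mulr_cst (dk a) a); rewrite add0r.
Qed.

Lemma C11_real_sqrpos : C11_real (@sqrpos R) (fun s => 2 * Num.max 0 s) 2.
Proof.
move=> a b; split.
  by rewrite -mulrBr normrM ger0_norm// ler_wpM2l// max0_lip.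
by apply: (le_trans (sqrpos_rem a b)); rewrite ler_peMl ?sqr_ge0// ler1n.
Qed.

(* If v' <= 0 where v < d then p = max(0, v - v(0))^2 satisfies p' <= M p. *)
Lemma stays_below (v dv : R -> R) (d B : R) : v 0 < d ->
  (forall t : R, is_derive t 1 v (dv t)) -> (forall t, dv t <= B) -> 0 <= B ->
  (forall t, v t < d -> dv t <= 0) -> forall t, 0 <= t -> v t <= v 0.
Proof.
move=> v0 vd dB B0 neg t t0.
(* Where v >= d, v - v(0) is at least d - v(0), so 2 (v - v(0)) B is at most M (v - v(0))^2. *)
pose p s := sqrpos (v s - v 0); pose M := 2 * B / (d - v 0).
have dv0 : 0 < d - v 0 by rewrite subr_gt0.
have pd (s : R) : is_derive s 1 p (2 * Num.max 0 (v s - v 0) * dv s).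
  have h1 : is_derive s 1 (fun s => v s - v 0) (dv s).
    by have := is_derive_subr (vd s) (is_derive_cst (v 0) s 1); rewrite subr0.
  have h2 := C11_real_is_derive (v s - v 0) C11_real_sqrpos.
  exact: (@is_derive1_comp _ (@sqrpos R) (fun s => v s - v 0) s _ _ h2 h1).
have pM s : 2 * Num.max 0 (v s - v 0) * dv s <= M * p s.
  have [vs|vs] := ltP (v s) d.
    apply: (@le_trans _ _ 0).
      by rewrite mulr_ge0_le0 ?neg// mulr_ge0// le_max lexx.
    by rewrite mulr_ge0 ?sqr_ge0// divr_ge0 ?mulr_ge0// ltW.
  rewrite /p /sqrpos max_r; last by rewrite subr_ge0; lra.
  apply: (@le_trans _ _ (2 * (v s - v 0) * B)).
    by rewrite ler_wpM2l// mulr_ge0// subr_ge0; lra.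
  rewrite /M expr2 (_ : 2 * (v s - v 0) * B = 2 * B / (d - v 0) * ((d - v 0) * (v s - v 0))).
    rewrite ler_wpM2l ?divr_ge0 ?mulr_ge0 ?(ltW dv0)//.
    by rewrite ler_wpM2r//; lra.
  by field; rewrite gt_eqF.
have := @is_derive_nonincr _ (fun s => p s * expR (- M * s))
  (fun s => 2 * Num.max 0 (v s - v 0) * dv s * expR (- M * s) + p s * (- M * expR (- M * s))) 0 t t0.
have p0 : p 0 = 0 by rewrite /p subrr /sqrpos max_l// expr0n.
rewrite p0 mul0r => h.
have {h} : p t * expR (- M * t) <= 0.
  apply: h => s _; first exact: is_derive_mulr (pd s) (is_derive_expR_mul (- M) s).
  have := pM s; have := expR_gt0 (- M * s); move: (expR _) => x x0 hp.
  have : (2 * Num.max 0 (v s - v 0) * dv s - M * p s) * x <= 0.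
    by rewrite pmulr_lle0// subr_le0.
  rewrite mulrBl; move: (p s) => ps; lra.
rewrite pmulr_lle0 ?expR_gt0// /p /sqrpos => h.
have /eqP : Num.max 0 (v t - v 0) ^+ 2 == 0 by rewrite eq_le h sqr_ge0.
move=> /eqP; rewrite sqrf_eq0 => /eqP h0.
have : v t - v 0 <= Num.max 0 (v t - v 0) by rewrite le_max lexx orbT.
by rewrite h0 subr_le0.
Qed.

(** [stays_below] confines the orbit to the trap without an argument on first exit times. There V_z'
    <= - c V_z, so V_z e^(c t) is nonincreasing. *)
Lemma trapped l z d c x : z \in l -> {in l, forall w, sphere r w} -> 0 < c ->
  (forall x, sphere r x -> halfdist2 r z x < d ->
    c * halfdist2 r z x <= dotv z (flow_field r l x)) ->
  sphere r x -> halfdist2 r z x < d -> forall t, 0 <= t ->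
  halfdist2 r z (flow r l x t) <= halfdist2 r z x /\
  halfdist2 r z (flow r l x t) <= halfdist2 r z x * expR (- c * t).
Proof.
move=> zl lr c0 hc xr xd; have zr := lr z zl.
pose v t := halfdist2 r z (flow r l x t).
have Sx t : sphere r (flow r l x t) by exact: flow_sphere.
have vd (t : R) : is_derive t 1 v (- dotv z (flow_field r l (flow r l x t))).
  exact: is_derive_halfdist2_flow.
have v0 : v 0 = halfdist2 r z x by rewrite /v flow0.
have vge0 t : 0 <= v t by exact: halfdist2_ge0.
have [C C1 CP] := smooth_lipschitz (smooth_flow_field r SM l).
have C0 : 0 <= C by exact: le_trans C1.
have below t : 0 <= t -> v t <= v 0.
  apply: (@stays_below v (fun t => - dotv z (flow_field r l (flow r l x t))) d (3 * r * C)).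
  - by rewrite v0.
  - move=> s; apply: (le_trans (ler_norm _)); rewrite normrN.
    apply: (le_trans (normr_dotv _ _)); rewrite ler_pM ?mulr_ge0//.
      by rewrite ler_wpM2l// SM.
    by have [] := CP _ _ (Sx s) (Sx s).
  - by rewrite !mulr_ge0.
  - move=> s vs; rewrite oppr_le0; apply: le_trans (hc _ (Sx s) vs).
    by rewrite mulr_ge0 ?(ltW c0)//; exact: vge0.
move=> t t0; split; first by rewrite -v0; exact: below.
have := @is_derive_nonincr _ (fun s => v s * expR (c * s))
  (fun s => - dotv z (flow_field r l (flow r l x s)) * expR (c * s) + v s * (c * expR (c * s))) 0 t t0.
rewrite mulr0 expR0 mulr1 v0 => h.
have {h} : v t * expR (c * t) <= halfdist2 r z x.
  apply: h => s /andP[s0 _]; first exact: is_derive_mulr (vd s) (is_derive_expR_mul c s).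
  have vs : v s < d by apply: le_lt_trans (below s s0) _; rewrite v0.
  have := hc _ (Sx s) vs; rewrite -/(v s) => h1.
  have := expR_gt0 (c * s); move: (expR _) (dotv _ _) h1 => e X h1 e0.
  have : (c * v s - X) * e <= 0 by rewrite pmulr_lle0// subr_le0.
  rewrite mulrBl; move: (v s) => vs'; lra.
by rewrite mulNr expRN -ler_pdivlMr ?invr_gt0 ?expR_gt0// invrK.
Qed.

End trapping.

Lemma C11_real_affine {R : realType} (k dk : R -> R) (D p c : R) : C11_real k dk D ->
  C11_real (fun s => k (p + c * s)) (fun s => c * dk (p + c * s)) (D * c ^+ 2).
Proof.
move=> kD a b; have [h1 h2] := kD (p + c * a) (p + c * b).
have E : p + c * b - (p + c * a) = c * (b - a) by ring.
rewrite E in h1 h2; split.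
  rewrite -mulrBr normrM; apply: (@le_trans _ _ (`|c| * (D * `|c * (b - a)|))).
    by rewrite ler_wpM2l.
  rewrite normrM -(real_normK (num_real c)) expr2 le_eqVlt; apply/orP; left.
  by apply/eqP; ring.
rewrite (_ : c * _ * _ = dk (p + c * a) * (c * (b - a))); last by ring.
by apply: (le_trans h2); rewrite exprMn mulrA.
Qed.

Lemma C11_real_lincomb {R : realType} (k1 dk1 k2 dk2 : R -> R) (D1 D2 c : R) :
  C11_real k1 dk1 D1 -> C11_real k2 dk2 D2 ->
  C11_real (fun s => k1 s + c * k2 s) (fun s => dk1 s + c * dk2 s) (D1 + `|c| * D2).
Proof.
move=> h1 h2 a b; have [a1 a2] := h1 a b; have [b1 b2] := h2 a b; split.
  rewrite (_ : _ - _ = (dk1 b - dk1 a) + c * (dk2 b - dk2 a)); last by ring.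
  rewrite (le_trans (ler_normD _ _))// mulrDl lerD// normrM -mulrA ler_wpM2l//.
rewrite (_ : _ - _ - _ = (k1 b - k1 a - dk1 a * (b - a)) +
   c * (k2 b - k2 a - dk2 a * (b - a))); last by ring.
by rewrite (le_trans (ler_normD _ _))// mulrDl lerD// normrM -mulrA ler_wpM2l.
Qed.

(** With q_p(s) = max(0, p - s/a)^2, k = 2 q_2 - 4 q_(3/2) + 2 q_1. This is twice a second
    difference with step 1/2 of the squared positive part: it equals 1 where all three squares are
    active, s <= a, and 0 where none is, s >= 2 a. *)
Lemma cutoff_ex {R : realType} (a : R) : 0 < a -> exists k dk D : _,
  [/\ C11_real k dk D, forall s : R, s <= a -> k s = 1 /\ dk s = 0
    & forall s : R, 2 * a <= s -> k s = 0 /\ dk s = 0].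
Proof.
move=> a0; pose q p : R -> R := fun s => sqrpos (p + - a^-1 * s).
pose dq p : R -> R := fun s => - a^-1 * (2 * Num.max 0 (p + - a^-1 * s)).
have qC p : C11_real (q p) (dq p) (2 * (- a^-1) ^+ 2).
  exact: C11_real_affine C11_real_sqrpos.
have as1 s : s <= a -> a^-1 * s <= 1 by move=> h; rewrite ler_pdivrMl// mulr1.
have as2 s : 2 * a <= s -> 2 <= a^-1 * s by move=> h; rewrite ler_pdivlMl// mulrC.
eexists; eexists; eexists; split; first exact: C11_real_lincomb 2
  (C11_real_lincomb (- 4) (C11_real_lincomb 1 (qC 2) (qC 2)) (qC (3 / 2))) (qC 1).
  move=> s /as1 h; rewrite /q /dq /sqrpos !max_r; [|lra..]; split; field; rewrite gt_eqF//.
move=> s /as2 h; rewrite /q /dq /sqrpos !max_l; [|lra..].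
by rewrite expr0n/=; split; ring.
Qed.

(** Logarithmic derivative of the product. It separates the singularities: the term of w is singular
    at w only, and its truncation is the field of [sint_ibp]. *)
Lemma wells_inv_flow_field {R : realType} (r : R) l (x v : 'rV[R]_3) : sphere r x ->
  {in l, forall w, halfdist2 r w x != 0} ->
  (wells r l x)^-1 * dotv (flow_field r l x) v =
  \sum_(w <- l) (halfdist2 r w x)^-1 * dotv (r ^+ 2 *: w - dotv x w *: x) v.
Proof.
move=> xr; rewrite /flow_field xr.
elim: l => [|w l IH] lx; first by rewrite big_nil/= (dotvC x) dotvBl !dotvZl !dotv0l; ring.
have wx : halfdist2 r w x != 0 by apply: lx; exact: mem_head.
have lx' : {in l, forall w, halfdist2 r w x != 0}.
  by move=> u ul; apply: lx; rewrite in_cons ul orbT.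
have W0 : wells r l x != 0.
  elim: (l) lx' => [|u l' IH'] h /=; first exact: oner_neq0.
  rewrite mulf_neq0//; first by apply: h; exact: mem_head.
  by apply: IH' => u' ul; apply: h; rewrite in_cons ul orbT.
rewrite big_cons -IH//= !dotvBl !dotvZl !dotvDr !dotvDl !dotvZr !dotvZl.
by field; rewrite wx W0.
Qed.

(** Entry into the trap V_z < d instead of convergence to z. For a trapping radius d the two agree,
    by [basin_decay], and entry can be tested at integer times. *)
Definition basin {R : realType} (r : R) l z (d : R) : set 'rV[R]_3 :=
  [set x | sphere r x /\ exists2 t, 0 <= t & halfdist2 r z (flow r l x t) < d].

Lemma sint_sum {R : realType} (r : R) (s : seq 'rV[R]_3) (F : 'rV[R]_3 -> 'rV[R]_3 -> R) :
  0 <= r -> (forall w, w \in s -> bounded_lipschitz (sphere r) (F w)) ->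
  bounded_lipschitz (sphere r) (fun x => \sum_(w <- s) F w x) /\
  sint r (fun x => \sum_(w <- s) F w x) = \sum_(w <- s) sint r (F w).
Proof.
move=> r0; elim: s => [|w s IH] h.
  have -> : (fun x : 'rV[R]_3 => \sum_(w <- [::]) F w x) = fun=> 0.
    by apply/funext => x; rewrite big_nil.
  rewrite big_nil sint_cst// mul0r; split=> //.
  by apply: bounded_lipschitz_of_smooth; exact: smooth_cst.
have [l1 E] := IH (fun u us => h u (mem_behead (s := w :: s) us)).
have lw := h w (mem_head _ _).
have -> : (fun x : 'rV[R]_3 => \sum_(w <- w :: s) F w x) =
    (fun x => F w x + \sum_(w <- s) F w x) by apply/funext => x; rewrite big_cons.
by rewrite big_cons sint_add// E; split=> //; exact: bounded_lipschitz_add.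
Qed.

Lemma normr_sint_le {R : realType} (r : R) (f : 'rV[R]_3 -> R) M : 0 <= r ->
  bounded_lipschitz (sphere r) f -> (forall x, sphere r x -> `|f x| <= M) ->
  `|sint r f| <= M * (4 * pi * r ^+ 2).
Proof.
move=> r0 lf fM.
have lc c : bounded_lipschitz (sphere r) (fun=> c).
  by apply: bounded_lipschitz_of_smooth; exact: smooth_cst.
rewrite ler_norml -mulNr -!sint_cst//; apply/andP; split; apply: le_sint => // x xr.
  by have := fM x xr; rewrite ler_norml => /andP[].
by have := fM x xr; rewrite ler_norml => /andP[].
Qed.

Section basin.
Context {R : realType} (r : R) (l : seq 'rV[R]_3) (d : R).
Hypotheses (r_gt0 : 0 < r) (lr : {in l, forall w, sphere r w})
  (d_gt0 : 0 < d)
  (hd : {in l, forall z, exists2 c, 0 < c & forall x, sphere r x ->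
    halfdist2 r z x < d -> c * halfdist2 r z x <= dotv z (flow_field r l x)}).

Lemma basin_trapped z x t s : z \in l -> sphere r x ->
  halfdist2 r z (flow r l x t) < d -> t <= s ->
  halfdist2 r z (flow r l x s) <= halfdist2 r z (flow r l x t).
Proof.
move=> zl xr xd ts; have [c c0 hc] := hd zl.
have yr := flow_sphere l r_gt0 t xr.
have := trapped r_gt0 zl lr c0 hc yr xd (t := s - t).
by rewrite flow_add// subrKC subr_ge0 => /(_ ts)[].
Qed.

Lemma basin_decay z x : z \in l -> basin r l z d x -> forall e, 0 < e ->
  exists2 T, 0 <= T & forall t, T <= t -> halfdist2 r z (flow r l x t) < e.
Proof.
move=> zl [xr [t t0 xd]] e e0; have [c c0 hc] := hd zl.
have yr := flow_sphere l r_gt0 t xr.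
set V := halfdist2 r z (flow r l x t).
(* Past this time V <= e c (s - t) < e e^(c (s - t)), as exp y > y, so the exponential decay brings
   V_z below e. *)
exists (t + V / (c * e)) => [|s ts].
  rewrite addr_ge0// divr_ge0 ?mulr_ge0 ?(ltW c0) ?(ltW e0)//.
  by apply: halfdist2_ge0 => //; exact: lr.
have V0 : 0 <= V by apply: halfdist2_ge0 => //; exact: lr.
have st : V / (c * e) <= s - t by rewrite lerBrDl.
have st0 : 0 <= s - t by apply: le_trans st; rewrite divr_ge0 ?mulr_ge0 ?(ltW c0) ?(ltW e0).
have [_] := trapped r_gt0 zl lr c0 hc yr xd st0.
rewrite flow_add// subrKC => h; apply: (le_lt_trans h).
rewrite mulNr expRN -/V ltr_pdivrMr ?expR_gt0//.
have h1 : V <= e * (c * (s - t)).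
  by rewrite mulrA (mulrC e) -ler_pdivrMl ?mulr_gt0// [leLHS]mulrC.
apply: (le_lt_trans h1); rewrite ltr_pM2l//.
by apply: lt_le_trans (expR_ge1Dx _); rewrite ltrDr.
Qed.

Lemma basin_disjoint z w x : z \in l -> w \in l ->
  basin r l z d x -> basin r l w d x -> z = w.
Proof.
move=> zl wl xz xw; apply/eqP/negPn/negP => zw.
have n0 : 0 < `|z - w| by rewrite normr_gt0 subr_eq0.
(* At a late time both squared distances are at most 2 e, so |z - w|^2 <= 2 (2 e + 2 e) = |z - w|^2
   / 2, a contradiction. *)
pose e := `|z - w| ^+ 2 / 16; have e0 : 0 < e by rewrite divr_gt0// exprn_gt0.
have [T1 _ h1] := basin_decay zl xz e0; have [T2 _ h2] := basin_decay wl xw e0.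
pose T := Num.max T1 T2; pose y := flow r l x T.
have yr : sphere r y by apply: flow_sphere => //; case: xz.
have {}h1 : `|y - z| ^+ 2 <= 2 * e.
  apply: (le_trans (halfdist2_norm (lr zl) yr)); rewrite ler_wpM2l// ltW// h1//.
  by rewrite le_max lexx.
have {}h2 : `|y - w| ^+ 2 <= 2 * e.
  apply: (le_trans (halfdist2_norm (lr wl) yr)); rewrite ler_wpM2l// ltW// h2//.
  by rewrite le_max lexx orbT.
have h3 : `|z - w| <= `|y - z| + `|y - w|.
  have -> : z - w = (y - w) - (y - z) by rewrite opprB [RHS]addrC subrKA.
  by rewrite (le_trans (ler_normB _ _))// addrC.
have h4 : `|z - w| ^+ 2 <= (`|y - z| + `|y - w|) ^+ 2.
  by rewrite ler_sqr ?nnegrE// addr_ge0.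
have h5 := sqr_ge0 (`|y - z| - `|y - w|).
have n2 : 0 < `|z - w| ^+ 2 by rewrite exprn_gt0.
rewrite /e in h1 h2; lra.
Qed.

Lemma basin_self z : z \in l -> basin r l z d z.
Proof.
move=> zl; have zr := lr zl; split=> //; exists 0 => //.
by rewrite flow0// halfdist2_self.
Qed.

End basin.

(** * Cutoffs carried by the flow and growth of the truncated integral *)

Definition cutoff_flow {R : realType} (r : R) l (k : R -> R) z (t : R) (x : 'rV[R]_3) : R :=
  k (halfdist2 r z (flow r l x t)).

(** Every factor is truncated separately. For eps > 0 the product is bounded and C^{1,1} on the
    sphere, and it equals 1 / [wells] where all V_w are at least eps. *)
Definition trunc_inv_wells {R : realType} (r : R) l (eps : R) (x : 'rV[R]_3) : R :=
  \prod_(w <- l) (trunc eps (halfdist2 r w x))^-1.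

Section basin_area.
Context {R : realType} (r : R) (l : seq 'rV[R]_3) (d : R) (z : 'rV[R]_3).
Hypotheses (r_gt0 : 0 < r) (ul : uniq l) (lr : {in l, forall w, sphere r w})
  (d_gt0 : 0 < d)
  (hd : {in l, forall z, exists2 c, 0 < c & forall x, sphere r x ->
    halfdist2 r z x < d -> c * halfdist2 r z x <= dotv z (flow_field r l x)})
  (zl : z \in l) (area : 4 * pi * r ^+ 2 = (size l)%:R).

Let r_ge0 : 0 <= r. Proof. exact: ltW. Qed.
Let SM (x : 'rV[R]_3) : sphere r x -> `|x| <= r. Proof. exact: sphere_norm. Qed.
Let d3_gt0 : 0 < d / 3. Proof. by rewrite divr_gt0. Qed.

Variables (k dk : R -> R) (D : R).
Hypotheses (kD : C11_real k dk D)
  (k_near : forall s : R, s <= d / 3 -> k s = 1 /\ dk s = 0)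
  (k_far : forall s : R, 2 * (d / 3) <= s -> k s = 0 /\ dk s = 0).

Let chi (x : 'rV[R]_3) : R := k (halfdist2 r z x).
Let dchi (x : 'rV[R]_3) : 'rV[R]_3 := dk (halfdist2 r z x) *: - z.
Let u := cutoff_flow r l k z.

Let chi_C11 : C11 (sphere r) chi dchi.
Proof. exact: C11_comp kD (C11_halfdist2 r SM z). Qed.

(** The gradient is displayed as a multiple of dk because [flux_sum] needs it to vanish where dk
    does, in particular near the points of l. *)
Let u_C11 t : 0 <= t -> exists h, C11 (sphere r) (u t)
  (fun x => dk (halfdist2 r z (flow r l x t)) *: h x).
Proof.
move=> t0.
have [h hC] : smooth (sphere r) (fun x => halfdist2 r z (flow r l x t)).
  apply: smooth_sub; first exact: smooth_cst.
  by apply: smooth_dotv => i; [exact: smooth_flow|exact: smooth_cst].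
by exists h; exact: C11_comp kD hC.
Qed.

(** A point with V_w < d/3 is trapped. If w = z, V_z stays at most d/3, where k = 1; otherwise x
    lies in the basin of w, which is disjoint from that of z, so V_z never falls below d and k =
    0. *)
Let u_flat w x : w \in l -> sphere r x -> halfdist2 r w x < d / 3 ->
  forall t, 0 <= t -> u t x = u 0 x /\ dk (halfdist2 r z (flow r l x t)) = 0.
Proof.
move=> wl xr xw t t0.
have xwd : halfdist2 r w (flow r l x 0) < d by rewrite flow0//; have := d_gt0; lra.
have xb : basin r l w d x by split => //; exists 0.
rewrite /u /cutoff_flow; have [wz|wz] := eqVneq w z.
  have near s : 0 <= s -> halfdist2 r z (flow r l x s) <= d / 3.
    move=> s0; rewrite -wz.
    apply: le_trans (basin_trapped r_gt0 lr hd wl xr xwd s0) _.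
    by rewrite flow0// ltW.
  have [-> ->] := k_near (near t t0).
  by have [-> _] := k_near (near 0 (lexx _)).
have far s : 0 <= s -> 2 * (d / 3) <= halfdist2 r z (flow r l x s).
  move=> s0; apply: (@le_trans _ _ d); first by have := d_gt0; lra.
  rewrite leNgt; apply/negP => xz.
  have zb : basin r l z d x by split => //; exists s.
  by move: wz; rewrite (basin_disjoint r_gt0 lr hd wl zl xb zb) eqxx.
have [-> ->] := k_far (far t t0).
by have [-> _] := k_far (far 0 (lexx _)).
Qed.

(** Differentiate u_t(Phi_s x) = chi(Phi_s(Phi_t x)) at s = 0. The gradients are compared in the
    direction of the flow, which is tangent to the sphere, so any representative g serves. *)
Let u_dot x t g : sphere r x -> 0 <= t -> C11 (sphere r) (u t) g ->
  dotv (g x) (flow_field r l x) =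
  dotv (dchi (flow r l x t)) (flow_field r l (flow r l x t)).
Proof.
move=> xr t0 gC.
have h1 := C11_chain gC (fun s => flow_sphere l r_gt0 s xr)
  (fun i => flow_derive l r_gt0 0 i xr).
have yr := flow_sphere l r_gt0 t xr.
have h2 := C11_chain chi_C11 (fun s => flow_sphere l r_gt0 s yr)
  (fun i => flow_derive l r_gt0 0 i yr).
rewrite !flow0// in h1 h2.
have E : (fun s => u t (flow r l x s)) = (fun s => chi (flow r l (flow r l x t) s)).
  by apply/funext => s; rewrite /u /cutoff_flow /chi !flow_add// addrC.
rewrite E in h1; by rewrite -(@derive_val _ _ _ _ _ _ _ h1) -(@derive_val _ _ _ _ _ _ _ h2).
Qed.

Let flow_rem : exists2 C, 0 <= C & forall y h, sphere r y -> 0 <= h ->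
  `|flow r l y h - y| <= C * h /\
  `|flow r l y h - y - h *: flow_field r l y| <= C * h ^+ 2.
Proof.
have [K K1 KP] := smooth_lipschitz (smooth_flow_field r SM l).
have K0 : 0 <= K by exact: le_trans K1.
have first y h : sphere r y -> 0 <= h -> `|flow r l y h - y| <= K * h.
  move=> yr h0; apply: norm_le_coord => [|i]; first by rewrite mulr_ge0.
  rewrite rV_subE.
  have := @is_derive_le_cst _ (fun s => flow r l y s ord0 i)
    (fun s => flow_field r l (flow r l y s) ord0 i) 0 h K h0.
  rewrite subr0 flow0//; apply => s _; first exact: flow_derive.
  apply: (le_trans (coord_le_norm _ _)).
  by have [] := KP _ _ (flow_sphere l r_gt0 s yr) (flow_sphere l r_gt0 s yr).
exists (K + K * K) => [|y h yr h0]; first by rewrite addr_ge0// mulr_ge0.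
have KK : 0 <= K * K by rewrite mulr_ge0.
split.
  by apply: (le_trans (first y h yr h0)); rewrite ler_wpM2r//; lra.
apply: (@le_trans _ _ (K * K * h ^+ 2)); last by rewrite ler_wpM2r ?sqr_ge0//; lra.
apply: norm_le_coord => [|i]; first by rewrite mulr_ge0 ?sqr_ge0.
have Gi : (h *: flow_field r l y) ord0 i = flow_field r l y ord0 i * h.
  by rewrite mxE mulrC.
rewrite !rV_subE Gi.
have := @is_derive_le_cst _ (fun s => flow r l y s ord0 i - flow_field r l y ord0 i * s)
    (fun s => flow_field r l (flow r l y s) ord0 i - flow_field r l y ord0 i) 0 h (K * K * h) h0.
rewrite flow0// mulr0 !subr0 expr2 mulrA addrAC; apply => s /andP[s0 sh].
  by apply: is_derive_subr; [exact: flow_derive|exact: is_derive_mulr_cst].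
rewrite -rV_subE; apply: (le_trans (coord_le_norm _ _)).
have [_ h1] := KP _ _ (flow_sphere l r_gt0 s yr) yr.
apply: (le_trans h1); rewrite -mulrA ler_wpM2l//.
by apply: (le_trans (first y s yr s0)); rewrite ler_wpM2l.
Qed.

(** The expansion is that of chi at the point Phi_t(x), so the constant depends on neither t nor x,
    in contrast with the constants of [u_C11]. *)
Let u_rem : exists2 C, 0 <= C & forall x t h, sphere r x -> 0 <= h ->
  `|u (t + h) x - u t x -
    h * dotv (dchi (flow r l x t)) (flow_field r l (flow r l x t))| <= C * h ^+ 2.
Proof.
have [K K0 KP] := flow_rem; have [C C1 CP] := chi_C11.
have C0 : 0 <= C by exact: le_trans C1.
exists (C * K ^+ 2 + 3 * C * K) => [|x t h xr h0].
  by rewrite addr_ge0 ?mulr_ge0 ?sqr_ge0.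
have yr := flow_sphere l r_gt0 t xr.
rewrite /u /cutoff_flow -flow_add// -!/(chi _); set y := flow r l x t in yr *.
have [k1 k2] := KP y h yr h0.
have [_ c2 _ _ c5] := CP y (flow r l y h) yr (flow_sphere l r_gt0 h yr).
rewrite (_ : _ - _ - _ = (chi (flow r l y h) - chi y - dotv (dchi y) (flow r l y h - y))
   + dotv (dchi y) (flow r l y h - y - h *: flow_field r l y)); last first.
  have aux (a b e : 'rV[R]_3) : dotv a (b - h *: e) = dotv a b - h * dotv a e.
    by rewrite dotvBr dotvZr.
  by rewrite aux; ring.
rewrite (le_trans (ler_normD _ _))// mulrDl lerD//.
  apply: (le_trans c5); rewrite -mulrA ler_wpM2l// -exprMn ler_sqr ?nnegrE//.
  by rewrite mulr_ge0.
apply: (le_trans (normr_dotv _ _)).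
have -> : 3 * C * K * h ^+ 2 = 3 * C * (K * h ^+ 2) by ring.
by rewrite ler_pM ?mulr_ge0// ler_wpM2l.
Qed.

Let kw w x : R := (trunc (d / 3) (halfdist2 r w x))^-1.
Let omega := trunc_inv_wells r l (d / 3).

Let kw_smooth w : smooth (sphere r) (kw w).
Proof.
have d6 : 0 < d / 3 / 2 by rewrite divr_gt0.
eexists; apply: (C11_inv d6 (fun x _ => trunc_ge (halfdist2 r w x) d3_gt0)).
exact: C11_comp (C11_real_trunc d3_gt0) (C11_halfdist2 r SM w).
Qed.

Let omega_smooth : smooth (sphere r) omega.
Proof.
rewrite /omega /trunc_inv_wells; elim: (l) => [|w s IH].
  have -> : (fun x : 'rV[R]_3 => \prod_(w <- [::]) kw w x) = fun=> 1.
    by apply/funext => x; rewrite big_nil.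
  exact: smooth_cst.
have -> : (fun x : 'rV[R]_3 => \prod_(w <- w :: s) kw w x) =
    (fun x => kw w x * \prod_(w <- s) kw w x) by apply/funext => x; rewrite big_cons.
exact: smooth_mul.
Qed.

Let omegaE x : sphere r x -> {in l, forall w, d / 3 <= halfdist2 r w x} ->
  omega x = (wells r l x)^-1 /\ {in l, forall w, kw w x = (halfdist2 r w x)^-1}.
Proof.
move=> xr h; split; last by move=> w wl; rewrite /kw trunc_id// h.
rewrite /omega /trunc_inv_wells; elim: (l) h => [|w s IH] h; first by rewrite big_nil invr1.
rewrite big_cons IH/=; last by move=> v vs; apply: h; rewrite in_cons vs orbT.
by rewrite /kw trunc_id ?invfM// h// mem_head.
Qed.

Let Tw w (x : 'rV[R]_3) : 'rV[R]_3 := r ^+ 2 *: w - dotv x w *: x.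

(** Where every V_w is at least d/3 no truncation acts and [wells_inv_flow_field] applies. Elsewhere
    some V_w is below d/3, and both sides vanish by [u_flat]. *)
Let flux_sum x t g : sphere r x -> 0 <= t -> C11 (sphere r) (u t) g ->
  (dk (halfdist2 r z (flow r l x t)) = 0 -> g x = 0) ->
  \sum_(w <- l) kw w x * dotv (Tw w x) (g x) =
  dotv (dchi (flow r l x t)) (flow_field r l (flow r l x t)) * omega x.
Proof.
move=> xr t0 gC g0.
have [/allP h|/allPn[w wl]] := boolP (all (fun w => d / 3 <= halfdist2 r w x) l); last first.
  rewrite -ltNge => xw; have [_ dk0] := u_flat wl xr xw t0.
  rewrite /dchi dk0 scale0r dotv0l mul0r big1// => v _.
  by rewrite (g0 dk0) dotvC dotv0l mulr0.
have [-> kwE] := omegaE xr h.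
rewrite -(u_dot xr t0 gC) dotvC mulrC wells_inv_flow_field//; last first.
  by move=> w wl; rewrite gt_eqF// (lt_le_trans d3_gt0)// h.
rewrite !big_seq; apply: eq_bigr => w wl; rewrite kwE//.
Qed.

Let lip_cst (c : R) : bounded_lipschitz (sphere r) (fun=> c).
Proof. by apply: bounded_lipschitz_of_smooth; exact: smooth_cst. Qed.

Let u_lip t : 0 <= t -> bounded_lipschitz (sphere r) (u t).
Proof. by move=> t0; have [h /C11_bounded_lipschitz[]] := u_C11 t0. Qed.

Let flux_lip w t g : 0 <= t -> C11 (sphere r) (u t) g ->
  bounded_lipschitz (sphere r) (fun x => kw w x * dotv (Tw w x) (g x)).
Proof.
move=> t0 gC; have [_ lg] := C11_bounded_lipschitz gC.
apply: bounded_lipschitz_mul; first exact: bounded_lipschitz_of_smooth.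
apply: bounded_lipschitz_dotv => // i; apply: bounded_lipschitz_of_smooth.
have -> : (fun x => Tw w x ord0 i) = (fun x => r ^+ 2 * w ord0 i - dotv x w * x ord0 i).
  by apply/funext => x; rewrite !mxE.
apply: smooth_sub; first exact: smooth_cst.
apply: smooth_mul (smooth_coord i SM).
by eexists; exact: C11_dotv SM.
Qed.

Let flux_int w t g : w \in l -> 0 <= t -> C11 (sphere r) (u t) g ->
  sint r (fun x => kw w x * dotv (Tw w x) (g x)) =
  - sint r (u t) + (if w == z then (size l)%:R else 0).
Proof.
move=> wl t0 gC.
have flat x : sphere r x -> halfdist2 r w x < d / 3 -> u t x = k (halfdist2 r z x).
  move=> xr xw; have [-> _] := u_flat wl xr xw t0.
  by rewrite /u /cutoff_flow flow0.
case: eqP => [wz|/eqP wz].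
  have gC' : C11 (sphere r) (fun x => 1 - u t x) (fun x => - g x).
    by apply: C11_eq (C11_sub (C11_cst _ 1) gC) => // x _; rewrite sub0r.
  have m0 x : sphere r x -> halfdist2 r w x < d / 3 -> 1 - u t x = 0.
    move=> xr xw; rewrite flat//; rewrite wz in xw.
    by have [-> _] := k_near (ltW xw); rewrite subrr.
  have := sint_ibp r_gt0 (lr wl) d3_gt0 gC' m0.
  have -> : (fun x => (trunc (d / 3) (halfdist2 r w x))^-1 *
      dotv (r ^+ 2 *: w - dotv x w *: x) (- g x)) =
      (fun x => -1 * (kw w x * dotv (Tw w x) (g x))).
    by apply/funext => x; rewrite dotvNr mulrN mulN1r.
  rewrite sint_scale//; last exact: flux_lip gC.
  have -> : (fun x => 1 - u t x) = (fun x => 1 + -1 * u t x).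
    by apply/funext => x; rewrite mulN1r.
  have lu : bounded_lipschitz (sphere r) (fun x => -1 * u t x).
    by apply: bounded_lipschitz_mul => //; exact: u_lip.
  rewrite sint_add// sint_scale//; last exact: u_lip.
  by rewrite sint_cst// area; lra.
rewrite addr0; apply: (sint_ibp r_gt0 (lr wl) d3_gt0 gC) => x xr xw.
rewrite flat//; apply: (k_far _).1.
have xwd : halfdist2 r w (flow r l x 0) < d by rewrite flow0//; have := d_gt0; lra.
have wb : basin r l w d x by split=> //; exists 0.
apply: (@le_trans _ _ d); first by have := d_gt0; lra.
rewrite leNgt; apply/negP => xz.
have zb : basin r l z d x by split => //; exists 0 => //; rewrite flow0.
by move: wz; rewrite (basin_disjoint r_gt0 lr hd wl zl wb zb) eqxx.
Qed.

(** [size l] occurs in two roles: as the number of terms - int u_t, and as the area of the sphere,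
    contributed by the term w = z. Their equality makes the equilibrium value of int u_t equal to
    1. *)
Let flux_total t g : 0 <= t -> C11 (sphere r) (u t) g ->
  bounded_lipschitz (sphere r) (fun x => \sum_(w <- l) kw w x * dotv (Tw w x) (g x)) /\
  sint r (fun x => \sum_(w <- l) kw w x * dotv (Tw w x) (g x)) =
  (size l)%:R * (1 - sint r (u t)).
Proof.
move=> t0 gC.
have [lE ->] := sint_sum (s := l) (F := fun w x => kw w x * dotv (Tw w x) (g x)) r_ge0
  (fun w _ => flux_lip w t0 gC).
split=> //; rewrite big_seq.
under eq_bigr => w wl do rewrite (flux_int wl t0 gC).
rewrite -big_seq big_split/= big_const_seq count_predT iter_addr_0.
rewrite (bigD1_seq z)//= eqxx big1 ?addr0 => [|w /negbTE ->//].
by rewrite mulrBr mulr1 mulNrn mulr_natl addrC.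
Qed.

(** The pointwise remainder of [u_rem] is integrated against the bounded weight [omega], and
    [flux_total] evaluates the linear term. No derivative is taken under the integral sign, and one
    C serves all times. *)
Lemma cutoff_growth : exists2 C, 0 <= C & forall t h, 0 <= t -> 0 <= h ->
  `|sint r (fun x => u (t + h) x * omega x) - sint r (fun x => u t x * omega x) -
    h * ((size l)%:R * (1 - sint r (u t)))| <= C * h ^+ 2.
Proof.
have [K K0 KP] := u_rem.
have [W W0 WP] := bounded_lipschitz_of_smooth omega_smooth.
exists (K * W * (size l)%:R) => [|t h t0 h0]; first by rewrite !mulr_ge0.
have th0 : 0 <= t + h by rewrite addr_ge0.
have [v vC] := u_C11 t0; set g := (fun x => _) in vC.
have [lE <-] := flux_total t0 vC.
have lO := bounded_lipschitz_of_smooth omega_smooth.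
have lu t1 : 0 <= t1 -> bounded_lipschitz (sphere r) (fun x => u t1 x * omega x).
  by move=> t10; apply: bounded_lipschitz_mul => //; exact: u_lip.
have lN f : bounded_lipschitz (sphere r) f -> forall c, bounded_lipschitz (sphere r) (fun x => c * f x).
  by move=> lf c; exact: bounded_lipschitz_mul.
rewrite -(mulN1r (sint r (fun x => u t x * _))) -sint_scale; [|by []|exact: lu].
rewrite -sint_add//; [|exact: lu|by apply: lN; exact: lu].
rewrite -mulNr -sint_scale//.
rewrite -sint_add//; [|by apply: bounded_lipschitz_add; [exact: lu|apply: lN; exact: lu]|exact: lN].
rewrite (_ : K * W * _ * _ = K * h ^+ 2 * W * (4 * pi * r ^+ 2)); last first.
  by rewrite area; ring.
apply: normr_sint_le => //.
  apply: bounded_lipschitz_add; last exact: lN.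
  by apply: bounded_lipschitz_add; [exact: lu|apply: lN; exact: lu].
move=> x xr; rewrite (flux_sum xr t0 vC); last by rewrite /g => ->; rewrite scale0r.
rewrite (_ : _ + _ = (u (t + h) x - u t x - h * dotv (dchi (flow r l x t))
   (flow_field r l (flow r l x t))) * omega x); last by ring.
by rewrite normrM ler_pM ?KP//; have [] := WP x x xr xr.
Qed.

Lemma cutoff_bounded : exists M, forall t x, sphere r x -> `|u t x| <= M.
Proof.
have [C _ CP] := chi_C11; exists C => t x xr.
by have [] := CP _ _ (flow_sphere l r_gt0 t xr) (flow_sphere l r_gt0 t xr).
Qed.

Lemma cutoff_lipschitz t : 0 <= t ->
  bounded_lipschitz (sphere r) (u t) /\ bounded_lipschitz (sphere r) omega.
Proof.
by move=> t0; split; [exact: u_lip|exact: bounded_lipschitz_of_smooth].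
Qed.

(** The sequence is eventually constant: off the basin V_z never falls below d, where k = 0, and in
    the basin V_z ends below d/3, where k = 1. *)
Lemma cutoff_cvg x h : sphere r x -> 0 < h ->
  u (j%:R * h) x @[j --> \oo] --> (\1_(basin r l z d) x : R).
Proof.
move=> xr h0; have [xb|xb] := pselect (basin r l z d x); last first.
  rewrite indicE memNset//; apply: cvg_near_cst; apply: nearW => j.
  apply: (k_far _).1; apply: (@le_trans _ _ d); first by have := d_gt0; lra.
  rewrite leNgt; apply/negP => xz; apply: xb; split=> //.
  by exists (j%:R * h) => //; rewrite mulr_ge0// ltW.
rewrite indicE mem_set//; apply: cvg_near_cst.
have [T T0 TP] := basin_decay r_gt0 lr hd zl xb d3_gt0.
near=> j; apply: (k_near _).1; apply: ltW; apply: TP.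
rewrite -ler_pdivrMr//; near: j; exact: nbhs_infty_ger.
Unshelve. all: by end_near. Qed.

End basin_area.

(** * Passage to the limit and area of a basin *)

Lemma sint_dominated_cvg {R : realType} (r M : R) (f : nat -> 'rV[R]_3 -> R) (B : set 'rV[R]_3) :
  0 <= r -> measurable (B : set (borelR3 R)) ->
  (forall j, bounded_lipschitz (sphere r) (f j)) ->
  (forall j x, sphere r x -> `|f j x| <= M) ->
  (forall x, sphere r x -> f j x @[j --> \oo] --> (\1_B x : R)) ->
  exists2 b, sphere_area r (B : set (borelR3 R)) = b%:E &
    sint r (f j) @[j --> \oo] --> b.
Proof.
move=> r0 mB fl fM fB.
pose mu2 := (@lebesgue_measure R \x @lebesgue_measure R)%E.
pose F j (p : R * R) := (r ^+ 2 * sin p.1 * f j (spherical r p))%:E.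
pose G (p : R * R) := (r ^+ 2 * sin p.1 * \1_B (spherical r p))%:E.
have bF j : bmeas (fun p => r ^+ 2 * sin p.1 * f j (spherical r p)).
  exact: bmeas_sint.
have mF j : measurable_fun angles (F j).
  apply/measurable_EFinP; have [+ _] := bF j; exact: measurable_funS.
have mG : measurable_fun angles G.
  apply: (measurable_funS measurableT) => //; apply/measurable_EFinP.
  apply: measurable_funM.
    by apply: measurable_funM => //; have [] := @bmeas_sin_fst R.
  have -> : (fun p : R * R => \1_B (spherical r p) : R) = \1_(spherical r @^-1` B).
    by apply/funext => p; rewrite !indicE; congr (_%:R); congr nat_of_bool;
      apply/idP/idP; rewrite !inE.
  apply: measurable_indic; rewrite -[X in measurable X]setTI.
  exact: measurable_spherical.
pose g : R * R -> \bar R := EFin \o (fun=> r ^+ 2 * `|M|).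
have iM : mu2.-integrable angles g.
  exact/bmeas_integrable/bmeas_cst.
have FG : {ae mu2, forall p, angles p -> (fun j => F j p) @ \oo --> (G p : \bar R)}.
  apply: aeW => p _; apply: cvg_EFin; first by apply: nearW.
  apply: cvgMr; exact: (fB _ (sphere_spherical r0 p)).
have FM : {ae mu2, forall p n, angles p -> (`|F n p| <= g p)%E}.
  apply: aeW => p n _; rewrite /F /g/= lee_fin 2!normrM (ger0_norm (sqr_ge0 r)) -mulrA ler_wpM2l ?sqr_ge0//.
  rewrite -[leRHS]mul1r ler_pM ?normr_sin_le1//.
  apply: (le_trans (fM n _ (sphere_spherical r0 p))); exact: ler_norm.
have [iG _ cvg] := @dominated_convergence _ _ _ mu2 _ (@measurable_angles R) F G g mF mG FG iM FM.
pose I := (\int[mu2]_(p in angles) G p)%E.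
have Gfin : I \is a fin_num.
  by apply: integrable_fin_num; [exact: measurable_angles|exact: iG].
exists (fine I); first by rewrite fineK.
by apply: fine_cvg; rewrite fineK.
Qed.

Lemma exists_natr_gt {R : realType} (x : R) : exists m : nat, x < m%:R.
Proof. by exists (Num.truncn x).+1; exact: truncnS_gt. Qed.

(* A bounded sequence whose increments are h c (1 - a_k) + O(h^2), uniformly in
   h, forces the limit of a_k to be 1. *)
Lemma bounded_increments {R : realType} (J a : R -> nat -> R) (M C c b : R) :
  0 < c -> 0 <= C -> (forall h k, 0 < h -> `|J h k| <= M) ->
  (forall h, 0 < h -> a h k @[k --> \oo] --> b) ->
  (forall h k, 0 < h -> `|J h k.+1 - J h k - h * (c * (1 - a h k))| <= C * h ^+ 2) ->
  b = 1.
Proof.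
move=> c0 C0 JM ab JC; apply/eqP/negPn/negP => b1.
pose e := `|1 - b|; have e0 : 0 < e by rewrite normr_gt0 subr_eq0 eq_sym.
(* With this step the error C h^2 is at most h c e / 4, and |a_k - b| <= e / 4 costs as much again.
   Of the drift h c e, in the direction of the sign of 1 - b, at least h c e / 2 remains at each
   late step. *)
pose h := c * e / (4 * (C + 1)).
have C10 : 0 < C + 1 by rewrite ltr_wpDl.
have h0 : 0 < h by rewrite divr_gt0 ?mulr_gt0.
pose s := Num.sg (1 - b).
have s1 : `|s| = 1 by rewrite normr_sg subr_eq0 eq_sym b1.
have se : s * (1 - b) = e by rewrite /s /e normrEsg.
have Ch : C * h ^+ 2 <= h * (c * e / 4).
  rewrite expr2 mulrA mulrC ler_wpM2l ?(ltW h0)//.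
  apply: (@le_trans _ _ ((C + 1) * h)); first by rewrite ler_wpM2r ?(ltW h0)// lerDl.
  have -> : (C + 1) * h = c * e / 4 by rewrite /h; field; rewrite gt_eqF.
  exact: lexx.
have e4 : 0 < e / 4 by rewrite divr_gt0.
have [N _ NP] := (cvgrPdist_le _ _).1 (ab h h0) _ e4.
have step k : (N <= k)%N -> h * (c * e / 2) <= s * J h k.+1 - s * J h k.
  move=> /NP/= bk; have := JC h k h0; set X := _ - _ - _ => hX.
  have -> : s * J h k.+1 - s * J h k = s * X + h * (c * (s * (1 - b))) + h * (c * (s * (b - a h k))).
    by rewrite /X; ring.
  rewrite se.
  have sX : - (C * h ^+ 2) <= s * X.
    by have := ler_norm (- (s * X)); rewrite normrN normrM s1 mul1r; lra.
  have sb : - (e / 4) <= s * (b - a h k).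
    by have := ler_norm (- (s * (b - a h k))); rewrite normrN normrM s1 mul1r; lra.
  have hc : 0 < h * c by rewrite mulr_gt0.
  have : h * c * - (e / 4) <= h * c * (s * (b - a h k)) by rewrite ler_wpM2l// ltW.
  lra.
have many m : m%:R * (h * (c * e / 2)) <= s * J h (N + m)%N - s * J h N.
  elim: m => [|m IH]; first by rewrite mul0r addn0 subrr.
  have := step (N + m)%N (leq_addr _ _); rewrite addnS -[m.+1%:R]natr1 mulrDl mul1r; lra.
have x0 : 0 < h * (c * e / 2) by apply: mulr_gt0 => //; rewrite divr_gt0// mulr_gt0.
have [m] := exists_natr_gt ((2 * M) / (h * (c * e / 2))).
rewrite ltr_pdivrMr// => mM.
have sJ k : `|s * J h k| <= M by rewrite normrM s1 mul1r JM.
have := many m; have := ler_norm (s * J h (N + m)%N); have := ler_norm (- (s * J h N)).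
rewrite normrN; have := sJ N; have := sJ (N + m)%N; lra.
Qed.

Section basin_area_one.
Context {R : realType} (r : R) (l : seq 'rV[R]_3) (d : R) (z : 'rV[R]_3).
Hypotheses (r_gt0 : 0 < r) (ul : uniq l) (lr : {in l, forall w, sphere r w})
  (d_gt0 : 0 < d)
  (hd : {in l, forall z, exists2 c, 0 < c & forall x, sphere r x ->
    halfdist2 r z x < d -> c * halfdist2 r z x <= dotv z (flow_field r l x)})
  (zl : z \in l) (area : 4 * pi * r ^+ 2 = (size l)%:R).

Lemma measurable_basin : measurable (basin r l z d : set (borelR3 R)).
Proof.
have r_ge0 := ltW r_gt0.
have SM (x : 'rV[R]_3) : sphere r x -> `|x| <= r by exact: sphere_norm.
(* An orbit that has entered the trap is still there at the next integer time, so a countable union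
   suffices. *)
have -> : basin r l z d = \bigcup_(j : nat)
    (sphere r `&` [set x | halfdist2 r z (flow r l x j%:R) < d]).
  apply/seteqP; split=> x.
    move=> [xr [t t0 xd]]; have [m tm] := exists_natr_gt t.
    exists m => //; split=> //=.
    exact: le_lt_trans (basin_trapped r_gt0 lr hd zl xr xd (ltW tm)) xd.
  by move=> [j _ [xr xj]]; split=> //; exists j%:R.
apply: bigcupT_measurable => j; apply: measurable_sublevel.
apply: bounded_lipschitz_of_smooth; apply: smooth_sub; first exact: smooth_cst.
by apply: smooth_dotv => i; [exact: smooth_flow|exact: smooth_cst].
Qed.

Lemma basin_area_eq1 : sphere_area r (basin r l z d : set (borelR3 R)) = 1%:E.
Proof.
have r_ge0 := ltW r_gt0.
have d3 : 0 < d / 3 by rewrite divr_gt0.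
have [k [dk [D [kD kn kf]]]] := cutoff_ex d3.
have [C C0 CP] := cutoff_growth r_gt0 ul lr d_gt0 hd zl area kD kn kf.
have [M MP] := cutoff_bounded l z r_gt0 kD.
have [lu0 lo] := cutoff_lipschitz l z r_gt0 d_gt0 kD (lexx 0).
pose om := trunc_inv_wells r l (d / 3); pose u := cutoff_flow r l k z.
have lu t : 0 <= t -> bounded_lipschitz (sphere r) (u t).
  by move=> t0; have [] := cutoff_lipschitz l z r_gt0 d_gt0 kD t0.
have cv h : 0 < h -> exists2 b, sphere_area r (basin r l z d : set (borelR3 R)) = b%:E &
    sint r (u (j%:R * h)) @[j --> \oo] --> b.
  move=> h0; apply: (@sint_dominated_cvg _ r M (fun j => u (j%:R * h))) => //.
  - exact: measurable_basin.
  - by move=> j; apply: lu; rewrite mulr_ge0// ltW.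
  - by move=> j x xr; exact: MP.
  - by move=> x xr; exact: (cutoff_cvg r_gt0 lr d_gt0 hd zl kn kf xr h0).
have [b bE _] := cv 1 ltr01; rewrite bE; congr EFin.
have [W W0 WP] := lo.
have l_gt0 : 0 < (size l)%:R :> R.
  by rewrite ltr0n lt0n size_eq0; apply: contraTneq zl => ->.
apply: (@bounded_increments _ (fun h j => sint r (fun x => u (j%:R * h) x * om x))
  (fun h j => sint r (u (j%:R * h))) (M * W * (4 * pi * r ^+ 2)) C (size l)%:R) => //.
- move=> h j h0; have jh : 0 <= j%:R * h by rewrite mulr_ge0// ltW.
  apply: normr_sint_le => // [|x xr].
    by apply: bounded_lipschitz_mul => //; exact: lu.
  by rewrite normrM ler_pM ?MP//; have [] := WP x x xr xr.
- by move=> h h0; have [b' b'E +] := cv h h0; move: b'E; rewrite bE => -[<-].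
- move=> h j h0; have jh : 0 <= j%:R * h by rewrite mulr_ge0// ltW.
  by have := CP _ _ jh (ltW h0); rewrite -[j.+1%:R]natr1 mulrDl mul1r.
Qed.

End basin_area_one.

(** * The force and its integral curves *)

Section force.
Context {R : realType} (r : R) (L : set 'rV[R]_3) (l : seq 'rV[R]_3).
Hypotheses (r_gt0 : 0 < r) (lr : {in l, forall w, sphere r w})
  (potentialE : potential L = fun x => \sum_(z <- l) ln (enorm (x - z))).

Let SM (x : 'rV[R]_3) : sphere r x -> `|x| <= r. Proof. exact: sphere_norm (ltW r_gt0). Qed.

Lemma curve_sphere_orthogonal x v c : curve_at (sphere r) x v c -> dotv x v = 0.
Proof.
move=> [cr c0 /is_derive_rV cd].
have h1 := is_derive_dotv cd cd.
have h2 : is_derive (0 : R) 1 (fun s => dotv (c s) (c s)) 0.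
  have -> : (fun s => dotv (c s) (c s)) = cst (r ^+ 2) by apply/funext => s; exact: cr.
  exact: is_derive_cst.
have : dotv v (c 0) + dotv (c 0) v = 0.
  by rewrite -(@derive_val _ _ _ _ _ _ _ h1) (@derive_val _ _ _ _ _ _ _ h2).
by rewrite c0 dotvC; lra.
Qed.

(* The curve is ((1 - s) x + t v) / (1 + s) with s = t^2 |v|^2 / (4 r^2). *)
Lemma tangent_sphere x v : sphere r x -> dotv x v = 0 -> tangent_space (sphere r) x v.
Proof.
move=> xr xv; pose q := dotv v v / (4 * r ^+ 2).
have q0 : 0 <= q by rewrite divr_ge0 ?dotv_ge0// mulr_ge0// sqr_ge0.
pose a (t : R) := 1 + q * t * t.
have a1 t : 0 < a t by rewrite ltr_wpDr// -mulrA mulr_ge0// -expr2 sqr_ge0.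
exists (fun t => (a t)^-1 *: ((1 - q * t * t) *: x + t *: v)); split.
- move=> t; have at0 := a1 t; rewrite /sphere/= dotvZl dotvZr dotvDl !dotvDr !dotvZl !dotvZr.
  rewrite (dotvC v x) xv xr.
  have -> : dotv v v = q * (4 * r ^+ 2) by rewrite divfK// gt_eqF// mulr_gt0// exprn_gt0.
  by rewrite /a; field; rewrite gt_eqF.
- by rewrite /a !mulr0 !(addr0, subr0) invr1 !scale1r scale0r addr0.
apply/is_derive_rV => i.
have hq : is_derive (0 : R) 1 (fun t : R => q * t * t) 0.
  have := is_derive_mulr (is_derive_mulr_cst q (0 : R)) (is_derive_id (0 : R) 1).
  by rewrite !mulr0 mul0r addr0.
have ha : is_derive (0 : R) 1 a 0.
  by have := is_derive_addr (is_derive_cst (1 : R) (0 : R) 1) hq; rewrite addr0.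
have hia : is_derive (0 : R) 1 (fun t => (a t)^-1) 0.
  have := is_deriveV (lt0r_neq0 (a1 0)) ha.
  by rewrite /GRing.scale/= mulr0.
have hb : is_derive (0 : R) 1 (fun t : R => (1 - q * t * t) * x ord0 i + t * v ord0 i) (v ord0 i).
  have h1 := is_derive_subr (is_derive_cst (1 : R) (0 : R) 1) hq.
  have h2 := is_derive_mulr h1 (is_derive_cst (x ord0 i) (0 : R) 1).
  have h3 := is_derive_mulr (is_derive_id (0 : R) 1) (is_derive_cst (v ord0 i) (0 : R) 1).
  by have := is_derive_addr h2 h3; rewrite subr0 mul0r mulr0 !add0r mul1r mulr0 addr0.
have -> : (fun t => ((a t)^-1 *: ((1 - q * t * t) *: x + t *: v)) ord0 i) =
    (fun t => (a t)^-1 * ((1 - q * t * t) * x ord0 i + t * v ord0 i)).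
  by apply/funext => t; rewrite !mxE.
have := is_derive_mulr hia hb; rewrite mul0r add0r /a !mulr0 addr0 invr1 mul1r.
exact.
Qed.

(** At x = z both sides are 0, the default value of [ln] at 0. The identity thus holds at all times
    along a curve in the sphere, which may meet L away from time 0. *)
Lemma ln_enorm (x z : 'rV[R]_3) : sphere r x -> sphere r z ->
  ln (enorm (x - z)) = 2^-1 * ln (2 * halfdist2 r z x).
Proof.
move=> xr zr; rewrite /enorm -(halfdist2E zr xr); set a := 2 * _.
have [a0|a0] := leP a 0.
  by rewrite (ler0_sqrtr a0) !ln0// mulr0.
rewrite -{2}(sqr_sqrtr (ltW a0)) lnXn ?sqrtr_gt0//.
by rewrite -[ln _ *+ 2]mulr_natl mulKf.
Qed.

(** Along the curve, (1/2) ln(2 V_z) has derivative -(z.v) / (2 V_z). These terms add up to the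
    given field by [wells_inv_flow_field], where x.v = 0 removes the radial part and leaves the
    factor r^2. *)
Lemma is_riem_grad_potential x : sphere r x -> x \notin l ->
  is_riem_grad (sphere r) (potential L) x (- ((2 * r ^+ 2 * wells r l x)^-1 *: flow_field r l x)).
Proof.
move=> xr xl; split.
  by apply: tangent_sphere => //; rewrite dotvNr dotvZr dotv_flow_field mulr0 oppr0.
move=> v c cv; have xv := curve_sphere_orthogonal cv.
have [cr c0 /is_derive_rV cd] := cv.
have V0 : {in l, forall w, 0 < halfdist2 r w x}.
  move=> w wl; rewrite lt_neqAle (halfdist2_ge0 (lr wl) xr) andbT eq_sym.
  apply: contra xl => /eqP/(halfdist2_eq0 (lr wl) xr) xw; first by rewrite xw.
have -> : potential L \o c = fun t => \sum_(z <- l) 2^-1 * ln (2 * halfdist2 r z (c t)).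
  apply/funext => t; rewrite potentialE/= !big_seq; apply: eq_bigr => w wl.
  exact: ln_enorm (cr t) (lr wl).
have -> : dotv (- ((2 * r ^+ 2 * wells r l x)^-1 *: flow_field r l x)) v =
    \sum_(z <- l) - (2^-1 * (halfdist2 r z x)^-1 * dotv z v).
  rewrite dotvNl dotvZl invfM -mulrA wells_inv_flow_field//; last first.
    by move=> w wl; rewrite gt_eqF// V0.
  rewrite sumrN mulr_sumr; congr (- _); apply: eq_bigr => w _.
  by rewrite dotvBl !dotvZl xv mulr0 subr0; move: (halfdist2 r w x)^-1 => I; field; rewrite gt_eqF.
have term w : w \in l -> is_derive (0 : R) 1 (fun t => 2^-1 * ln (2 * halfdist2 r w (c t)))
    (- (2^-1 * (halfdist2 r w x)^-1 * dotv w v)).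
  move=> wl; have hV := C11_chain (C11_halfdist2 r SM w) cr cd.
  have h2 := is_derive_mulr (is_derive_cst (2 : R) (0 : R) 1) hV.
  have V2 : 0 < 2 * halfdist2 r w (c 0) by rewrite c0 mulr_gt0// V0.
  have h3 := @is_derive1_comp _ (@ln R) (fun t => 2 * halfdist2 r w (c t)) 0 _ _ (is_derive1_ln V2) h2.
  have h4 := is_derive_mulr (is_derive_cst (2^-1 : R) (0 : R) 1) h3.
  apply: is_derive_eq h4 _; rewrite /cst/= c0 dotvNl.
  by field; rewrite gt_eqF// V0.
elim: (l) term => [|w s IH] term.
  have -> : (fun t => \sum_(z <- [::]) 2^-1 * ln (2 * halfdist2 r z (c t))) = cst 0.
    by apply/funext => t; rewrite big_nil.
  by rewrite big_nil; exact: is_derive_cst.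
have -> : (fun t => \sum_(z <- w :: s) 2^-1 * ln (2 * halfdist2 r z (c t))) =
   (fun t => 2^-1 * ln (2 * halfdist2 r w (c t)) +
     \sum_(z <- s) 2^-1 * ln (2 * halfdist2 r z (c t))).
  by apply/funext => t; rewrite big_cons.
rewrite big_cons; apply: is_derive_addr; first exact/term/mem_head.
by apply: IH => u us; apply: term; rewrite in_cons us orbT.
Qed.

(** A curve with velocity g - g' shows that g - g' is orthogonal to itself. This identifies the
    value that [xget] selects in [riem_grad]. *)
Lemma is_riem_grad_unique f x g g' : sphere r x ->
  is_riem_grad (sphere r) f x g -> is_riem_grad (sphere r) f x g' -> g = g'.
Proof.
move=> xr [[c1 t1] d1] [[c2 t2] d2].
have x1 := curve_sphere_orthogonal t1; have x2 := curve_sphere_orthogonal t2.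
have [|c cv] := @tangent_sphere x (g - g') xr; first by rewrite dotvBr x1 x2 subrr.
have e1 := d1 _ _ cv; have e2 := d2 _ _ cv.
apply/eqP; rewrite -subr_eq0; apply/eqP/dotv_eq0; rewrite {1}dotvBl.
by rewrite -(@derive_val _ _ _ _ _ _ _ e1) -(@derive_val _ _ _ _ _ _ _ e2) subrr.
Qed.

Lemma forceE x : sphere r x -> x \notin l ->
  force (sphere r) L x = (2 * r ^+ 2 * wells r l x)^-1 *: flow_field r l x.
Proof.
move=> xr xl; have gE := is_riem_grad_potential xr xl.
have gP := @xgetPex _ 0 [set g | is_riem_grad (sphere r) (potential L) x g] (ex_intro _ _ gE).
by rewrite /force /riem_grad (is_riem_grad_unique xr gP gE) opprK.
Qed.

End force.

(** * Time change between the flow and the integral curves of the force *)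

Section time_change.
Context {R : realType} (r : R) (L : set 'rV[R]_3) (l : seq 'rV[R]_3) (d : R) (z : 'rV[R]_3).
Hypotheses (r_gt0 : 0 < r) (lr : {in l, forall w, sphere r w})
  (potentialE : potential L = fun x => \sum_(z <- l) ln (enorm (x - z)))
  (Ll : forall x, L x <-> x \in l)
  (d_gt0 : 0 < d)
  (hd : {in l, forall z, exists2 c, 0 < c & forall x, sphere r x ->
    halfdist2 r z x < d -> c * halfdist2 r z x <= dotv z (flow_field r l x)})
  (zl : z \in l).

Let r_ge0 : 0 <= r. Proof. exact: ltW. Qed.
Let SM (x : 'rV[R]_3) : sphere r x -> `|x| <= r. Proof. exact: sphere_norm. Qed.

(** The ratio of G to the force, which is dt/ds along an orbit, where s is the time of the flow and
    t that of the integral curve; [T] below gives t as a function of s. *)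
Let speed (x : 'rV[R]_3) : R := 2 * r ^+ 2 * wells r l x.

Let speed_gt0 x : sphere r x -> x \notin l -> 0 < speed x.
Proof. by move=> xr xl; rewrite !mulr_gt0 ?exprn_gt0// wells_gt0. Qed.

Let forceE' x : sphere r x -> x \notin l ->
  force (sphere r) L x = (speed x)^-1 *: flow_field r l x.
Proof. exact: forceE. Qed.

Let speed_smooth : smooth (sphere r) speed.
Proof.
apply: smooth_mul; first exact: smooth_cst.
by eexists; exact: (C11_wells r SM l).
Qed.

Section from_basin.
Variable x : 'rV[R]_3.
Hypotheses (xr : sphere r x) (xl : x \notin l).
Let Z := flow r l x.

Let Zr s : sphere r (Z s). Proof. exact: flow_sphere. Qed.

Let Zl s : Z s \notin l.
Proof.
apply/negP => Zl; move/negP: xl; apply.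
by rewrite (flow_eq_fixpoint r_gt0 xr (flow_field_mem lr Zl) (erefl _)).
Qed.

Let Zd (s : R) i : is_derive s 1 (fun s => Z s ord0 i) (flow_field r l (Z s) ord0 i).
Proof. exact: flow_derive. Qed.

Let Zc i : continuous (fun s => Z s ord0 i).
Proof. by move=> s; exact: is_derive_continuous (Zd s i). Qed.

Let T := primitive (fun s => speed (Z s)).

Let T_prop : T 0 = 0 /\ forall s : R, is_derive s 1 T (speed (Z s)).
Proof.
apply: primitiveP; have [C C0 CP] := bounded_lipschitz_of_smooth speed_smooth.
apply: (@lipschitz_comp_continuous _ Z _ C) => // s t.
by have [_] := CP _ _ (Zr t) (Zr s).
Qed.

Let T0 : T 0 = 0. Proof. by have [] := T_prop. Qed.
Let Td (s : R) : is_derive s 1 T (speed (Z s)). Proof. by have [_] := T_prop. Qed.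
Let Tc : continuous T. Proof. by move=> s; exact: is_derive_continuous (Td s). Qed.

Let T_lt a b : a < b -> T a < T b.
Proof.
move=> ab; have [|c _ E] := @MVT _ T (fun s => speed (Z s)) a b ab (fun s _ => Td s).
  exact: continuous_subspaceT.
by rewrite -subr_gt0 E mulr_gt0 ?subr_gt0// speed_gt0.
Qed.

Let T_inj : injective T.
Proof.
by move=> a b ab; apply/eqP; case: (ltgtP a b) => // /T_lt; rewrite ab ltxx.
Qed.

(* Backward in time [wells] increases along the flow, so T tends to -oo. *)
Let T_linear s : s <= 0 -> T s <= speed x * s.
Proof.
move=> s0.
have wd (u : R) : is_derive u 1 (fun s => speed (Z s))
    (2 * r ^+ 2 * dotv (- attraction r l (Z u)) (flow_field r l (Z u))).
  have := is_derive_mulr (is_derive_cst (2 * r ^+ 2) u 1)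
    (C11_chain (C11_wells r SM l) Zr (Zd u)).
  by rewrite mul0r add0r.
(* With A the attraction, the derivative of [wells] along the flow is -(|x|^2 |A|^2 - (x.A)^2) in
   Euclidean norms, nonpositive by the Cauchy-Schwarz inequality. *)
have wle u : 2 * r ^+ 2 * dotv (- attraction r l (Z u)) (flow_field r l (Z u)) <= 0.
  rewrite mulr_ge0_le0 ?mulr_ge0 ?sqr_ge0// dotvNl oppr_le0 /flow_field.
  rewrite dotvBr !dotvZr (dotvC _ (Z u)) -expr2 subr_ge0.
  exact: dotv_CauchySchwarz.
have le u : u <= 0 -> speed x <= speed (Z u).
  move=> u0; rewrite -{1}(flow0 l r_gt0 x).
  exact: (is_derive_nonincr u0 (fun t _ => wd t) (fun t _ => wle t)).
have := is_derive_compare s0 (fun t _ => is_derive_mulr_cst (speed x) t) (fun t _ => Td t).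
by rewrite T0 mulr0 !sub0r lerN2; apply => t /andP[_ t0]; exact: le.
Qed.

(** The limit of T as the flow time tends to infinity, taken in the extended reals so that finite
    and infinite ends are treated alike. *)
Let tau : \bar R := ereal_sup (range (EFin \o T)).

Let T_surj (t : R) : (t%:E < tau)%E -> exists s, T s = t.
Proof.
move=> /ereal_sup_gt[_ [s1 _ <-]]; rewrite lte_fin => ts1.
have sx0 := speed_gt0 xr xl.
(* By [T_linear], T(s0) <= [speed x] s0 <= t; this is the left end for the intermediate value
   theorem. *)
pose s0 := Num.min 0 (t / speed x).
have Ts0 : T s0 <= t.
  have s00 : s0 <= 0 by rewrite ge_min lexx.
  apply: (le_trans (T_linear s00)); rewrite mulrC -ler_pdivlMr//.
  by rewrite ge_min lexx orbT.
have s01 : s0 <= s1.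
  rewrite leNgt; apply/negP => /T_lt h.
  by have := lt_trans ts1 (lt_le_trans h Ts0); rewrite ltxx.
have [|s _ Ts] := @IVT _ T s0 s1 t s01 (continuous_subspaceT Tc); last by exists s.
have h := le_trans Ts0 (ltW ts1).
by rewrite min_l// max_r// Ts0 ltW.
Qed.

Let T_tau s : ((T s)%:E < tau)%E.
Proof.
have s1 : s < s + 1 by rewrite ltrDl.
apply: (@lt_le_trans _ _ (T (s + 1))%:E); first by rewrite lte_fin T_lt.
by apply: ereal_sup_ubound; exists (s + 1).
Qed.

Let sigma (t : R) : R := xget 0 [set s | T s = t].

Let T_sigma t : (t%:E < tau)%E -> T (sigma t) = t.
Proof. by move=> /T_surj[s sP]; exact: (@xgetPex _ 0 [set s | T s = t] (ex_intro _ s sP)). Qed.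

Let sigma_T s : sigma (T s) = s.
Proof. by apply: T_inj; rewrite T_sigma. Qed.

Let Y t := Z (sigma t).

Let Y_derive (t : R) : (t%:E < tau)%E -> is_derive t (1 : R) Y (force (sphere r) L (Y t)).
Proof.
move=> tt; apply/is_derive_rV => i; set s := sigma t.
have sd : is_derive t 1 sigma (speed (Z s))^-1.
  rewrite -[t in is_derive t _ _ _](T_sigma tt).
  apply: is_derive_inverse (Td s) _.
  - by near=> u; exact: sigma_T.
  - by near=> u; exact: Tc.
  - by rewrite gt_eqF// speed_gt0.
have h := @is_derive1_comp _ (fun u => Z u ord0 i) sigma t _ _ (Zd s i) sd.
by rewrite /Y -/s (forceE' (Zr s) (Zl s)) mxE [X in is_derive _ _ _ X]mulrC.
Unshelve. all: by end_near. Qed.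

Let Y_integral : integral_curve (sphere r) L x tau Y.
Proof.
split.
- by apply: lt_trans (T_tau 1); rewrite lte_fin -[X in X < _]T0 T_lt.
- by rewrite /Y -T0 sigma_T /Z flow0.
- move=> t tt; split; last exact: Y_derive.
  by split; [exact: Zr|move=> /Ll; exact/negP/Zl].
Qed.

(** Convergence is [basin_decay], since [sigma t] exceeds every bound as t tends to tau. As to
    maximality, a curve that continues Y past a finite tau would by continuity take the value z at
    tau, whereas integral curves avoid L. *)
Lemma basin_flows_to : basin r l z d x -> flows_to (sphere r) L x z.
Proof.
move=> xb; have zr := lr zl.
have Y_near (F : set_system R) : Filter F -> (forall s, \forall t \near F, T s < t) ->
    (\forall t \near F, (t%:E < tau)%E) -> Y t @[t --> F] --> z.
  move=> FF FT Ft; apply/cvgrPdist_le => e e0.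
  have e20 : 0 < e ^+ 2 / 2 by rewrite divr_gt0// exprn_gt0.
  have [s0 _ sP] := basin_decay r_gt0 lr hd zl xb e20.
  near=> t.
  have tt : (t%:E < tau)%E by near: t.
  have st : s0 <= sigma t.
    rewrite leNgt; apply/negP => /T_lt; rewrite T_sigma// ltNge => /negP; apply.
    by apply: ltW; near: t; exact: FT.
  rewrite distrC -ler_sqr ?nnegrE ?(ltW e0)//.
  apply: (le_trans (halfdist2_norm zr (Zr (sigma t)))).
  by have := sP _ st; rewrite -/Z ltr_pdivlMr// mulrC => /ltW.
have Yz : Y t @[t --> left_end tau] --> z.
  have T_lt_tau := T_tau; move: Y_near T_lt_tau; case: tau => [a| |] /= Y_near T_lt_tau.
  - apply: Y_near.
    + move=> s; apply: nbhs_left_gt; by have := T_lt_tau s; rewrite lte_fin.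
    + near=> t; rewrite lte_fin; near: t; exact: nbhs_left_lt.
  - apply: Y_near.
    + by move=> s; apply: nbhs_pinfty_gt; rewrite num_real.
    + by apply: nearW => t; rewrite ltry.
  - by have := T_lt_tau 0; rewrite ltNge leNye.
exists tau, Y; split=> //; split=> // tau' Y' [tau'0 Y'0 Y'd] YY'.
rewrite leNgt; apply/negP => lt_tau.
have T_lt_tau := T_tau.
move: Yz T_lt_tau lt_tau YY'; case: tau => [a| |] /= Yz T_lt_tau lt_tau YY'.
- have [[_ Y'L] Y'a] := Y'd a lt_tau.
  have Y'z : Y' a = z.
    have c1 : Y' t @[t --> a^'-] --> Y' a.
      by apply: cvg_at_left_filter; exact: is_derive_continuous Y'a.
    have c2 : Y' t @[t --> a^'-] --> z.
      apply: cvg_trans Yz; apply: near_eq_cvg; near=> t.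
      have ta : t < a by near: t; exact: nbhs_left_lt.
      have ta' : (t%:E < a%:E)%E by rewrite lte_fin.
      by apply/esym/YY' => //; exact: lt_trans ta' lt_tau.
    by apply: (cvg_unique _ c1 c2); exact: norm_hausdorff.
  by apply: Y'L; rewrite Y'z; apply/Ll.
- by move: lt_tau; rewrite ltNge leey.
- by have := T_lt_tau 0; rewrite ltNge leNye.
Unshelve. all: by end_near. Qed.

End from_basin.

(** For t1 >= 0, the retraction onto [0, t1]. An integral curve is controlled before tau only;
    composed with [clamp t1] it gives functions continuous on the whole line, as
    [continuous_primitive] requires. *)
Let clamp (t1 t : R) : R := Num.max 0 (Num.min t1 t).

Let clamp_itv t1 t : 0 <= t1 -> 0 <= clamp t1 t <= t1.
Proof.
by move=> t10; rewrite /clamp le_max lexx/= ge_max t10/= ge_min lexx.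
Qed.

Let clamp_id t1 t : 0 <= t <= t1 -> clamp t1 t = t.
Proof. by move=> /andP[t0 tt1]; rewrite /clamp min_r// max_r. Qed.

Let clamp_lip t1 a b : `|clamp t1 a - clamp t1 b| <= `|a - b|.
Proof.
wlog ab : a b / a <= b.
  by move=> H; have [/H//|/ltW/H] := leP a b; rewrite distrC (distrC a).
rewrite distrC (distrC a) [leRHS]ger0_norm ?subr_ge0// ler_norml; apply/andP.
by rewrite /clamp /Num.max /Num.min; split; do ! case: ifPn; rewrite -?leNgt; lra.
Qed.

Let clamp_continuous t1 : continuous (clamp t1).
Proof.
move=> t; apply/cvgrPdist_le => /= e e0; near=> s.
apply: (le_trans (clamp_lip _ _ _)); near: s; exact: cvgr_dist_le.
Unshelve. all: by end_near. Qed.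

(** Let S be the primitive of 1 / [speed] along Y. On [0, t1], Y(t) and the flow at time S(t) both
    solve w' = f(t) G(w) from x. With f frozen as a function of time, the singular force becomes a
    field that is Lipschitz in w, and Gronwall's lemma applies. *)
Lemma integral_curve_time_change x tau Y t1 : sphere r x ->
  integral_curve (sphere r) L x tau Y -> (t1%:E < tau)%E -> 0 <= t1 ->
  exists2 s, 0 <= s & Y t1 = flow r l x s.
Proof.
move=> xr [tau0 Y0 Yd] t1tau t10.
have ttau t : t <= t1 -> (t%:E < tau)%E by move=> tt; apply: le_lt_trans t1tau; rewrite lee_fin.
have Yr t : t <= t1 -> sphere r (Y t) /\ Y t \notin l.
  by move=> /ttau/Yd[[? YL] _]; split=> //; apply/negP => /Ll.
have Yder (t : R) i : t <= t1 -> is_derive t 1 (fun s => Y s ord0 i)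
    ((speed (Y t))^-1 * flow_field r l (Y t) ord0 i).
  move=> tt; have [yr yl] := Yr t tt; have [_] := Yd t (ttau t tt).
  by rewrite forceE'// => /is_derive_rV/(_ i); rewrite mxE.
pose f t := (speed (Y (clamp t1 t)))^-1.
have cr t : sphere r (Y (clamp t1 t)) /\ Y (clamp t1 t) \notin l.
  by apply: Yr; have /andP[] := clamp_itv t t10.
have cY i : continuous (fun t => Y (clamp t1 t) ord0 i).
  move=> t; apply: (@continuous_comp _ _ _ (clamp t1) (fun s => Y s ord0 i)).
    exact: clamp_continuous.
  have /andP[_ ct] := clamp_itv t t10.
  exact: is_derive_continuous (Yder _ i ct).
have fgt0 t : 0 < f t by rewrite invr_gt0; have [yr yl] := cr t; exact: speed_gt0.
have fc : continuous f.
  have sc : continuous (fun t => speed (Y (clamp t1 t))).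
    have [C C0 CP] := bounded_lipschitz_of_smooth speed_smooth.
    apply: (@lipschitz_comp_continuous _ (fun t => Y (clamp t1 t)) _ C) => // s t.
    by have [ys _] := cr s; have [yt _] := cr t; have [_] := CP _ _ yt ys.
  move=> t; apply: (@cvgV _ _ _ _ (fun t => speed (Y (clamp t1 t)))); last exact: sc.
  by have [yr yl] := cr t; rewrite gt_eqF// speed_gt0.
have [S [S0 Sd]] := continuous_primitive fc.
have S_ge0 : 0 <= S t1.
  have := @is_derive_compare _ (fun=> 0) (fun=> 0) S f 0 t1 t10
    (fun t _ => is_derive_cst 0 t 1) (fun t _ => Sd t).
  by rewrite S0 !subr0; apply => t _; exact: ltW.
have [B BP] : exists B, forall t, 0 <= t <= t1 -> f t <= B.
  have [c _ cP] := @EVT_max _ f 0 t1 t10 (continuous_subspaceT fc).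
  by exists (f c) => t tt; apply: cP; rewrite in_itv.
have [C C1 CP] := smooth_lipschitz (smooth_flow_field r SM l).
have C0 : 0 <= C by exact: le_trans C1.
have B0 : 0 <= B by apply: le_trans (BP 0 _); [exact: ltW|rewrite lexx].
exists (S t1) => //; apply/eqP; rewrite -subr_eq0 -normr_le0.
have := @gronwall _ (fun t => Y t - flow r l x (S t)) (fun t =>
  f t *: (flow_field r l (Y t) - flow_field r l (flow r l x (S t)))) (B * C) 0 t1
  (mulr_ge0 B0 C0) (lexx _) t10.
rewrite S0 Y0 flow0// subrr normr0 addr0 mulr0; apply => [t /andP[t0 tt1] i|t tt].
  have -> : (fun t => (Y t - flow r l x (S t)) ord0 i) =
      (fun t => Y t ord0 i - flow r l x (S t) ord0 i).
    by apply/funext => s; rewrite rV_subE.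
  have fE : f t = (speed (Y t))^-1 by rewrite /f clamp_id// t0.
  have := is_derive_subr (Yder t i tt1) (@is_derive1_comp _ (fun u => flow r l x u ord0 i) S t _ _
    (flow_derive l r_gt0 (S t) i xr) (Sd t)).
  have scaleE (c : R) (a b : 'rV[R]_3) : (c *: (a - b)) ord0 i = c * a ord0 i - b ord0 i * c.
    by rewrite !mxE; ring.
  by rewrite scaleE fE.
rewrite addr0 normrZ -mulrA ler_pM//.
  by rewrite ger0_norm ?BP// ltW.
have /andP[_ tt1] := tt; have [yr _] := Yr t tt1.
by have [] := CP _ _ yr (flow_sphere l r_gt0 (S t) xr).
Qed.

Lemma flows_to_basin x : sphere r x -> flows_to (sphere r) L x z -> basin r l z d x.
Proof.
move=> xr [tau [Y [[YI _] Yz]]]; have zr := lr zl; have [tau0 Y0 Yd] := YI.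
(* Sup distance at most e from z gives 2 V_z <= 3 e^2 <= 3 e <= d, hence V_z < d. *)
pose e := Num.min 1 (d / 3).
have e0 : 0 < e by rewrite lt_min ltr01 divr_gt0.
have [t [t0 ttau tz]] : exists t, [/\ 0 <= t, (t%:E < tau)%E & `|z - Y t| <= e].
  have {}Yz := (cvgrPdist_le _ _).1 Yz _ e0.
  move: tau0 Yz; clear YI Yd; case: tau => [a| |] //=; rewrite ?lte_fin => a0 Yz.
  - have [t tP] : exists t, 0 < t /\ t < a /\ `|z - Y t| <= e.
      apply: (@filter_ex _ (a^'-)); near=> t; split; first by near: t; exact: nbhs_left_gt.
      by split; near: t; [exact: nbhs_left_lt|exact: Yz].
    by case: tP => t0 [ta tz]; exists t; split; rewrite ?lte_fin// ltW.
  - have [t tP] : exists t, 0 < t /\ `|z - Y t| <= e.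
      apply: (@filter_ex _ (pinfty_nbhs R)); near=> t; split; near: t; last exact: Yz.
      by apply: nbhs_pinfty_gt; rewrite num_real.
    by case: tP => t0 tz; exists t; split; rewrite ?ltry// ltW.
have [s s0 Ys] := integral_curve_time_change xr YI ttau t0.
split=> //; exists s => //; rewrite -Ys.
have [[Yr _] _] := Yd t ttau.
have h1 : 2 * halfdist2 r z (Y t) <= 3 * e ^+ 2.
  rewrite halfdist2E//; apply: (le_trans (ler_norm _)); apply: (le_trans (normr_dotv _ _)).
  rewrite -mulrA -expr2 ler_wpM2l// ler_sqr ?nnegrE ?(ltW e0)//.
  by rewrite distrC.
have e1 : e <= 1 by rewrite ge_min lexx.
have ed : e <= d / 3 by rewrite ge_min lexx orbT.
have e2 : e ^+ 2 <= e by rewrite expr2 ler_piMr// ltW.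
have := d_gt0; lra.
Unshelve. all: by end_near. Qed.

End time_change.

(** * From basins to the allocation *)

Section allocation.
Context {R : realType} (r : R) (L : set 'rV[R]_3) (l : seq 'rV[R]_3) (d : R).
Hypotheses (r_gt0 : 0 < r) (ul : uniq l) (lr : {in l, forall w, sphere r w})
  (potentialE : potential L = fun x => \sum_(z <- l) ln (enorm (x - z)))
  (Ll : forall x, L x <-> x \in l)
  (d_gt0 : 0 < d)
  (hd : {in l, forall z, exists2 c, 0 < c & forall x, sphere r x ->
    halfdist2 r z x < d -> c * halfdist2 r z x <= dotv z (flow_field r l x)})
  (area : 4 * pi * r ^+ 2 = (size l)%:R).

Let psi := gravitational_allocation (sphere r) L.

Lemma allocation_mem x z : psi x = Some z -> z \in l.
Proof.
rewrite /psi /gravitational_allocation; case: (pselect (L x)) => [Lx|nLx].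
  by move=> /Some_inj <-; exact/Ll.
by case: pselect => // e /Some_inj <-; apply/Ll; case: (projT2 (cid e)).
Qed.

(** The point picked by [cid] is one whose basin contains x; disjointness of the basins leaves no
    other. For x in L the convention agrees with [basin_self]. *)
Lemma allocation_basin x z : sphere r x -> z \in l -> psi x = Some z <-> basin r l z d x.
Proof.
move=> xr zl; rewrite /psi /gravitational_allocation.
case: (pselect (L x)) => [Lx|Lx].
  have xl := (Ll x).1 Lx; have xb := basin_self r_gt0 lr d_gt0 xl.
  split=> [/Some_inj <-//|zb]; congr Some.
  exact: (basin_disjoint r_gt0 lr hd xl zl xb zb).
have xl : x \notin l by apply/negP => /Ll.
have toB w : w \in l -> flows_to (sphere r) L x w -> basin r l w d x.
  by move=> wl; exact: (flows_to_basin r_gt0 lr potentialE Ll d_gt0 wl xr).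
case: pselect => [e|ne]; last first.
  split=> // zb; exfalso; apply: ne; exists z; split; first exact/Ll.
  exact: (basin_flows_to r_gt0 lr potentialE Ll hd zl xr xl zb).
case: (cid e) => w [/Ll wl xw] /=; have wb := toB w wl xw; split=> [/Some_inj <-//|zb].
by congr Some; exact: (basin_disjoint r_gt0 lr hd wl zl wb zb).
Qed.

Let mu : {measure set (borelR3 R) -> \bar R} := sphere_area r.
Let U (s : seq 'rV[R]_3) : set (borelR3 R) := \bigcup_(w in [set` s]) basin r l w d.

Let U_cons w s : U (w :: s) = basin r l w d `|` U s.
Proof.
apply/seteqP; split=> x.
  by move=> [v /=]; rewrite in_cons => /predU1P[->|vs] vx; [left|right; exists v].
move=> [wx|[v /= vs vx]]; first by exists w => //=; exact: mem_head.
by exists v => //=; rewrite in_cons vs orbT.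
Qed.

Let U_nil : U [::] = set0.
Proof. by apply/seteqP; split=> x // [v]. Qed.

Let measurable_U s : {subset s <= l} -> measurable (U s).
Proof.
elim: s => [|w s IH] sl; first by rewrite U_nil.
rewrite U_cons; apply: measurableU.
  by apply: (measurable_basin r_gt0 lr hd); apply: sl; exact: mem_head.
by apply: IH => v vs; apply: sl; rewrite in_cons vs orbT.
Qed.

Let area_U s : uniq s -> {subset s <= l} -> mu (U s) = (size s)%:R%:E.
Proof.
elim: s => [|w s IH] us sl; first by rewrite U_nil measure0.
have wl : w \in l by apply: sl; exact: mem_head.
have sl' : {subset s <= l} by move=> v vs; apply: sl; rewrite in_cons vs orbT.
move: us => /= /andP[ws us].
have mw := measurable_basin r_gt0 lr hd wl; have ms := measurable_U sl'.
have ws0 : basin r l w d `&` U s = set0.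
  apply/seteqP; split=> // x [wx [v /= vs vx]].
  by move: ws; rewrite (basin_disjoint r_gt0 lr hd wl (sl' v vs) wx vx) vs.
have aw : mu (basin r l w d) = 1%:E := basin_area_eq1 r_gt0 ul lr d_gt0 hd wl area.
rewrite U_cons; apply: etrans (measureU mu mw ms ws0) _.
by rewrite [X in (X + _)%E]aw [X in (_ + X)%E](IH us sl') -EFinD addrC natr1.
Qed.

Let psi_None : sphere r `&` psi @^-1` [set None] = sphere r `\` U l.
Proof.
apply/seteqP; split=> x [xr /= h]; split=> //.
  move=> [w /= wl wb]; have /(allocation_basin xr wl) := wb.
  by rewrite h.
case E : (psi x) => [w|//]; exfalso; apply: h; have wl := allocation_mem E.
by exists w => //; apply/(allocation_basin xr wl).
Qed.

Lemma fair_allocation_sphere : fair_allocation (sphere_area r) (sphere r) L psi.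
Proof.
have ll : {subset l <= l} by [].
have r_ge0 := ltW r_gt0.
split.
- by move=> x z xr /allocation_mem/Ll.
- move=> B.
  (* Only points of l and [None] occur as values, so an arbitrary B selects finitely many basins and
     possibly the complement of their union. *)
  have -> : sphere r `&` psi @^-1` B =
     (\bigcup_(w in [set` l]) (if `[< B (Some w) >] then basin r l w d else set0))
     `|` (if `[< B None >] then sphere r `\` U l else set0).
    apply/seteqP; split=> x.
      move=> [xr /=]; case E : (psi x) => [w|] Bw.
        have wl := allocation_mem E; left; exists w => //.
        by case: asboolP => // _; apply/(allocation_basin xr wl).
      by right; case: asboolP => // _; rewrite -psi_None.
    move=> [[w /= wl]|].
      case: asboolP => // Bw wb; have xr : sphere r x by case: wb.
      by split=> //=; rewrite ((allocation_basin xr wl).2 wb).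
    by case: asboolP => // BN; rewrite -psi_None => -[xr /= xN]; split=> //=; rewrite xN.
  apply: measurableU.
    apply: fin_bigcup_measurable => [|w wl]; first exact: finite_seq.
    by case: asboolP => // _; exact: (measurable_basin r_gt0 lr hd wl).
  case: asboolP => // _; apply: measurableD; first exact: measurable_sphere.
  exact: measurable_U.
- rewrite psi_None.
  have sE : mu (sphere r) = (size l)%:R%:E.
    by have := sphere_area_total r_ge0; rewrite osphereE// area.
  have sfin : (mu (sphere r) < +oo)%E by rewrite sE ltry.
  have sU : sphere r `&` U l = U l by apply/setIidr => x [w _ []].
  apply: etrans (measureD (measurable_sphere r) (measurable_U ll) sfin) _.
  by rewrite sU [X in (X - _)%E]sE [X in (_ - X)%E](area_U ul ll) -EFinB subrr.
- move=> z /Ll zl.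
  have -> : sphere r `&` psi @^-1` [set Some z] = basin r l z d.
    apply/seteqP; split=> x.
      by move=> [xr /= h]; apply/(allocation_basin xr zl).
    move=> xb; have xr : sphere r x by case: xb.
    by split=> //; apply/(allocation_basin xr zl).
  exact: (basin_area_eq1 r_gt0 ul lr d_gt0 hd zl area).
Qed.

End allocation.

Theorem proposition1 (R : realType) (n : nat) (n_gt0 : (0 < n)%N)
    (L : set 'rV[R]_3)
    (L_sphere : L `<=` osphere (radius_of_area n%:R)) (L_card : (L #= `I_n)%card) :
  fair_allocation (sphere_area (radius_of_area n%:R))
    (osphere (radius_of_area n%:R)) L
    (gravitational_allocation (osphere (radius_of_area n%:R)) L).
Proof.
set r := radius_of_area n%:R in L_sphere *.
have pi4 : 0 < 4 * pi :> R by rewrite mulr_gt0// pi_gt0.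
have r0 : 0 < r by rewrite sqrtr_gt0 divr_gt0// ltr0n.
have Lfin : finite_set L by exists n.
(* An enumeration of L without repetition: [wells] and [attraction] recurse over a list, and
   distinctness makes the trapping rates positive. *)
pose l := finmap.enum_fset (fset_set L).
have Ll x : L x <-> x \in l by rewrite in_fset_set// inE.
have lsize : size l = n.
  by have := card_fset_set L_card.
have lr : {in l, forall w, sphere r w}.
  by move=> w /Ll/L_sphere; rewrite osphereE// ltW.
have potE : potential L = fun x => \sum_(z <- l) ln (enorm (x - z)).
  by apply/funext => x; rewrite /potential fsbig_finite.
have area : 4 * pi * r ^+ 2 = (size l)%:R.
  rewrite lsize sqr_sqrtr; last by rewrite divr_ge0 ?(ltW pi4).
  by rewrite mulrC divfK// gt_eqF.
have ul : uniq l by exact: finmap.fset_uniq.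
have [d d0 hd] := trapping_radius r0 ul lr.
rewrite osphereE; last exact: ltW.
exact: (fair_allocation_sphere r0 ul lr potE Ll d0 hd area).
Qed.
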